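(* Let $w=11122322221$, $w^*=111223^*22221$, $\tau=12221\,w\,11123$ and $\tau^*=12221\,w^*\,11123$. Let $j_0=m(\overline{w^*})$, $$j_1=m\left(\overline{21}\,1232321212112221\,w\,w\,w^*\,w\,11121\,\overline{12}\right),\qquad i_1=m\left(\overline{21}\,123232111111112321\,\tau^*\,212111111111232321\,\overline{12}\right).$$ Let $F$ be the set consisting of the following words and their transposes: $13$, $32323$, $32322$, $1223221$, $21223222$, $1112232223$, $21112232222$, $11w$, $w2$, $321w11$, $221w112$, $1221w11$, $221w1111$, $22221w11123$, $32221w11123$, $32221w11122$, $332221w11121121$, $232221w1112112$, $2211111223222222$, $1211111223222222$, $33211111223222222$, $211111223222223$, $2111112232222221$, $2111112232222222$, $21111122322222233$, $123211111223222222321$, $2123211111223222222322$, $221\tau2$, $121\tau2$, $21\tau22$, $21\tau23$, $2121\tau$, $21\tau211$, $11121\tau$, $3321\tau2$, $321121\tau$, $221121\tau$, $121\tau33$, $121\tau321$, $121\tau322$, $21\tau2123$, $21\tau2122$, $212321\tau21211$, $12321\tau212112$, $21112321\tau2121111$, $1112321\tau21211112$, $2111112321\tau212111111$, $111112321\tau2121111112$, $11111112321\tau212111111112$, $211111112321\tau21211111111$, $1111111112321\tau21211111111$, $11111112321\tau2121111111111$, and $22221w11122$. Then $$(M\setminus L)\cap(i_1,j_1)=C\cup D\cup X,$$ where $$C=\{\lambda_0(\gamma\,21212112221\,w\,w^*\,\overline{w})\;:\;\gamma\,21212112221\,w\,w\in\{1,2,3\}^{\mathbb{N}}\ \text{does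 not contain any word from } F\}$$ is a Cantor set, and $$D=\{\lambda_0(\overline{w^T}\,w\,w\,12221121212\,\theta\,21212112221\,w\,w^*\,\overline{w}):\ \theta \text{ a finite word in } 1,2,3,\ [0;\theta]\ge[0;\theta^T],\ 12221121212\,\theta\,21212112221 \text{ does not contain any word from } F\},$$ $$X=\{\lambda_0(\overline{w^T}ww122211212121212112221ww^*\overline{w}),\ \lambda_0(\overline{w^T}ww1222112121212112221ww^*\overline{w}),\ \lambda_0(\overline{w^T}ww12221121212112221ww^*\overline{w})\}$$ are sets of isolated points of $M$.
   Context: For a bi-infinite sequence $B=(b_n)_{n\in\mathbb{Z}}$ of positive integers, $\lambda_k(B)=[b_k;b_{k+1},\dots]+[0;b_{k-1},b_{k-2},\dots]$, $m(B)=\sup_k\lambda_k(B)$, $\ell(B)=\limsup_{k\to\infty}\lambda_k(B)$, $M=\{m(B)<\infty\}$, $L=\{\ell(B)<\infty\}$. Words are finite strings of positive integers written by concatenation; the transpose of $v=v_1\dots v_n$ is $v^T=v_n\dots v_1$. In each expression exactly one letter is starred and sits at position $0$. An overline at the left end of an expression denotes the word repeated infinitely to the left, at the right end repeated infinitely to the right; $\gamma$ denotes a left-infinite word (written $\gamma\cdots\in\{1,2,3\}^{\mathbb{N}}$), placed to the left of the displayed finite word. $\overline{v^*}$ is the bi-infinite periodic sequence repeating $v$ with its starred letter at position $0$; $m(\cdot)$, $\lambda_0(\cdot)$ of an expression refer to the bi-infinite sequence described. A (possibly infinite) word ''contains'' a word if the latter appears as a block of consecutive letters. For a finite word $\theta=\theta_1\dots\theta_k$,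 $[0;\theta]=[0;\theta_1,\dots,\theta_k]$.
   Formalization: In D and X the left block \overline{w^T}ww before 12221121212 (resp. the middle word) is read as \overline{w^T}w^Tw^T; as printed, w^T followed by w contains the forbidden word 11w and the stated equality fails. *)

(* Defs.v *)
From mathcomp Require Import all_boot all_order all_algebra.
From mathcomp Require Import all_classical all_reals all_analysis.

Set Implicit Arguments.
Unset Strict Implicit.
Unset Printing Implicit Defensive.

Import Order.TTheory GRing.Theory Num.Theory numFieldNormedType.Exports.

Local Open Scope classical_set_scope.
Local Open Scope ring_scope.

Fixpoint digits (d : Decimal.uint) : seq nat :=
  match d with
  | Decimal.Nil => [::]
  | Decimal.D0 d => 0%N :: digits d
  | Decimal.D1 d => 1%N :: digits d
  | Decimal.D2 d => 2%N :: digits d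
  | Decimal.D3 d => 3%N :: digits d
  | Decimal.D4 d => 4%N :: digits d
  | Decimal.D5 d => 5%N :: digits d
  | Decimal.D6 d => 6%N :: digits d
  | Decimal.D7 d => 7%N :: digits d
  | Decimal.D8 d => 8%N :: digits d
  | Decimal.D9 d => 9%N :: digits d
  end.

(* A finite word is a [seq nat] read from left to right.  Numerals below are
   parsed as digit strings, never as numbers: [word 1232] is [:: 1; 2; 3; 2]. *)
Definition word (d : Number.uint) : seq nat :=
  if d is Number.UIntDecimal d' then digits d' else [::].

Arguments word d%_dec_uint_scope.

(* A right-infinite word is a function [r : nat -> nat] with first letter
   [r 0].  A left-infinite word is a function [l : nat -> nat] indexed from its
   right end: it reads ... (l 2) (l 1) (l 0). *)
Definition rcat (v : seq nat) (r : nat -> nat) (n : nat) : nat :=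
  if (n < size v)%N then nth 0%N v n else r (n - size v)%N.

Definition lcat (l : nat -> nat) (u : seq nat) : nat -> nat := rcat (rev u) l.

Definition rperiodic (v : seq nat) (n : nat) : nat := nth 0%N v (n %% size v).

Definition lperiodic (v : seq nat) : nat -> nat := rperiodic (rev v).

(* The bi-infinite sequence  l u v r  whose position 0 is the first letter of
   [v r] ([Negz n] is the integer -(n+1)).  An expression with one starred
   letter is encoded by splitting its finite part just before that letter. *)
Definition biseq (l : nat -> nat) (u v : seq nat) (r : nat -> nat)
    (i : int) : nat :=
  match i with
  | Posz n => rcat v r n
  | Negz n => lcat l u n
  end.

Definition lcontains (l : nat -> nat) (v : seq nat) : Prop :=
  exists k, mkseq (fun i => l (k + i)%N) (size v) = rev v.

(* [0; theta] for a finite word, with [0; ] = 0 for the empty word. *)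
Definition cf_fin (R : realType) (s : seq nat) : R :=
  foldr (fun a x => (a%:R + x)^-1) 0 s.

(* [0; a_0, a_1, ...] *)
Definition cf (R : realType) (a : nat -> nat) : R :=
  limn (fun n => cf_fin R (mkseq a n)).

Definition lambda (R : realType) (B : int -> nat) (k : int) : R :=
  (B k)%:R + cf R (fun n => B (k + n.+1%:Z)) + cf R (fun n => B (k - n.+1%:Z)).

Definition markov_value (R : realType) (B : int -> nat) : \bar R :=
  ereal_sup [set (lambda R B k)%:E | k in [set: int]].

Definition lagrange_value (R : realType) (B : int -> nat) : \bar R :=
  limn_esup (fun k : nat => (lambda R B k%:Z)%:E).

Definition markov_spectrum (R : realType) : set R :=
  [set x | exists B : int -> nat,
    (forall i, (0 < B i)%N) /\ markov_value R B = x%:E].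
Arguments markov_spectrum : clear implicits.

Definition lagrange_spectrum (R : realType) : set R :=
  [set x | exists B : int -> nat,
    (forall i, (0 < B i)%N) /\ lagrange_value R B = x%:E].
Arguments lagrange_spectrum : clear implicits.

Definition w : seq nat := word 11122322221.

(* w^* = wl 3^* ..., that is, w = wl ++ wr and [wr] starts with the starred
   letter. *)
Definition wl : seq nat := word 11122.
Definition wr : seq nat := word 322221.

Definition tau : seq nat := word 12221 ++ w ++ word 11123.

Definition j1 (R : realType) : \bar R :=
  markov_value R
    (biseq (lperiodic (word 21))
       (word 1232321212112221 ++ w ++ w ++ wl)
       (wr ++ w ++ word 11121)
       (rperiodic (word 12))).

Definition i1 (R : realType) : \bar R :=
  markov_value R
    (biseq (lperiodic (word 21))
       (word 123232111111112321 ++ word 12221 ++ wl)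
       (wr ++ word 11123 ++ word 212111111111232321)
       (rperiodic (word 12))).

Definition forbidden_base : seq (seq nat) :=
  [:: word 13; word 32323; word 32322; word 1223221; word 21223222;
      word 1112232223; word 21112232222;
      word 11 ++ w; w ++ word 2; word 321 ++ w ++ word 11;
      word 221 ++ w ++ word 112; word 1221 ++ w ++ word 11;
      word 221 ++ w ++ word 1111; word 22221 ++ w ++ word 11123;
      word 32221 ++ w ++ word 11123; word 32221 ++ w ++ word 11122;
      word 332221 ++ w ++ word 11121121; word 232221 ++ w ++ word 1112112;
      word 2211111223222222; word 1211111223222222; word 33211111223222222;
      word 211111223222223; word 2111112232222221; word 2111112232222222;
      word 21111122322222233; word 123211111223222222321;
      word 2123211111223222222322;
      word 221 ++ tau ++ word 2; word 121 ++ tau ++ word 2;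
      word 21 ++ tau ++ word 22; word 21 ++ tau ++ word 23;
      word 2121 ++ tau; word 21 ++ tau ++ word 211; word 11121 ++ tau;
      word 3321 ++ tau ++ word 2; word 321121 ++ tau; word 221121 ++ tau;
      word 121 ++ tau ++ word 33; word 121 ++ tau ++ word 321;
      word 121 ++ tau ++ word 322; word 21 ++ tau ++ word 2123;
      word 21 ++ tau ++ word 2122; word 212321 ++ tau ++ word 21211;
      word 12321 ++ tau ++ word 212112;
      word 21112321 ++ tau ++ word 2121111;
      word 1112321 ++ tau ++ word 21211112;
      word 2111112321 ++ tau ++ word 212111111;
      word 111112321 ++ tau ++ word 2121111112;
      word 11111112321 ++ tau ++ word 212111111112;
      word 211111112321 ++ tau ++ word 21211111111;
      word 1111111112321 ++ tau ++ word 21211111111;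
      word 11111112321 ++ tau ++ word 2121111111111;
      word 22221 ++ w ++ word 11122].

Definition forbidden : seq (seq nat) := forbidden_base ++ map rev forbidden_base.

Definition cantor_part (R : realType) : set R :=
  [set x | exists gamma : nat -> nat,
    let u := lcat gamma (word 21212112221 ++ w ++ w) in
    [/\ forall n, u n \in [:: 1; 2; 3]%N,
        forall f, f \in forbidden -> ~ lcontains u f
      & x = lambda R (biseq gamma (word 21212112221 ++ w ++ wl) wr
                        (rperiodic w)) 0]].
Arguments cantor_part : clear implicits.

(* lambda_0 of  \overline{w^T} w^T w^T v w w^* \overline{w}.  The left tail is
   the mirror image of the right one, so the two copies of w to the left of v
   are transposed. *)
Definition two_sided_value (R : realType) (v : seq nat) : R :=
  lambda R (biseq (lperiodic (rev w)) (rev w ++ rev w ++ v ++ w ++ wl) wr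
              (rperiodic w)) 0.

Definition two_sided_part (R : realType) : set R :=
  [set x | exists theta : seq nat,
    let v := word 12221121212 ++ theta ++ word 21212112221 in
    [/\ all (mem [:: 1; 2; 3]%N) theta,
        cf_fin R (rev theta) <= cf_fin R theta,
        forall f, f \in forbidden -> ~~ infix f v
      & x = two_sided_value R v]].
Arguments two_sided_part : clear implicits.

Definition exceptional_part (R : realType) : set R :=
  [set two_sided_value R (word 122211212121212112221);
       two_sided_value R (word 1222112121212112221);
       two_sided_value R (word 12221121212112221)].
Arguments exceptional_part : clear implicits.

(* The library's [cantor_like] does not exclude the empty space. *)
Definition cantor_set (R : realType) (A : set R) : Prop :=
  A !=set0 /\ cantor_like (set_type A).

(* Main.v *)
(** Every value above [i1] forces, around the position where it is attained, the
    word [22221 w 11122] or its transpose: the other ways of reaching such a value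
    are excluded by the forbidden words, by a finite search over windows in which
    the unknown tails of the continued fractions are bounded by 0 and 1.  The
    endpoints [i1] and [j1] are the only values that this search cannot separate;
    there both tails are compared with [1 2 1 2 ...], the largest word without 13.

    Below [j1] a second search shows that [22221 w 11122] reproduces itself to the
    right for ever, and that to the left a run of copies of [w] either never stops,
    which gives the value [j0], or starts with [21212112221 w w].  The maximum is
    then at the second copy of [w].  To the left of the run, either the same word
    never occurs again, which gives the Cantor set, or its transpose occurs, which
    gives a run of copies of the transpose of [w] that is infinite to the left.

    The set of sequences is compact, so values of the Markov spectrum are attained,
    and a value of the Lagrange spectrum is attained by a limit of shifts; since
    runs of [w] never end, only [j0] is possible there.  The same compactness
    shows that the two-sided values are isolated: a nearby value comes from a
    sequence that agrees with the given one on a long window, hence everywhere. *)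
Require Import Defs.
From mathcomp Require Import all_boot all_order all_algebra.
From mathcomp Require Import all_classical all_reals all_analysis.
From mathcomp Require Import lra ring zify.
From Stdlib Require BinNat.
Import Order.TTheory GRing.Theory Num.Theory numFieldNormedType.Exports.
Local Open Scope classical_set_scope.
Local Open Scope ring_scope.

Set Implicit Arguments.
Unset Strict Implicit.
Unset Printing Implicit Defensive.

(** * Continued fractions *)

(** One comparison separates the two spectra here. Read leftwards from its star, the second copy of
    [w] in a run that starts after 12221 meets the letter 1 at index 20; every later copy, and the
    periodic sequence, meets 2 there. Index 20 is even, so the smaller letter gives the larger
    fraction, and the value exceeds those of the later copies and [j0]. The word 22221 w 11122 at
    the end of the list differs from the others: it is not excluded below [j1], it is what produces
    the values. In C it is forbidden only up to the end of the starred copy of [w]. In a two-sided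
    sequence both ends of the middle word compete for the maximum, and the condition on theta says
    that the starred end does not lose. X comes from middle words in which 12221121212 and
    21212112221 overlap, so that no theta exists; these words are palindromes and their two ends
    have the same value. The searches are evaluated by the virtual machine, hence the bounds by
    fractions of binary numbers. *)

Definition pos (a : nat -> nat) : Prop := forall n, (0 < a n)%N.
Definition shift (n : nat) (a : nat -> nat) (i : nat) : nat := a (n + i)%N.
Definition pre (s : seq nat) (a : nat -> nat) : Prop := mkseq a (size s) = s.

Lemma shiftD m n a : shift m (shift n a) = shift (n + m) a.
Proof. by apply/funext => i; rewrite /shift addnA. Qed.

Lemma shift0 a : shift 0 a = a.
Proof. by []. Qed.

Lemma pos_shift n a : pos a -> pos (shift n a).
Proof. by move=> ap i; exact: ap. Qed.

Lemma mkseqD (a : nat -> nat) m n :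
  mkseq a (m + n) = mkseq a m ++ mkseq (shift m a) n.
Proof.
by rewrite /mkseq iotaD map_cat add0n -{2}(addn0 m) iotaDl -map_comp.
Qed.

Lemma preP s a : pre s a <-> forall i, (i < size s)%N -> a i = nth 0%N s i.
Proof.
split => [<- i|h]; first by rewrite size_mkseq => ?; rewrite nth_mkseq.
by apply: (@eq_from_nth _ 0%N); rewrite size_mkseq // => i ?; rewrite nth_mkseq // h.
Qed.

Lemma pre_mkseq a n : pre (mkseq a n) a.
Proof. by rewrite /pre size_mkseq. Qed.

Lemma pre_cat s t a : pre (s ++ t) a <-> pre s a /\ pre t (shift (size s) a).
Proof.
rewrite /pre size_cat mkseqD; split=> [/eqP|[-> ->]//].
by rewrite eqseq_cat ?size_mkseq // => /andP[/eqP -> /eqP ->].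
Qed.

Lemma pre_cons c s a : pre (c :: s) a <-> a 0%N = c /\ pre s (shift 1 a).
Proof.
rewrite -cat1s pre_cat {1}/pre /mkseq /=.
by split=> -[h1 h2]; split=> //; [case: h1|rewrite h1].
Qed.

Lemma pre_rcons c s a : pre (rcons s c) a <-> pre s a /\ a (size s) = c.
Proof.
rewrite -cats1 pre_cat {2}/pre /mkseq /= /shift addn0.
by split=> -[h1 h2]; split=> //; [case: h2|rewrite h2].
Qed.

Lemma pre_pos s a : pos a -> pre s a -> all (fun c => (0 < c)%N) s.
Proof.
move=> ap <-; apply/allP => x /mapP[i _ ->]; exact: ap.
Qed.

Section CF.
Variable R : realType.
Implicit Types (s t : seq nat) (x y : R) (a b : nat -> nat).

Definition cft s x : R := foldr (fun c x => (c%:R + x)^-1) x s.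

Notation posw := (all (fun c => (0 < c)%N)).

Lemma cft_cat s t x : cft (s ++ t) x = cft s (cft t x).
Proof. by rewrite /cft foldr_cat. Qed.

Lemma natr_ge1 (c : nat) : (0 < c)%N -> 1 <= c%:R :> R.
Proof. by rewrite ler1n. Qed.

Lemma cft_itv s x : posw s -> 0 <= x <= 1 -> 0 <= cft s x <= 1.
Proof.
move=> + x01; elim: s => //= c s ih /andP[c0 /ih/andP[h0 h1]].
have c1 := natr_ge1 c0.
rewrite invr_ge0 invf_le1; lra.
Qed.

Lemma inv_lip (c : nat) x y : (0 < c)%N -> 0 <= x -> 0 <= y ->
  `|(c%:R + x)^-1 - (c%:R + y)^-1| <= `|x - y|.
Proof.
move=> c0 x0 y0; have c1 := natr_ge1 c0.
have -> : (c%:R + x)^-1 - (c%:R + y)^-1 = (y - x) / ((c%:R + x) * (c%:R + y)).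
  by field; apply/andP; split; lra.
rewrite normrM distrC ler_piMr // normfV ger0_norm; last by nra.
by rewrite invf_le1; nra.
Qed.

(** One letter need not contract (c = 1, x = 0), but two letters contract by 1/4. The induction in
    [cft_lip] therefore removes two letters at a time, and the factor 2 there pays for an odd one
    left over. *)
Lemma inv2_lip (c d : nat) x y : (0 < c)%N -> (0 < d)%N -> 0 <= x -> 0 <= y ->
  `|(c%:R + (d%:R + x)^-1)^-1 - (c%:R + (d%:R + y)^-1)^-1| <= `|x - y| / 4.
Proof.
move=> c0 d0 x0 y0; have c1 := natr_ge1 c0; have d1 := natr_ge1 d0.
set c' : R := c%:R in c1 *; set d' : R := d%:R in d1 *.
have hx : 2 <= c' * (d' + x) + 1 by nra.
have hy : 2 <= c' * (d' + y) + 1 by nra.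
have -> : (c' + (d' + x)^-1)^-1 - (c' + (d' + y)^-1)^-1 =
    (x - y) / ((c' * (d' + x) + 1) * (c' * (d' + y) + 1)).
  by field; rewrite ?gt_eqF //; nra.
rewrite normrM ler_wpM2l // normfV ger0_norm; last by nra.
rewrite lef_pV2 ?posrE; nra.
Qed.

Lemma cft_lip s x y : posw s -> 0 <= x <= 1 -> 0 <= y <= 1 ->
  `|cft s x - cft s y| <= 2 * (2 ^+ size s)^-1 * `|x - y|.
Proof.
move=> + hx hy.
have [n] := ubnP (size s); elim: n s => // n ih [|c [|d s]] /=.
- by move=> _ _; rewrite expr0 invr1 mulr1; have := normr_ge0 (x - y); lra.
- rewrite andbT expr1 => _ c0; rewrite divff ?mul1r //; apply: inv_lip => //; lra.
move=> sn /and3P[c0 d0 sp].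
have /andP[? ?] := cft_itv sp hx; have /andP[? ?] := cft_itv sp hy.
apply: le_trans (inv2_lip c0 d0 _ _) _ => //.
have := ih s (ltnW sn) sp.
rewrite !exprS !invfM.
set A := `|cft _ _ - _|; set B := `|x - y|; set C := (2 ^+ _)^-1.
lra.
Qed.

Lemma cft_mono s x y : posw s -> 0 <= x -> x < y ->
  if odd (size s) then cft s y < cft s x else cft s x < cft s y.
Proof.
move=> + x0 xy.
have y0 : 0 <= y by lra.
have nn t z : 0 <= z -> 0 <= cft t z.
  by move=> z0; elim: t => //= c t ih; rewrite invr_ge0 addr_ge0.
elim: s => //= c s ih /andP[c0 /ih]; have c1 := natr_ge1 c0.
have := nn s _ x0; have := nn s _ y0; rewrite -!/(cft _ _).
by case: odd => /= ? ? ?; rewrite ltf_pV2 ?posrE; lra.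
Qed.

Lemma cft_mono_le s x y : posw s -> 0 <= x -> x <= y ->
  if odd (size s) then cft s y <= cft s x else cft s x <= cft s y.
Proof.
move=> sp x0; rewrite le_eqVlt => /predU1P[->|]; first by case: ifP.
by move/(cft_mono sp x0); case: odd => /ltW.
Qed.

Lemma exprn_half_lt (e : R) : 0 < e -> exists n, 2 * (2 ^+ n)^-1 < e.
Proof.
move=> e0; have e20 : 0 < e / 2 by lra.
have [N _ /(_ N (leqnn _)) /=] := near_infty_natSinv_expn_lt (PosNum e20).
by rewrite div1r => h; exists N; lra.
Qed.

Lemma cf_cvg a : pos a -> cvgn (fun n => cf_fin R (mkseq a n)).
Proof.
move=> ap; apply/cauchy_cvgP/cauchy_exP => e e0.
have [N hN] := exprn_half_lt e0.
exists (cf_fin R (mkseq a N)); exists N => // n /= Nn.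
rewrite /ball /= (le_lt_trans _ hN) // -(subnKC Nn) mkseqD.
rewrite -[cf_fin R _]/(cft _ _) -[X in _ - X]/(cft _ _) cft_cat.
have wp k (b : nat -> nat) : pos b -> posw (mkseq b k).
  by move=> bp; apply: pre_pos bp _; exact: pre_mkseq.
have h01 : 0 <= (0 : R) <= 1 by lra.
have h := @cft_itv (mkseq (shift N a) (n - N)) 0 (wp _ _ (pos_shift N ap)) h01.
apply: le_trans (cft_lip (wp _ _ ap) h01 h) _.
rewrite size_mkseq ler_piMr ?mulr_ge0 ?invr_ge0 ?exprn_ge0 //.
by rewrite sub0r normrN ger0_norm; lra.
Qed.

Lemma cf_ge0 a : pos a -> 0 <= cf R a.
Proof.
move=> ap; apply: limr_ge; first exact: cf_cvg.
by near=> n; have /andP[] := @cft_itv (mkseq a n) 0 (pre_pos ap (pre_mkseq _ _)) ltac:(lra).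
Unshelve. all: by end_near. Qed.

Lemma cf_cons a : pos a -> cf R a = ((a 0%N)%:R + cf R (shift 1 a))^-1.
Proof.
move=> ap; have ap1 := pos_shift 1 ap; apply/cvg_lim => //.
rewrite -cvg_shiftS.
rewrite (_ : [sequence _]_n =
    (fun n => ((a 0%N)%:R + cf_fin R (mkseq (shift 1 a) n))^-1)); last first.
  by apply/funext => n; rewrite -[LHS]/(cf_fin R (mkseq a (1 + n)%N)) mkseqD.
apply: cvgV.
  have h1 := natr_ge1 (ap 0%N); have h2 := cf_ge0 ap1.
  by rewrite gt_eqF // (lt_le_trans ltr01) // -[leLHS]addr0 lerD.
by apply: cvgD; [exact: cvg_cst|exact: cf_cvg].
Qed.

Lemma cf_itv a : pos a -> 0 < cf R a < 1.
Proof.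
move=> ap.
have h b : pos b -> 0 < cf R b.
  move=> bp; rewrite cf_cons // invr_gt0.
  by have := natr_ge1 (bp 0%N); have := cf_ge0 (pos_shift 1 bp); lra.
rewrite h //= cf_cons // invf_lt1.
  by have := natr_ge1 (ap 0%N); have := h _ (pos_shift 1 ap); lra.
by have := natr_ge1 (ap 0%N); have := h _ (pos_shift 1 ap); lra.
Qed.

Lemma cf_pre s a : pos a -> pre s a -> cf R a = cft s (cf R (shift (size s) a)).
Proof.
elim: s a => [|c s ih] a ap; first by rewrite shift0.
by move=> /pre_cons[<- /(ih _ (pos_shift 1 ap)) h]; rewrite cf_cons // h shiftD.
Qed.

Lemma cf_close s a b : pos a -> pos b -> pre s a -> pre s b ->
  `|cf R a - cf R b| <= 2 * (2 ^+ size s)^-1.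
Proof.
move=> ap bp sa sb; rewrite (cf_pre ap sa) (cf_pre bp sb).
have /andP[h1 h2] := cf_itv (pos_shift (size s) ap).
have /andP[h3 h4] := cf_itv (pos_shift (size s) bp).
apply: le_trans (cft_lip (pre_pos ap sa) _ _) _; try lra.
rewrite ler_piMr ?mulr_ge0 ?invr_ge0 ?exprn_ge0 //.
by rewrite ler_norml; lra.
Qed.

(** The alternating lexicographic order: the first difference is at index [size s], and at an even
    index the smaller letter gives the larger value. *)
Lemma cf_lex s c d a b : pos a -> pos b -> pre (rcons s c) a -> pre (rcons s d) b ->
  (c < d)%N -> if odd (size s) then cf R a < cf R b else cf R b < cf R a.
Proof.
move=> ap bp /pre_rcons[sa ca] /pre_rcons[sb db] cd.
rewrite (cf_pre ap sa) (cf_pre bp sb).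
have /andP[h1 h2] := cf_itv (pos_shift (size s) ap).
have /andP[h3 h4] := cf_itv (pos_shift (size s) bp).
suff h : cf R (shift (size s) b) < cf R (shift (size s) a).
  by have := cft_mono (pre_pos ap sa) (ltW h3) h; case: ifP.
rewrite (cf_cons (pos_shift _ ap)) (cf_cons (pos_shift _ bp)) /= /shift !addn0 ca db -/(shift _ _).
have /andP[h5 h6] := cf_itv (pos_shift 1 (pos_shift (size s) ap)).
have /andP[h7 h8] := cf_itv (pos_shift 1 (pos_shift (size s) bp)).
have : 0 < c%:R :> R by rewrite -ca ltr0n; exact: ap.
have : c.+1%:R <= d%:R :> R by rewrite ler_nat.
rewrite -natr1 => ? ?; rewrite ltf_pV2 ?posrE; rewrite /shift in h5 h6 h7 h8 *; lra.
Qed.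

Lemma first_diff a b : a <> b -> exists n, mkseq a n = mkseq b n /\ a n <> b n.
Proof.
move=> ab; have [m hm] : exists m, a m != b m.
  apply: contra_notP ab => /forallNP h; apply/funext => n.
  by apply/eqP/negPn/negP; exact: h.
have hex : exists m, a m != b m by exists m.
exists (ex_minn hex); case: ex_minnP => n /eqP hn hmin; split=> //.
apply/eq_in_map => i; rewrite mem_iota add0n => /andP[_ ilt].
by apply/eqP/negPn/negP => /hmin; lia.
Qed.

Lemma cf_inj a b : pos a -> pos b -> cf R a = cf R b -> a = b.
Proof.
move=> ap bp; apply: contra_eqP => /first_diff[n [hpre hn]].
have pa : pre (rcons (mkseq a n) (a n)) a.
  by apply/pre_rcons; rewrite size_mkseq; split=> //; exact: pre_mkseq.
have pb : pre (rcons (mkseq a n) (b n)) b.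
  by apply/pre_rcons; rewrite hpre size_mkseq; split=> //; exact: pre_mkseq.
have [lt|lt|//] := ltngtP (a n) (b n).
  by have := cf_lex ap bp pa pb lt; case: ifP => _ h; [rewrite lt_eqF|rewrite gt_eqF].
by have := cf_lex bp ap pb pa lt; case: ifP => _ h; [rewrite gt_eqF|rewrite lt_eqF].
Qed.

(** Euclid's algorithm: dropping the first letter turns p/q into a fraction with denominator p < q,
    which cannot go on for ever. *)
Lemma cf_irrational a (p q : nat) : pos a -> (0 < q)%N -> cf R a <> p%:R / q%:R.
Proof.
elim/ltn_ind: q p a => q ih p a ap q0 h.
have := cf_itv ap; rewrite h => /andP[p0 pq].
have q0' : 0 < q%:R :> R by rewrite ltr0n.
rewrite pmulr_lgt0 ?invr_gt0 // ltr0n in p0.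
rewrite ltr_pdivrMr // mul1r ltr_nat in pq.
have p0' : 0 < p%:R :> R by rewrite ltr0n.
have e : (a 0%N)%:R + cf R (shift 1 a) = q%:R / p%:R.
  by rewrite -[LHS]invrK -cf_cons // h invf_div.
have := cf_itv (pos_shift 1 ap) => /andP[t0 _].
apply: (ih p pq (q - p * a 0)%N (shift 1 a) (pos_shift 1 ap) p0).
have le : (p * a 0 <= q)%N.
  have hle : (a 0%N)%:R <= q%:R / p%:R :> R by rewrite -e; lra.
  by move: hle; rewrite ler_pdivlMr // -natrM ler_nat mulnC.
rewrite natrB // natrM mulrBl -e; field; lra.
Qed.

Definition alt (n : nat) : nat := if odd n then 2%N else 1%N.

(** At the first difference, an even index has 1 in [alt], so [a] is larger there and loses. An odd
    index has 2 after a common 1; to win, [a] would need a 3 after this 1. *)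
Lemma cf_le_alt a : (forall n, a n \in [:: 1; 2; 3]%N) ->
  (forall n, a n = 1%N -> a n.+1 <> 3%N) -> cf R a <= cf R alt.
Proof.
move=> a3 a13; have ap : pos a by move=> n; have := a3 n; case: (a n).
have bp : pos alt by move=> n; rewrite /alt; case: odd.
have [->//|/first_diff[n [hpre hn]]] := pselect (a = alt).
have pa : pre (rcons (mkseq a n) (a n)) a.
  by apply/pre_rcons; rewrite size_mkseq; split=> //; exact: pre_mkseq.
have pb : pre (rcons (mkseq a n) (alt n)) alt.
  by apply/pre_rcons; rewrite hpre size_mkseq; split=> //; exact: pre_mkseq.
case odn : (odd n); last first.
  have lt : (alt n < a n)%N.
    by move: hn; rewrite /alt odn; have := a3 n; case: (a n) => [|[|]].
  by have := cf_lex bp ap pb pa lt; rewrite size_mkseq odn => /ltW.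
have lt : (a n < alt n)%N.
  have an3 : a n <> 3%N.
    move: odn hpre; case: n {hn pa pb} => //= m /negbTE om.
    move/(congr1 (fun s => nth 0%N s m)); rewrite !nth_mkseq // /alt om.
    exact: a13.
  move: hn an3; rewrite /alt odn; have := a3 n; rewrite !inE.
  by case: (a n) => [|[|[|[|]]]].
by have := cf_lex ap bp pa pb lt; rewrite size_mkseq odn => /ltW.
Qed.

End CF.

Notation frac := (BinNums.N * BinNums.N)%type.

(** * Windows of bi-infinite sequences *)

Definition rtail (B : int -> nat) (k : int) (n : nat) : nat := B (k + n%:Z).
Definition ltail (B : int -> nat) (k : int) (n : nat) : nat := B (k - n.+1%:Z).
Definition revB (B : int -> nat) (k : int) : nat := B (- k).
Definition trB (d : int) (B : int -> nat) (k : int) : nat := B (k + d).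
Definition posB (B : int -> nat) : Prop := forall k, (0 < B k)%N.
Definition letters123 (B : int -> nat) : Prop := forall k, B k \in [:: 1; 2; 3]%N.

(* [l] is read leftwards from position [k - 1], [r] rightwards from [k]. *)
Definition win (B : int -> nat) (k : int) (l r : seq nat) : Prop :=
  pre l (ltail B k) /\ pre r (rtail B k).

Definition occ (B : int -> nat) (k : int) (f : seq nat) : Prop := pre f (rtail B k).
Definition avoids (F : seq (seq nat)) (B : int -> nat) : Prop :=
  forall f : seq nat, f \in F -> forall k, ~ occ B k f.

Lemma shift_rtail n B k : shift n (rtail B k) = rtail B (k + n%:Z).
Proof. by apply/funext => i; rewrite /shift /rtail PoszD addrA. Qed.

Lemma shift_ltail n B k : shift n (ltail B k) = ltail B (k - n%:Z).
Proof. by apply/funext => i; rewrite /shift /ltail -addnS PoszD opprD addrA. Qed.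

Lemma pos_rtail B k : posB B -> pos (rtail B k).
Proof. by move=> Bp n; exact: Bp. Qed.

Lemma pos_ltail B k : posB B -> pos (ltail B k).
Proof. by move=> Bp n; exact: Bp. Qed.

Lemma letters123_pos B : letters123 B -> posB B.
Proof. by move=> h k; have := h k; case: (B k). Qed.

Lemma rtail_rev B k : rtail (revB B) k = ltail B (1 - k).
Proof. by apply/funext => n; rewrite /rtail /revB /ltail; congr B; lia. Qed.

Lemma ltail_rev B k : ltail (revB B) k = rtail B (1 - k).
Proof. by apply/funext => n; rewrite /rtail /revB /ltail; congr B; lia. Qed.

Lemma rtail_tr d B k : rtail (trB d B) k = rtail B (k + d).
Proof. by apply/funext => n; rewrite /rtail /trB; congr B; lia. Qed.

Lemma ltail_tr d B k : ltail (trB d B) k = ltail B (k + d).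
Proof. by apply/funext => n; rewrite /ltail /trB; congr B; lia. Qed.

Lemma pos_revB B : posB B -> posB (revB B).
Proof. by move=> h k; exact: h. Qed.

Lemma pos_trB d B : posB B -> posB (trB d B).
Proof. by move=> h k; exact: h. Qed.

Lemma winS B k l c r : win B k l (c :: r) <-> win B (k + 1) (c :: l) r.
Proof.
rewrite /win !pre_cons shift_rtail shift_ltail addrK.
have -> : rtail B k 0 = B k by rewrite /rtail addr0.
have -> : ltail B (k + 1) 0 = B k by rewrite /ltail addrK.
by split=> [[h1 [h2 h3]]|[[h1 h2] h3]].
Qed.

Lemma win_catrev B k l r : win B k l r -> occ B (k - (size l)%:Z) (catrev l r).
Proof.
elim: l k r => [|c l ih] k r; first by rewrite subr0 => -[].
rewrite -{1}(subrK 1 k) => /winS/ih.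
by rewrite (_ : k - 1 - (size l)%:Z = k - (size (c :: l))%:Z) //=; lia.
Qed.

Lemma occ_win B k l r : occ B k (catrev l r) -> win B (k + (size l)%:Z) l r.
Proof.
elim: l k r => [|c l ih] k r; first by rewrite addr0.
move=> /= /ih /winS.
by rewrite (_ : k + (size l)%:Z + 1 = k + (size (c :: l))%:Z) //=; lia.
Qed.

Lemma occ_infix B k f s : infix f s -> occ B k s -> exists k', occ B k' f.
Proof.
move=> /infixP[s1 [s2 ->]] /pre_cat[_ /pre_cat[h _]].
by rewrite shift_rtail in h; exists (k + (size s1)%:Z).
Qed.

Lemma occ_revB B k f : occ (revB B) k (rev f) <-> occ B (1 - k - (size f)%:Z) f.
Proof.
rewrite /occ rtail_rev !preP size_rev; split=> h i ilt.
  have := h (size f - i.+1)%N ltac:(lia).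
  rewrite nth_rev; last lia.
  rewrite (_ : size f - (size f - i.+1).+1 = i)%N; last lia.
  by move=> <-; rewrite /rtail /ltail; congr B; lia.
rewrite nth_rev // -h; last lia.
by rewrite /rtail /ltail; congr B; lia.
Qed.

Lemma avoids_revB F B : (forall f, f \in F -> rev f \in F) ->
  avoids F B -> avoids F (revB B).
Proof. by move=> hF h f /hF/h h' k; rewrite -(revK f) => /occ_revB/h'. Qed.

Section Lambda.
Variable R : realType.

Lemma lambdaE B k :
  lambda R B k = (B k)%:R + cf R (rtail B (k + 1)) + cf R (ltail B k).
Proof.
rewrite /lambda (_ : (fun n => B (k + n.+1%:Z)) = rtail B (k + 1)) //.
by apply/funext => n; rewrite /rtail -addrA -PoszD add1n.
Qed.

Lemma lambda_tr d B k : lambda R (trB d B) k = lambda R B (k + d).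
Proof. by rewrite !lambdaE rtail_tr ltail_tr (addrAC k). Qed.

Lemma lambda_rev B k : lambda R (revB B) k = lambda R B (- k).
Proof.
rewrite !lambdaE rtail_rev ltail_rev addrAC.
have -> : 1 - (k + 1) = - k by lia.
by have -> : 1 - k = - k + 1 by lia.
Qed.

Lemma win_lambda B k l c r : posB B -> win B k l (c :: r) ->
  lambda R B k = c%:R + cft r (cf R (rtail B (k + (size r).+1%:Z)))
    + cft l (cf R (ltail B (k - (size l)%:Z))).
Proof.
move=> Bp [hl /pre_cons[hc hr]]; rewrite lambdaE.
rewrite shift_rtail in hr.
rewrite (cf_pre R (pos_rtail _ Bp) hr) (cf_pre R (pos_ltail _ Bp) hl).
rewrite shift_rtail shift_ltail -hc [rtail B k 0]/rtail addr0.
by have -> : k + 1 + (size r)%:Z = k + (size r).+1%:Z by lia.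
Qed.

Lemma lambda_close B B' k l c r : posB B -> posB B' ->
  win B k l (c :: r) -> win B' k l (c :: r) -> (size l <= size r)%N ->
  `|lambda R B k - lambda R B' k| <= 2 * (2 * (2 ^+ size l)^-1).
Proof.
move=> Bp Bp' [hl /pre_cons[hc hr]] [hl' /pre_cons[hc' hr']] le.
rewrite !shift_rtail in hr hr'.
rewrite !lambdaE.
have -> : B k = B' k by move: hc hc'; rewrite /rtail addr0 => -> ->.
have h1 := cf_close R (pos_rtail _ Bp) (pos_rtail _ Bp') hr hr'.
have h2 := cf_close R (pos_ltail _ Bp) (pos_ltail _ Bp') hl hl'.
have h3 : 2 * (2 ^+ size r)^-1 <= 2 * (2 ^+ size l)^-1 :> R.
  rewrite ler_wpM2l // lef_pV2 ?posrE ?exprn_gt0 //; by rewrite ler_weXn2l // ler1n.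
move: h1 h2; rewrite !ler_norml; lra.
Qed.

Lemma lambda_ge B k : posB B -> (B k)%:R < lambda R B k.
Proof.
move=> Bp; rewrite lambdaE.
have := cf_itv R (pos_rtail (k + 1) Bp); have := cf_itv R (pos_ltail k Bp); lra.
Qed.

Lemma lambda_lt B k : posB B -> lambda R B k < (B k)%:R + 2.
Proof.
move=> Bp; rewrite lambdaE.
have := cf_itv R (pos_rtail (k + 1) Bp); have := cf_itv R (pos_ltail k Bp); lra.
Qed.

(** * Rational bounds *)

Definition frac_val (q : frac) : R := (nat_of_bin q.1)%:R / (nat_of_bin q.2)%:R.

End Lambda.

(** The computable form of [cft]: numerator and denominator are binary numbers and are never
    reduced. *)
Definition ev (s : seq nat) (q : frac) : frac :=
  foldr (fun c q => (q.2, BinNat.N.add (BinNat.N.mul (bin_of_nat c) q.2) q.1)) q s.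

Definition frac0 : frac := (BinNums.N0, BinNums.Npos BinNums.xH).
Definition frac1 : frac := (BinNums.Npos BinNums.xH, BinNums.Npos BinNums.xH).

(** The unknown tail lies between 0 and 1; the parity of the number of known letters decides which
    extreme gives the lower bound. *)
Definition lo (s : seq nat) := ev s (if odd (size s) then frac1 else frac0).
Definition hi (s : seq nat) := ev s (if odd (size s) then frac0 else frac1).

Definition lamq (c : nat) (x y : frac) : frac :=
  (BinNat.N.add (BinNat.N.mul (bin_of_nat c) (BinNat.N.mul x.2 y.2))
     (BinNat.N.add (BinNat.N.mul x.1 y.2) (BinNat.N.mul y.1 x.2)),
   BinNat.N.mul x.2 y.2).

Definition leq_frac (x y : frac) : bool := BinNat.N.leb (BinNat.N.mul x.1 y.2) (BinNat.N.mul y.1 x.2).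

Definition lowb (q : frac) (l r : seq nat) : bool :=
  if r is c :: r' then leq_frac q (lamq c (lo r') (lo l)) else false.
Definition highb (q : frac) (l r : seq nat) : bool :=
  if r is c :: r' then leq_frac (lamq c (hi r') (hi l)) q else false.

Lemma nat_of_add_bin x y : nat_of_bin (BinNat.N.add x y) = (nat_of_bin x + nat_of_bin y)%N.
Proof. lia. Qed.

Lemma nat_of_mul_bin x y : nat_of_bin (BinNat.N.mul x y) = (nat_of_bin x * nat_of_bin y)%N.
Proof. lia. Qed.

Section Bounds.
Variable R : realType.
Notation fr := (frac_val R).
Notation posw := (all (fun c => (0 < c)%N)).

Lemma evP s (q : frac) : posw s -> (0 < q.2)%N ->
  fr (ev s q) = cft s (fr q) /\ (0 < (ev s q).2)%N.
Proof.
move=> + q0; elim: s => //= c s ih /andP[c0 /ih[h1 h2]].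
have h3 : (0 < nat_of_bin (BinNat.N.add (BinNat.N.mul (bin_of_nat c) (ev s q).2) (ev s q).1))%N.
  by rewrite nat_of_add_bin nat_of_mul_bin bin_of_natK; nia.
split=> //; rewrite -h1 /frac_val /= nat_of_add_bin nat_of_mul_bin bin_of_natK natrD natrM.
have ? : 0 < (nat_of_bin (ev s q).2)%:R :> R by rewrite ltr0n.
have ? : 0 < c%:R :> R by rewrite ltr0n.
have ? : 0 <= (nat_of_bin (ev s q).1)%:R :> R by rewrite ler0n.
by field; rewrite ?gt_eqF //=; nra.
Qed.

Lemma lo_hiP s a : pos a -> pre s a ->
  [/\ fr (lo s) <= cf R a, cf R a <= fr (hi s), (0 < (lo s).2)%N & (0 < (hi s).2)%N].
Proof.
move=> ap sa; have sp := pre_pos ap sa.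
rewrite (cf_pre R ap sa); set t := cf _ _.
have /andP[t0 t1] : 0 < t < 1 := cf_itv R (pos_shift _ ap).
have f0 : fr frac0 = 0 by rewrite /frac_val mul0r.
have f1 : fr frac1 = 1 by rewrite /frac_val divff ?oner_neq0.
have [e0 p0] := evP sp (erefl : (0 < nat_of_bin frac0.2)%N).
have [e1 p1] := evP sp (erefl : (0 < nat_of_bin frac1.2)%N).
have := cft_mono_le sp (lexx 0) (ltW t0); have := cft_mono_le sp (ltW t0) (ltW t1).
by rewrite /lo /hi; case: odd => ? ?; rewrite e0 e1 f0 f1.
Qed.

Lemma leq_fracP (x y : frac) : (0 < x.2)%N -> (0 < y.2)%N -> leq_frac x y -> fr x <= fr y.
Proof.
move=> x0 y0 /BinNat.N.leb_spec0 h.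
rewrite /frac_val ler_pdivrMr ?ltr0n // mulrAC ler_pdivlMr ?ltr0n // -!natrM ler_nat.
by rewrite -!nat_of_mul_bin; lia.
Qed.

Lemma lamqP c (x y : frac) : (0 < x.2)%N -> (0 < y.2)%N ->
  fr (lamq c x y) = c%:R + fr x + fr y /\ (0 < (lamq c x y).2)%N.
Proof.
move=> x0 y0; split; last by rewrite /= nat_of_mul_bin muln_gt0 x0.
rewrite /frac_val /= !(nat_of_add_bin, nat_of_mul_bin) bin_of_natK !(natrD, natrM).
have ? : 0 < (nat_of_bin x.2)%:R :> R by rewrite ltr0n.
have ? : 0 < (nat_of_bin y.2)%:R :> R by rewrite ltr0n.
by field; rewrite ?gt_eqF.
Qed.

Lemma lowbP (q : frac) B k l r : posB B -> (0 < q.2)%N -> win B k l r -> lowb q l r ->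
  fr q <= lambda R B k.
Proof.
move=> Bp q0; case: r => //= c r [hl /pre_cons[hc hr]] h.
rewrite shift_rtail in hr; rewrite lambdaE.
have [h1 _ p1 _] := lo_hiP (pos_rtail _ Bp) hr.
have [h2 _ p2 _] := lo_hiP (pos_ltail _ Bp) hl.
have [e p] := lamqP c p1 p2.
apply: le_trans (leq_fracP q0 p h) _; rewrite e -hc /rtail addr0.
by rewrite lerD // lerD.
Qed.

Lemma highbP (q : frac) B k l r : posB B -> (0 < q.2)%N -> win B k l r -> highb q l r ->
  lambda R B k <= fr q.
Proof.
move=> Bp q0; case: r => //= c r [hl /pre_cons[hc hr]] h.
rewrite shift_rtail in hr; rewrite lambdaE.
have [_ h1 _ p1] := lo_hiP (pos_rtail _ Bp) hr.
have [_ h2 _ p2] := lo_hiP (pos_ltail _ Bp) hl.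
have [e p] := lamqP c p1 p2.
apply: le_trans _ (leq_fracP p q0 h); rewrite e -hc /rtail addr0.
by rewrite lerD // lerD.
Qed.

End Bounds.

(** * Tree search over windows *)

(* Written with [if] rather than [&&] and [||] so that the virtual machine
   does not evaluate both sides. *)
Fixpoint pfx (f s : seq nat) : bool :=
  match f, s with
  | [::], _ => true
  | x :: f', y :: s' => if eqn x y then pfx f' s' else false
  | _, _ => false
  end.

Fixpoint ifx (f s : seq nat) : bool :=
  if pfx f s then true else if s is _ :: s' then ifx f s' else false.

Fixpoint hasw (F : seq (seq nat)) (s : seq nat) : bool :=
  if F is f :: F' then (if ifx f s then true else hasw F' s) else false.

Fixpoint hasp (F : seq (seq nat)) (s : seq nat) : bool :=
  if F is f :: F' then (if pfx f s then true else hasp F' s) else false.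

(* A window is extended by one letter at a time, so that a new word of [F], which
   is closed under transposition, can only appear at one of the two ends. *)
Definition hasends (F : seq (seq nat)) (l r : seq nat) : bool :=
  if hasp F (catrev l r) then true else hasp F (catrev r l).

(** Only letters 3 are tried; at the others the value is at most [i1], by [lambda_small]. *)
Fixpoint anylow (q : frac) (l r : seq nat) : bool :=
  if r is c :: r' then
    if (if eqn c 3 then lowb q l r else false) then true else anylow q (c :: l) r'
  else false.

(** A proof tree whose leaves satisfy [close]; [side] chooses the end at which the window grows.
    Running out of the fuel [n] counts as failure, so success means that every sequence over 1, 2, 3
    containing the initial window reaches a leaf. *)
Fixpoint search (close side : seq nat -> seq nat -> bool) (n : nat)
    (l r : seq nat) : bool :=
  if close l r then true else
  if n is m.+1 then
    if side l r then
      if search close side m (rcons l 1) r then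
        if search close side m (rcons l 2) r then search close side m (rcons l 3) r
        else false
      else false
    else
      if search close side m l (rcons r 1) then
        if search close side m l (rcons r 2) then search close side m l (rcons r 3)
        else false
      else false
  else false.

Definition balanced (l r : seq nat) : bool := (size l < size r)%N.

Lemma pfxP f s : pfx f s -> exists t, s = f ++ t.
Proof.
elim: f s => [s _|x f ih [|y s]] //=; first by exists s.
by case: eqnP => // -> /ih[t ->]; exists t.
Qed.

Lemma ifx_cons f y s : ifx f (y :: s) = if pfx f (y :: s) then true else ifx f s.
Proof. by []. Qed.

Lemma ifxP f s : ifx f s -> infix f s.
Proof.
elim: s => [|y s ih]; first by case: f.
rewrite ifx_cons.
case: ifP => [/pfxP[t ->] _|_ /ih]; first by apply/infixP; exists [::], t.
by move=> /infixP[s1 [s2 ->]]; apply/infixP; exists (y :: s1), s2.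
Qed.

Lemma pfx_prefix f t : pfx f (f ++ t).
Proof. by elim: f => //= x f ->; rewrite eqnE eqxx. Qed.

Lemma infix_ifx f s : infix f s -> ifx f s.
Proof.
move=> /infixP[s1 [s2 ->]]; elim: s1 => [|x s1 ih]; last by rewrite cat_cons ifx_cons ih; case: ifP.
rewrite cat0s; case: (f ++ s2) (pfx_prefix f s2) => [|y t] h; last by rewrite ifx_cons h.
by case: f h.
Qed.

Lemma haswP F s : hasw F s -> exists2 f, f \in F & infix f s.
Proof.
elim: F => //= f F ih; case: ifP => [/ifxP h _|_ /ih[g gF h]].
  by exists f => //; exact: mem_head.
by exists g => //; rewrite in_cons gF orbT.
Qed.

Lemma hasw_infix F s f : f \in F -> infix f s -> hasw F s.
Proof.
elim: F => //= g F ih; rewrite in_cons => /predU1P[<- /infix_ifx ->//|/ih h /h ->].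
by case: ifP.
Qed.

Lemma haspP F s : hasp F s -> exists f t, f \in F /\ s = f ++ t.
Proof.
elim: F => //= f F ih; case: ifP => [/pfxP[t ->] _|_ /ih[g [t [gF h]]]].
  by exists f, t; split=> //; exact: mem_head.
by exists g, t; split=> //; rewrite in_cons gF orbT.
Qed.

Lemma hasends_win F B k l r : (forall f : seq nat, f \in F -> rev f \in F) ->
  avoids F B -> win B k l r -> ~~ hasends F l r.
Proof.
move=> hF h /win_catrev o; apply/negP; rewrite /hasends.
case: ifP => [/haspP[f [t [fF e]]] _|_ /haspP[f [t [fF e]]]].
  have fi : infix f (catrev l r) by apply/infixP; exists [::], t.
  by have [k' /(h _ fF)] := occ_infix fi o.
have fi : infix (rev f) (catrev l r).
  apply/infixP; exists (rev t), [::]; rewrite cats0 -rev_cat -e !catrevE.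
  by rewrite rev_cat revK.
by have [k' /(h _ (hF _ fF))] := occ_infix fi o.
Qed.

Lemma anylowP (R : realType) (q : frac) B k l r : posB B -> (0 < q.2)%N -> win B k l r -> anylow q l r ->
  exists k', frac_val R q <= lambda R B k'.
Proof.
move=> Bp q0; elim: r k l => //= c r ih k l h; case: ifP => [|_].
  by case: eqnP => // _ hl _; exists k; exact: (lowbP R Bp q0 h hl).
by apply: ih (k + 1) _ _; exact/winS.
Qed.

Lemma searchP close side n B k l r : letters123 B -> win B k l r -> search close side n l r ->
  exists l' r', close l' r' /\ win B k l' r'.
Proof.
move=> B3; elim: n l r => [|n ih] l r h /=; case: ifP => [c _|//]; first by exists l, r.
  by exists l, r.
have [hl hr] := h.
have hL c : ltail B k (size l) = c -> win B k (rcons l c) r.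
  by move=> e; split=> //; apply/pre_rcons.
have hR c : rtail B k (size r) = c -> win B k l (rcons r c).
  by move=> e; split=> //; apply/pre_rcons.
case: ifP => _.
  have := B3 (k - (size l).+1%:Z); rewrite -/(ltail B k (size l)) !inE.
  case: ifP => // s1; case: ifP => // s2 /or3P[] /eqP /hL hw _ s3; [exact: ih hw s1|exact: ih hw s2|exact: ih hw s3].
have := B3 (k + (size r)%:Z); rewrite -/(rtail B k (size r)) !inE.
case: ifP => // s1; case: ifP => // s2 /or3P[] /eqP /hR hw _ s3; [exact: ih hw s1|exact: ih hw s2|exact: ih hw s3].
Qed.

Arguments search : simpl never.

(** * The certified searches *)

(* All forbidden words but the last one, [22221 w 11122]. *)
Definition base0 : seq (seq nat) := take 52 forbidden_base.
Definition forb0 : seq (seq nat) := base0 ++ map rev base0.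

(* [last_word] is [rev Ll ++ Lr], with the letter 3 of the middle
   copy of [w] at the head of [Lr]. *)
Definition last_word : seq nat := word 22221 ++ w ++ word 11122.
Definition Ll : seq nat := rev (word 22221 ++ wl).
Definition Lr : seq nat := wr ++ word 11122.

(** The finite parts of the sequences defining [j1] and [i1], each read away from the starred 3,
    which is left out. Thirty letters of the periodic tails make the enclosures of the two values
    narrow enough for the searches. *)
Definition LJ : seq nat := rev (word 1232321212112221 ++ w ++ w ++ wl).
Definition RJ : seq nat := behead wr ++ w ++ word 11121.
Definition LI : seq nat := rev (word 123232111111112321 ++ word 12221 ++ wl).
Definition RI : seq nat := behead wr ++ word 11123 ++ word 212111111111232321.
Definition altw : seq nat := mkseq alt 30.

Definition Jhi : frac := lamq 3 (hi (RJ ++ altw)) (hi (LJ ++ altw)).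
Definition Jlo : frac := lamq 3 (lo (RJ ++ altw)) (lo (LJ ++ altw)).
Definition Ihi : frac := lamq 3 (hi (RI ++ altw)) (hi (LI ++ altw)).
Definition Ilo : frac := lamq 3 (lo (RI ++ altw)) (lo (LI ++ altw)).

(* For each word of [base0], the position of the letter 3 around which the
   window is grown. *)
Definition centers : seq nat :=
  [:: 1; 2; 2; 3; 4; 5; 6; 7; 5; 8; 8; 9; 8; 10; 10; 10; 11; 11; 9; 9; 10; 8; 8; 8; 8; 11; 12; 13; 13; 12; 12; 14; 12; 15; 14; 16; 16; 13; 13; 13; 12; 12; 16; 15; 18; 17; 20; 19; 21; 22; 23; 21]%N.

Definition closeF (known : seq (seq nat)) (l r : seq nat) : bool :=
  if hasends known l r then true else anylow Jhi [::] (catrev l r).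

(** Each word is excluded with the help of the earlier ones and their transposes, so the order of
    the list matters. *)
Fixpoint checkF (known fs : seq (seq nat)) (cs : seq nat) : bool :=
  match fs, cs with
  | f :: fs', c :: cs' =>
    if search (closeF known) balanced 60 (rev (take c f)) (drop c f)
    then checkF (f :: rev f :: known) fs' cs' else false
  | [::], _ => true
  | _, [::] => false
  end.

Lemma checkF_base0 : checkF [::] base0 centers.
Proof. by vm_compute. Qed.

Definition closeT (l r : seq nat) : bool :=
  if hasends forb0 l r then true else
  if highb Ilo l r then true else
  if pfx LI l && pfx (3%N :: RI) r then true else
  if pfx RI l && pfx (3%N :: LI) r then true else
  if pfx Ll l && pfx Lr r then true else
  pfx (behead Lr) l && pfx (3%N :: Ll) r.

Lemma searchT : search closeT balanced 80 [::] [::].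
Proof. by vm_compute. Qed.

(** The third kind of leaf is the window of [j1], refuted later by [alt_extremal]; the last kind is
    a further copy of [w], again followed by 11122. *)
Definition closeR (l r : seq nat) : bool :=
  if hasends forb0 l r then true else
  if anylow Jhi [::] (catrev l r) then true else
  if pfx LJ l && pfx (3%N :: RJ) r then true else
  pfx Ll l && pfx (wr ++ wl ++ Lr) r.

Lemma searchR : search closeR balanced 110 Ll Lr.
Proof. by vm_compute. Qed.

(** The window already holds three more copies of [w] on the right and grows only to the left. It
    ends either at the same word 11 places earlier or at the start of the run. *)
Definition closeL (l r : seq nat) : bool :=
  if hasends forb0 l r then true else
  if anylow Jhi [::] (catrev l r) then true else
  if pfx (rev wl ++ rev wr ++ Ll) l then true else
  pfx (rev (word 21212112221 ++ w ++ wl)) l.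

Lemma searchL : search closeL (fun _ _ => true) 60 Ll (wr ++ w ++ w ++ w).
Proof. by vm_compute. Qed.

(** * Infinite words with a given prefix, and windows under translation and reversal *)

Lemma shift_rcat s a : shift (size s) (rcat s a) = a.
Proof. by apply/funext => i; rewrite /shift /rcat ltnNge leq_addr /= addKn. Qed.

Lemma pre_rcat s a : pre s (rcat s a).
Proof. by apply/preP => i h; rewrite /rcat h. Qed.

Lemma rcat_shift s a : pre s a -> a = rcat s (shift (size s) a).
Proof.
move=> /preP h; apply/funext => i; rewrite /rcat; case: ltnP => [/h//|h'].
by rewrite /shift subnKC.
Qed.

Lemma rcat_cat s t a : rcat (s ++ t) a = rcat s (rcat t a).
Proof.
apply/funext => i; rewrite /rcat size_cat nth_cat.
by case: (ltnP i (size s)) => h; [rewrite ltn_addr|rewrite ltn_subLR // subnDA].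
Qed.

Lemma pos_rcat s a : all (fun c => (0 < c)%N) s -> pos a -> pos (rcat s a).
Proof.
move=> /allP h ap i; rewrite /rcat; case: (ltnP i (size s)) => // ilt.
exact: (h _ (mem_nth 0%N ilt)).
Qed.

Lemma pos_alt : pos alt.
Proof. by move=> n; rewrite /alt; case: odd. Qed.

Lemma win_pfx B k l r l' r' : pfx l l' -> pfx r r' -> win B k l' r' -> win B k l r.
Proof. by move=> /pfxP[t ->] /pfxP[t' ->] [/pre_cat[h _] /pre_cat[h' _]]. Qed.

Lemma win_move B k l s r : win B k l (s ++ r) <-> win B (k + (size s)%:Z) (catrev s l) r.
Proof.
elim: s k l => [|c s ih] k l /=; first by rewrite addr0.
rewrite winS ih (_ : k + 1 + (size s)%:Z = k + (size s).+1%:Z) //; lia.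
Qed.

Lemma win_rev B k l c r : win B k l (c :: r) <-> win (revB B) (- k) r (c :: l).
Proof.
rewrite winS /win rtail_rev ltail_rev opprK (addrC 1).
by split=> [[h1 h2]|[h1 h2]].
Qed.

Lemma mem_cat_map_rev (s : seq (seq nat)) (f : seq nat) :
  f \in s ++ map rev s -> rev f \in s ++ map rev s.
Proof.
rewrite !mem_cat => /orP[h|/mapP[g h ->]]; first by rewrite map_f ?orbT.
by rewrite revK h.
Qed.

Lemma mem_forb0_rev (f : seq nat) : f \in forb0 -> rev f \in forb0.
Proof. exact: mem_cat_map_rev. Qed.

Lemma nat_of_bin_gt0 n : ~~ BinNat.N.eqb n BinNums.N0 -> (0 < nat_of_bin n)%N.
Proof. by move=> /BinNat.N.eqb_spec; lia. Qed.

Lemma Jhi_gt0 : (0 < nat_of_bin Jhi.2)%N.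
Proof. by apply: nat_of_bin_gt0; vm_compute. Qed.

Lemma Ilo_gt0 : (0 < nat_of_bin Ilo.2)%N.
Proof. by apply: nat_of_bin_gt0; vm_compute. Qed.

Lemma occ_rev2 B k f : occ (revB B) k f <-> occ B (1 - k - (size f)%:Z) (rev f).
Proof. by rewrite -{1}(revK f) occ_revB size_rev. Qed.

(** * Sequences whose values stay below j1 *)

Section Spectrum.
Variable R : realType.
Notation fr := (frac_val R).
Notation lam := (lambda R).

(** The values at the starred positions. That they are the suprema, hence [i1] and [j1], is shown in
    [i1_eq] and [j1_eq]. *)
Definition i1_val : R := 3%:R + cft RI (cf R alt) + cft LI (cf R alt).
Definition j1_val : R := 3%:R + cft RJ (cf R alt) + cft LJ (cf R alt).

Lemma cf_rcat s a : all (fun c => (0 < c)%N) s -> pos a ->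
  cf R (rcat s a) = cft s (cf R a).
Proof.
by move=> sp ap; rewrite (cf_pre R (pos_rcat sp ap) (pre_rcat _ _)) shift_rcat.
Qed.

Lemma alt_bounds s : all (fun c => (0 < c)%N) s ->
  [/\ fr (lo (s ++ altw)) <= cft s (cf R alt), cft s (cf R alt) <= fr (hi (s ++ altw)),
   (0 < nat_of_bin (lo (s ++ altw)).2)%N & (0 < nat_of_bin (hi (s ++ altw)).2)%N].
Proof.
move=> sp; rewrite -(cf_rcat sp pos_alt); apply: lo_hiP.
  exact: pos_rcat sp pos_alt.
by apply/pre_cat; split; [exact: pre_rcat|rewrite shift_rcat; exact: pre_mkseq].
Qed.

Lemma lamq_bounds r l : all (fun c => (0 < c)%N) r -> all (fun c => (0 < c)%N) l ->
  let x := 3%:R + cft r (cf R alt) + cft l (cf R alt) in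
  fr (lamq 3 (lo (r ++ altw)) (lo (l ++ altw))) <= x
    <= fr (lamq 3 (hi (r ++ altw)) (hi (l ++ altw))).
Proof.
move=> /alt_bounds[r1 r2 r3 r4] /alt_bounds[l1 l2 l3 l4] /=.
have [-> _] := lamqP R 3 r3 l3; have [-> _] := lamqP R 3 r4 l4.
by apply/andP; split; rewrite lerD // lerD.
Qed.

Lemma J1_bounds : fr Jlo <= j1_val <= fr Jhi.
Proof. exact: lamq_bounds. Qed.

Lemma I1_bounds : fr Ilo <= i1_val <= fr Ihi.
Proof. exact: lamq_bounds. Qed.

Lemma Jhi_lt4 : fr Jhi <= 4%:R.
Proof.
have -> : 4%:R = fr (lamq 4 frac0 frac0).
  by have [-> _] := @lamqP R 4 frac0 frac0 isT isT; rewrite /frac_val !mul0r !addr0.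
by apply: leq_fracP; [exact: Jhi_gt0| |vm_compute].
Qed.

Definition below_j1 (B : int -> nat) := posB B /\ forall k, lam B k < j1_val.

Lemma below_j1_rev B : below_j1 B -> below_j1 (revB B).
Proof. by move=> [h1 h2]; split=> [k|k]; [exact: h1|rewrite lambda_rev]. Qed.

Lemma below_j1_tr d B : below_j1 B -> below_j1 (trB d B).
Proof. by move=> [h1 h2]; split=> [k|k]; [exact: h1|rewrite lambda_tr]. Qed.

Lemma below_j1_letters123 B : below_j1 B -> letters123 B.
Proof.
move=> [Bp h] k; have := lambda_ge R k Bp; have := h k => h1 h2.
have : (B k < 4)%N.
  rewrite -(ltr_nat R); have := Jhi_lt4; have /andP[_ ] := J1_bounds; lra.
by have := Bp k; case: (B k) => [|[|[|[|]]]].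
Qed.

Lemma anylow_below_j1 B k l r : below_j1 B -> win B k l r -> ~~ anylow Jhi l r.
Proof.
move=> [Bp h] wn; apply/negP => /(anylowP R Bp Jhi_gt0 wn) [k' hk].
have := h k'; have /andP[_] := J1_bounds; lra.
Qed.

Lemma win_nil B k l r : win B k l r -> win B (k - (size l)%:Z) [::] (catrev l r).
Proof. by move=> /win_catrev h; split. Qed.

Lemma below_j1_avoids_step known f c B : below_j1 B ->
  (forall g : seq nat, g \in known -> rev g \in known) -> avoids known B ->
  search (closeF known) balanced 60 (rev (take c f)) (drop c f) -> forall k, ~ occ B k f.
Proof.
move=> Bs krev Ba hs k; rewrite -{1}(cat_take_drop c f) -{1}(revK (take c f)) -catrevE.
move=> /occ_win h.
have [l [r [hc hw]]] := searchP (below_j1_letters123 Bs) h hs.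
move: hc; rewrite /closeF (negbTE (hasends_win krev Ba hw)).
by apply/negP; apply: (anylow_below_j1 Bs (win_nil hw)).
Qed.

Lemma checkF_avoids known fs cs B : below_j1 B -> avoids known B ->
  (forall f : seq nat, f \in known -> rev f \in known) -> checkF known fs cs ->
  avoids (fs ++ map rev fs) B.
Proof.
move=> Bs; elim: fs known cs => [|f fs ih] known [|c cs] //= Ba krev.
case: ifP => // hs hc.
have hf k : ~ occ B k f := below_j1_avoids_step Bs krev Ba hs (k := k).
(* The transpose is excluded by the same search, applied to the reversed sequence. *)
have hfr k : ~ occ B k (rev f).
  move=> ho; apply: (below_j1_avoids_step (below_j1_rev Bs) krev (avoids_revB krev Ba) hs (k := 1 - k - (size f)%:Z)).
  rewrite occ_rev2; move: ho.
  by have -> : 1 - (1 - k - (size f)%:Z) - (size f)%:Z = k by lia.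
have Ba' : avoids [:: f, rev f & known] B.
  by move=> g; rewrite !in_cons => /or3P[/eqP ->|/eqP ->|/Ba].
have := ih _ cs Ba' _ hc.
have h g : g \in [:: f, rev f & known] -> rev g \in [:: f, rev f & known].
  rewrite !in_cons => /or3P[/eqP ->|/eqP ->|/krev ->]; rewrite ?revK ?eqxx ?orbT //.
move=> /(_ h) ha g; rewrite in_cons mem_cat in_cons.
by move=> /predU1P[->|/orP[hg|/predU1P[->|hg]]] //; apply: ha; rewrite mem_cat hg ?orbT.
Qed.

Lemma below_j1_avoids B : below_j1 B -> avoids forb0 B.
Proof. by move=> Bs; exact: (@checkF_avoids [::] base0 centers) checkF_base0. Qed.

Lemma avoids13 B k : avoids forb0 B -> B k = 1%N -> B (k + 1) <> 3%N.
Proof.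
move=> h h1 h3; apply: (h [:: 1; 3]%N _ k) => //.
by rewrite /occ /pre /mkseq /= /rtail addr0 h1 h3.
Qed.

Lemma avoids31 B k : avoids forb0 B -> B k = 1%N -> B (k - 1) <> 3%N.
Proof.
move=> h h1 h3; apply: (h [:: 3; 1]%N _ (k - 1)) => //.
by rewrite /occ /pre /mkseq /= /rtail addr0 subrK h1 h3.
Qed.

Lemma rtail_le_alt B k : letters123 B -> avoids forb0 B -> cf R (rtail B k) <= cf R alt.
Proof.
move=> B3 Ba; apply: cf_le_alt => n; first exact: B3.
rewrite /rtail => /(avoids13 Ba).
by rewrite (_ : k + n%:Z + 1 = k + n.+1%:Z) //; lia.
Qed.

Lemma ltail_le_alt B k : letters123 B -> avoids forb0 B -> cf R (ltail B k) <= cf R alt.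
Proof.
move=> B3 Ba; apply: cf_le_alt => n; first exact: B3.
rewrite /ltail => /(avoids31 Ba).
by rewrite (_ : k - n.+1%:Z - 1 = k - n.+2%:Z) //; lia.
Qed.

(** Without 13 and 31 both tails are at most [alt]. Even halves preserve the order and give an upper
    bound, odd halves reverse it and give a lower one. The halves of the [i1] window have even
    length and those of the [j1] window odd length, so the bounds have the right directions. *)
Lemma alt_extremal B k l c r : letters123 B -> avoids forb0 B -> win B k l (c :: r) ->
  let x := c%:R + cft r (cf R alt) + cft l (cf R alt) in
  (~~ odd (size l) -> ~~ odd (size r) -> lam B k <= x) /\
  (odd (size l) -> odd (size r) -> x <= lam B k).
Proof.
move=> B3 Ba hw x; rewrite /x (win_lambda R (letters123_pos B3) hw).
have Bp := letters123_pos B3.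
have [hl /pre_cons[_ hr]] := hw.
have lp := pre_pos (pos_ltail k Bp) hl.
have rp := pre_pos (pos_shift 1 (pos_rtail k Bp)) hr.
have r0 := cf_itv R (pos_rtail (k + (size r).+1%:Z) Bp).
have l0 := cf_itv R (pos_ltail (k - (size l)%:Z) Bp).
have := cft_mono_le lp (ltW (andP l0).1) (ltail_le_alt _ B3 Ba).
have := cft_mono_le rp (ltW (andP r0).1) (rtail_le_alt _ B3 Ba).
by case: odd; case: odd => h1 h2; split=> // _ _; rewrite lerD // lerD.
Qed.

(** In both predicates the letter 3 of the middle copy of [w] or of its transpose is at [k], so the
    reflection of the integers exchanges them. *)
Definition atL (B : int -> nat) (k : int) := win B k Ll Lr.
Definition atR (B : int -> nat) (k : int) := win B k (behead Lr) (3%N :: Ll).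

Lemma atR_rev B k : atR B k <-> atL (revB B) (- k).
Proof. by rewrite /atL /atR (_ : Lr = 3%N :: behead Lr) // -win_rev. Qed.

Lemma atL_rev B k : atL B k <-> atR (revB B) (- k).
Proof. by rewrite /atL /atR (_ : Lr = 3%N :: behead Lr) // -win_rev. Qed.

(* Only the middle of [22221 w 11122], or of its transpose, can have a value
   above [i1]. *)
Lemma lambda_dichotomy B k : letters123 B -> avoids forb0 B ->
  [\/ lam B k <= i1_val, atL B k | atR B k].
Proof.
move=> B3 Ba.
have h0 : win B k [::] [::] by [].
have [l [r [hc hw]]] := searchP B3 h0 searchT.
move: hc; rewrite /closeT (negbTE (hasends_win mem_forb0_rev Ba hw)).
case: ifP => [hh _|_].
  constructor 1; apply: le_trans (highbP R (letters123_pos B3) Ilo_gt0 hw hh) _.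
  by have /andP[] := I1_bounds.
case: ifP => [/andP[hl hr] _|_].
  constructor 1; have [h _] := alt_extremal B3 Ba (win_pfx hl hr hw); exact: h.
case: ifP => [/andP[hl hr] _|_].
  constructor 1; have [h _] := alt_extremal B3 Ba (win_pfx hl hr hw).
  by rewrite /i1_val addrAC; exact: h.
case: ifP => [/andP[hl hr] _|_ /andP[hl hr]].
  by constructor 2; exact: win_pfx hw.
by constructor 3; exact: win_pfx hw.
Qed.

Lemma atL_next B k : below_j1 B -> atL B k -> atL B (k + 11).
Proof.
move=> Bs h; have Ba := below_j1_avoids Bs; have B3 := below_j1_letters123 Bs.
have [l [r [hc hw]]] := searchP B3 h searchR.
move: hc; rewrite /closeR (negbTE (hasends_win mem_forb0_rev Ba hw)).
rewrite (negbTE (anylow_below_j1 Bs (win_nil hw))).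
case: ifP => [/andP[hl hr] _|_ /andP[hl hr]].
  have [_ h1] := alt_extremal B3 Ba (win_pfx hl hr hw).
  by have := Bs.2 k; rewrite ltNge /j1_val h1.
have := win_pfx hl hr hw; rewrite catA => /win_move.
exact: win_pfx.
Qed.

Lemma atL_prev B k : below_j1 B -> atL B k -> pre (wr ++ w ++ w ++ w) (rtail B k) ->
  atL B (k - 11) \/ pre (rev (word 21212112221 ++ w ++ wl)) (ltail B k).
Proof.
move=> Bs [h _] hr; have Ba := below_j1_avoids Bs; have B3 := below_j1_letters123 Bs.
have [l [r [hc hw]]] := searchP B3 (conj h hr : win B k _ _) searchL.
move: hc; rewrite /closeL (negbTE (hasends_win mem_forb0_rev Ba hw)).
rewrite (negbTE (anylow_below_j1 Bs (win_nil hw))).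
case: ifP => [/pfxP[t e] _|_ /pfxP[t e]]; last first.
  by right; case: hw => + _; rewrite e => /pre_cat[].
left; apply: (@win_pfx _ _ _ _ Ll (wr ++ wl ++ wr ++ w ++ w ++ w)) => //.
rewrite catA; apply/win_move; rewrite subrK; split=> //.
by case: hw => + _; rewrite e (_ : catrev _ _ = rev wl ++ rev wr ++ Ll) // => /pre_cat[].
Qed.

End Spectrum.

(** * Compactness *)

Definition agree (n : nat) (B B' : int -> nat) : Prop :=
  forall k : int, - n%:Z <= k -> k <= n%:Z -> B k = B' k.

Lemma agree_sym n B B' : agree n B B' -> agree n B' B.
Proof. by move=> h k h1 h2; rewrite h. Qed.

Lemma agree_win n B B' k l r : agree n B B' -> (size l)%:Z - k <= n%:Z ->
  k + (size r)%:Z <= n%:Z -> - n%:Z <= k -> k <= n%:Z -> win B k l r -> win B' k l r.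
Proof.
move=> h hl hr k1 k2 [/preP wl /preP wr]; split; apply/preP => i ilt.
  by rewrite -wl // /ltail h //; lia.
by rewrite -wr // /rtail h //; lia.
Qed.

Lemma in123 (n : nat) : n \in [:: 1; 2; 3]%N -> [\/ n = 1%N, n = 2%N | n = 3%N].
Proof.
rewrite !inE => /or3P[] /eqP ->; [exact: Or31|exact: Or32|exact: Or33].
Qed.

(** An ultrafilter finer than the cofinite one selects the letter at each position, which replaces a
    diagonal extraction. The letters need to be in range only eventually at each position, because
    shifts of one sequence are controlled only far to the right. *)
Lemma word_compactness (Bs : nat -> int -> nat) :
  (forall k, exists m, forall j, (m <= j)%N -> Bs j k \in [:: 1; 2; 3]%N) ->
  exists B, letters123 B /\ forall m n, exists j, (m <= j)%N /\ agree n (Bs j) B.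
Proof.
move=> hB.
have [U [UU subU]] := @ultraFilterLemma nat \oo _.
have UF := @ultra_proper _ _ UU.
have ev m : U [set j | (m <= j)%N] by apply: subU; exists m.
have hc k : exists c, U [set j | Bs j k = c].
  have [//|n1] := in_ultra_setVsetC [set j | Bs j k = 1%N] UU; first by exists 1%N.
  have [//|n2] := in_ultra_setVsetC [set j | Bs j k = 2%N] UU; first by exists 2%N.
  have [//|n3] := in_ultra_setVsetC [set j | Bs j k = 3%N] UU; first by exists 3%N.
  have [m hm] := hB k.
  have [j [[[h1 h2] h3] h4]] := filter_ex (filterI (filterI (filterI n1 n2) n3) (ev m)).
  by have := in123 (hm _ h4) => -[]; [move/h1|move/h2|move/h3].
have [B hBk] := choice hc.
have hagree n : U [set j | agree n (Bs j) B].
  elim: n => [|n ih].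
    apply: filterS (hBk 0) => j /= hj k k1 k2.
    by have -> : k = 0 by lia.
  apply: filterS (filterI ih (filterI (hBk n.+1%:Z) (hBk (- n.+1%:Z)))) => j /=.
  move=> [h1 [h2 h3]] k k1 k2.
  have [e|] := eqVneq k n.+1%:Z; first by rewrite e.
  have [e|] := eqVneq k (- n.+1%:Z); first by rewrite e.
  by move=> e1 e2; apply: h1; lia.
exists B; split=> [k|m n].
  have [m hm] := hB k.
  by have [j [<- /hm]] := filter_ex (filterI (hBk k) (ev m)).
by have [j [h1 h2]] := filter_ex (filterI (ev m) (hagree n)); exists j.
Qed.

Lemma rtail_win B k n m : win B k (mkseq (ltail B k) n) (mkseq (rtail B k) m).
Proof. by split; exact: pre_mkseq. Qed.

Section Limits.
Variable R : realType.
Notation lam := (lambda R).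

Lemma lambda_agree (e : R) k : 0 < e -> exists n, forall B B', posB B -> posB B' ->
  agree n B B' -> `|lam B k - lam B' k| < e.
Proof.
move=> e0; have e2 : 0 < e / 2 by lra.
have [n hn] := exprn_half_lt e2.
exists (n + `|k|%N).+2 => B B' Bp Bp' h.
have hw := rtail_win B k n n.+1.
have hw' : win B' k (mkseq (ltail B k) n) (mkseq (rtail B k) n.+1).
  by apply: agree_win h _ _ _ _ hw; rewrite ?size_mkseq; lia.
have hs : (size (mkseq (ltail B k) n) <= size (behead (mkseq (rtail B k) n.+1)))%N.
  by rewrite size_behead !size_mkseq.
apply: le_lt_trans (lambda_close R Bp Bp' hw hw' hs) _; rewrite size_mkseq.
lra.
Qed.

(** Common to both spectra: [p] follows a maximising sequence of positions, or tends to infinity.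
    Since y < 4, the letters around [p j] are eventually at most 3. *)
Lemma limit_shift B (y : R) (p : nat -> int) : posB B ->
  (forall (e : R) (k : int), 0 < e -> exists m, forall j, (m <= j)%N -> lam B (k + p j) < y + e) ->
  y < 4%:R ->
  exists B', [/\ letters123 B', forall k, lam B' k <= y &
    forall m n, exists j, (m <= j)%N /\ agree n (trB (p j) B) B'].
Proof.
move=> Bp hy y4.
have [k|B' [B3 hB']] := @word_compactness (fun j => trB (p j) B).
  have [m hm] := hy (4%:R - y) k ltac:(lra).
  exists m => j /hm h; have := lambda_ge R (k + p j) Bp; rewrite /trB.
  have := Bp (k + p j) => c0 c1.
  have : (B (k + p j)%R < 4)%N by rewrite -(ltr_nat R); lra.
  by case: (B _) c0 => [|[|[|[|]]]].
exists B'; split=> // k; rewrite leNgt; apply/negP => hlt.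
have e0 : 0 < (lam B' k - y) / 2 by lra.
have [m hm] := hy _ k e0; have [n hn] := lambda_agree k e0.
have [j [mj hj]] := hB' m n.
have := hn _ _ (pos_trB _ Bp) (letters123_pos B3) hj; rewrite lambda_tr ltr_norml.
have := hm _ mj; lra.
Qed.

Lemma markov_value_le B (x : R) : markov_value R B = x%:E -> forall k, lam B k <= x.
Proof.
move=> h k; rewrite -lee_fin -h; apply: ereal_sup_ubound; by exists k.
Qed.

Lemma markov_value_approx B (x e : R) : markov_value R B = x%:E -> 0 < e ->
  exists k, x - e < lam B k.
Proof.
move=> h e0; have : ((x - e)%:E < markov_value R B)%E by rewrite h lte_fin; lra.
by move=> /ereal_sup_gt[_ [k _ <-]]; rewrite lte_fin; exists k.
Qed.

Lemma markov_value_eq B k : (forall i, lam B i <= lam B k) ->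
  markov_value R B = (lam B k)%:E.
Proof.
move=> h; apply/le_anti/andP; split.
  by apply: ge_ereal_sup => _ [i _ <-]; rewrite lee_fin.
by apply: ereal_sup_ubound; exists k.
Qed.

Lemma inv_natS_lt (e : R) : 0 < e -> exists m, forall j, (m <= j)%N -> j.+1%:R^-1 < e.
Proof.
move=> e0; have [m _ hm] := near_infty_natSinv_lt (PosNum e0).
by exists m => j mj; exact: hm.
Qed.

Lemma markov_attained (x : R) : markov_spectrum R x -> x < 4%:R ->
  exists B, [/\ letters123 B, forall k, lam B k <= x & lam B 0 = x].
Proof.
move=> [B [Bp hB]] x4.
have hk (j : nat) : exists k, x - j.+1%:R^-1 < lam B k.
  by apply: markov_value_approx => //; rewrite invr_gt0.
have [p hp] := choice hk.
have [|B' [B3 hle hag]] := @limit_shift B x p Bp _ x4.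
  move=> e k e0; exists 0%N => j _; have := markov_value_le hB (k + p j); lra.
exists B'; split=> //; apply/le_anti; rewrite hle /= leNgt; apply/negP => hlt.
have e0 : 0 < (x - lam B' 0) / 2 by lra.
have [m hm] := inv_natS_lt e0; have [n hn] := lambda_agree 0 e0.
have [j [/hm mj hj]] := hag m n.
have := hn _ _ (pos_trB _ Bp) (letters123_pos B3) hj; rewrite lambda_tr add0r ltr_norml => /andP[h1 h2].
move: (hp j) mj h1 h2 hlt; set z := _^-1; set a := lam B (p j); set b := lam B' 0.
lra.
Qed.

Lemma limn_esup_lt (u : nat -> R) (y : R) e : limn_esup (fun n => (u n)%:E) = y%:E ->
  0 < e -> exists m, forall j, (m <= j)%N -> u j < y + e.
Proof.
rewrite limn_esup_lim => h e0.
have hinf : ereal_inf (range (esups (fun n => (u n)%:E))) = y%:E.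
  by rewrite -h; apply/esym/cvg_lim => //; apply: ereal_nonincreasing_cvgn; exact: nonincreasing_esups.
have : (ereal_inf (range (esups (fun n => (u n)%:E))) < (y + e)%:E)%E by rewrite hinf lte_fin; lra.
move=> /ereal_inf_lt[_ [m _ <-] hm]; exists m => j mj.
rewrite -lte_fin; apply: le_lt_trans hm; apply: ereal_sup_ubound; by exists j.
Qed.

Lemma limn_esup_gt (u : nat -> R) (y : R) e m : limn_esup (fun n => (u n)%:E) = y%:E ->
  0 < e -> exists2 j, (m <= j)%N & y - e < u j.
Proof.
rewrite limn_esup_lim => h e0.
have hinf : ereal_inf (range (esups (fun n => (u n)%:E))) = y%:E.
  by rewrite -h; apply/esym/cvg_lim => //; apply: ereal_nonincreasing_cvgn; exact: nonincreasing_esups.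
have : ((y - e)%:E < esups (fun n => (u n)%:E) m)%E.
  apply: (@lt_le_trans _ _ (ereal_inf (range (esups (fun n => (u n)%:E))))).
    by rewrite hinf lte_fin; lra.
  by apply: ereal_inf_lbound; exists m.
by move=> /ereal_sup_gt[_ [j mj <-]]; rewrite lte_fin; exists j.
Qed.

End Limits.

(** * Classification of the sequences attaining a value in the interval *)

Lemma periodic_eq n (f g : nat -> nat) : (0 < n)%N ->
  (forall i, f (i + n)%N = f i) -> (forall i, g (i + n)%N = g i) ->
  mkseq f n = mkseq g n -> f = g.
Proof.
move=> n0 hf hg /(congr1 (nth 0%N)) h; apply/funext => i.
elim/ltn_ind: i => i ih; case: (ltnP i n) => [ilt|ni].
  by have := congr1 (fun F => F i) h; rewrite !nth_mkseq.
by rewrite -(subnK ni) hf hg ih //; lia.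
Qed.

Lemma rperiodicD s i : rperiodic s (i + size s)%N = rperiodic s i.
Proof. by rewrite /rperiodic modnDr. Qed.

Lemma pre_rperiodic s : pre s (rperiodic s).
Proof. by apply/preP => i h; rewrite /rperiodic modn_small. Qed.

(** The period read rightwards from the starred letter and leftwards from the letter before it;
    [perR] and [perL] are the two halves of the periodic sequence whose value at the star is
    [j0]. *)
Definition wR : seq nat := wr ++ wl.
Definition wL : seq nat := rev wl ++ rev wr.
Definition perR : nat -> nat := rperiodic wR.
Definition perL : nat -> nat := rperiodic wL.

Lemma rcat_per s t : (0 < size s + size t)%N ->
  rcat s (rperiodic (t ++ s)) = rperiodic (s ++ t).
Proof.
move=> st0; apply: (@periodic_eq (size s + size t)) => // [i|i|].
- rewrite /rcat; case: (ltnP i (size s)) => ilt; last first.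
    rewrite ltnNge (leq_trans ilt (leq_addr _ _)) /=.
    by rewrite -addnBAC // (addnC (size s)) -size_cat rperiodicD.
  case: (ltnP (i + _)) => h; first by lia.
  rewrite /rperiodic modn_small; last by rewrite size_cat; lia.
  rewrite nth_cat (_ : i + _ - _ < size t = false)%N; last by apply/negbTE; lia.
  by congr nth; lia.
- by rewrite -size_cat rperiodicD.
rewrite -size_cat; apply: (@eq_from_nth _ 0%N); rewrite !size_mkseq // => i ilt.
rewrite !nth_mkseq // /rcat /rperiodic (modn_small ilt) [RHS]nth_cat.
case: (ltnP i (size s)) => // h; move: ilt; rewrite size_cat => ilt.
rewrite modn_small; last by rewrite size_cat; lia.
by rewrite nth_cat (_ : i - _ < size t)%N //; lia.
Qed.

Lemma rcat_wr : rcat wr (rperiodic w) = perR.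
Proof. by rewrite /perR /wR -rcat_per. Qed.

Lemma shift_perR n : shift (11 * n) perR = perR.
Proof.
apply/funext => i; rewrite /shift /perR addnC; elim: n i => [|n ih] i.
  by rewrite addn0.
by rewrite mulnSr addnA -[11%N]/(size wR) rperiodicD ih.
Qed.

(* [nform B]: [B] reads ... 21212112221 w w* w w w ..., with its starred letter at
   position 0, so that the first [w] starts at position -16. *)
Definition Kl : seq nat := rev (word 21212112221 ++ w ++ wl).
Definition nform (B : int -> nat) : Prop := pre Kl (ltail B 0) /\ rtail B 0 = perR.

Lemma step_ind (P : int -> Prop) (k d : int) :
  P k -> (forall p, P p -> P (p + d)) -> forall n : nat, P (k + d * n%:Z).
Proof.
move=> h0 hs; elim=> [|n ih]; first by rewrite mulr0 addr0.
by rewrite (_ : k + d * n.+1%:Z = k + d * n%:Z + d); [exact: hs|lia].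
Qed.

Lemma atL_perR B k : (forall n : nat, atL B (k + 11 * n%:Z)) -> rtail B k = perR.
Proof.
move=> h; apply/funext => i.
have [_ /preP hr] := h (i %/ 11)%N.
have ilt : (i %% 11 < 11)%N by rewrite ltn_mod.
have := hr _ ilt; rewrite /rtail.
have -> : k + 11 * (i %/ 11)%:Z + (i %% 11)%:Z = k + i%:Z.
  by rewrite -addrA; congr (_ + _); have := divn_eq i 11; lia.
by move=> ->; rewrite /perR /rperiodic (_ : size wR = 11)%N.
Qed.

Lemma atL_perL B k : (forall n : nat, atL B (k - 11 * n%:Z)) -> ltail B k = perL.
Proof.
move=> h; apply/funext => i.
have [_ /preP hr] := h (i %/ 11).+1.
have ilt : (i %% 11 < 11)%N by rewrite ltn_mod.
have ilt' : (10 - i %% 11 < 11)%N by lia.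
have := hr _ ilt'; rewrite /rtail.
have -> : k - 11 * (i %/ 11).+1%:Z + (10 - i %% 11)%N%:Z = k - i.+1%:Z.
  by rewrite -addrA; congr (_ + _); have := divn_eq i 11; lia.
rewrite /ltail => ->; rewrite /perL /rperiodic (_ : size wL = 11)%N //.
move: ilt; move: (i %% 11)%N; repeat (case=> //).
Qed.

(** What precedes a star, read leftwards, when at least two full copies of [w] come before the
    starred one. It differs from [Kl] for the first time at its last letter, of index 20: 2 instead
    of 1. *)
Definition Dl : seq nat := rev wl ++ rev w ++ [:: 1; 2; 2; 2; 2]%N.

Lemma nform_shift B n : nform B ->
  rtail B (11 * n.+1%:Z) = perR /\ pre Dl (ltail B (11 * n.+1%:Z)).
Proof.
move=> [hl hr].
have hR m : rtail B (11 * m%:Z) = perR.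
  by rewrite -(shift_perR m) -hr shift_rtail add0r PoszM.
split=> //.
have pw m : pre wR (rtail B (11 * m%:Z)) by rewrite hR; exact: pre_rperiodic.
have step m l : pre l (ltail B (11 * m%:Z)) -> pre (catrev wR l) (ltail B (11 * m.+1%:Z)).
  move=> h; have : win B (11 * m%:Z) l (wR ++ [::]) by rewrite cats0; split.
  move=> /win_move[+ _]; rewrite (_ : 11 * m%:Z + (size wR)%:Z = 11 * m.+1%:Z) //.
  by rewrite (_ : size wR = 11)%N //; lia.
elim: n => [|n ih].
  have h0 : pre Kl (ltail B (11 * 0%:Z)) by rewrite mulr0.
  have /step := h0; rewrite (_ : catrev wR Kl = Dl ++ drop (size Dl) (catrev wR Kl)) //.
  by move=> /pre_cat[].
have /step := ih; rewrite (_ : catrev wR Dl = Dl ++ drop (size Dl) (catrev wR Dl)) //.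
by move=> /pre_cat[].
Qed.

(** Such an overlap would be a period d < 11 of the word 22221 w 11122; the ten values are refuted
    one by one. *)
Lemma atL_overlap B s (d : nat) : (0 < d)%N -> (d < 11)%N ->
  atL B s -> atL B (s + d%:Z) -> False.
Proof.
move=> d0 d11 /win_catrev h1 /win_catrev h2.
have e : s + d%:Z - (size Ll)%:Z = s - (size Ll)%:Z + d%:Z by lia.
rewrite e in h2.
have key i : (i + d < 21)%N -> nth 0%N (catrev Ll Lr) (i + d) = nth 0%N (catrev Ll Lr) i.
  move=> ilt; move/preP: h1 => h1; move/preP: h2 => h2.
  rewrite -h1 // -h2; last by rewrite (_ : size _ = 21)%N //; lia.
  by rewrite /rtail; congr B; lia.
have : all (fun i => (i + d < 21)%N ==>
    (nth 0%N (catrev Ll Lr) (i + d) == nth 0%N (catrev Ll Lr) i)) (iota 0 21).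
  by apply/allP => i _; apply/implyP => /key ->.
by move: d0 d11; clear; move: d; do 11 (case=> //).
Qed.

Lemma atR_overlap B s (d : nat) : (0 < d)%N -> (d < 11)%N ->
  atR B s -> atR B (s + d%:Z) -> False.
Proof.
move=> d0 d11 /atR_rev h1 /atR_rev h2; apply: (atL_overlap d0 d11 h2).
by have -> : - (s + d%:Z) + d%:Z = - s by lia.
Qed.

Section Classification.
Variable R : realType.
Notation lam := (lambda R).
Notation below_j1 := (below_j1 R).
Notation i1_val := (i1_val R).
Notation j1_val := (j1_val R).

Definition j0_val : R := 3%:R + cf R (shift 1 perR) + cf R perL.

Lemma lambda_perR B k : rtail B k = perR ->
  lam B k = 3%:R + cf R (shift 1 perR) + cf R (ltail B k).
Proof.
move=> h; rewrite lambdaE -shift_rtail h.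
by have -> : B k = 3%N by rewrite -[k]addr0 -/(rtail B k 0) h.
Qed.

Lemma pos_perL : pos perL.
Proof.
move=> i; rewrite /perL /rperiodic (_ : size wL = 11)%N //.
have : (i %% 11 < 11)%N by rewrite ltn_mod.
by move: (i %% 11)%N; do 11 (case=> //).
Qed.

(** The comparison at the even index 20. It makes the second copy of [w] the maximum of its run and
    puts its value above [j0]. *)
Lemma cf_Kl_gt B B' : pos B -> pos B' -> pre Kl B -> pre Dl B' -> cf R B' < cf R B.
Proof.
move=> Bp Bp' h h'.
have := @cf_lex R (rev wl ++ rev w ++ [:: 1; 2; 2; 2]%N) 1%N 2%N B B' Bp Bp'.
apply=> //.
by move: h; rewrite (_ : Kl = rcons (rev wl ++ rev w ++ [:: 1; 2; 2; 2]%N) 1%N ++ drop 21 Kl) // => /pre_cat[].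
Qed.

Lemma nform_lambda B n : posB B -> nform B -> lam B (11 * n.+1%:Z) < lam B 0.
Proof.
move=> Bp hB; have [h1 h2] := nform_shift n hB; have [h3 h4] := hB.
rewrite (lambda_perR h1) (lambda_perR h4) ltrD2l.
exact: cf_Kl_gt (pos_ltail _ Bp) (pos_ltail _ Bp) h3 h2.
Qed.

Lemma nform_gt_j0 B : posB B -> nform B -> j0_val < lam B 0.
Proof.
move=> Bp [h3 h4]; rewrite (lambda_perR h4) ltrD2l.
apply: cf_Kl_gt (pos_ltail _ Bp) pos_perL h3 _.
by rewrite (_ : Dl = mkseq perL 21) //; exact: pre_mkseq.
Qed.

(** A minimal n finds the left end of the run. That the word fails one period further left is
    recorded for [lagrange_j0], which has to recognise ends of runs. *)
Lemma atL_dichotomy B k : below_j1 B -> atL B k ->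
  rtail B k = perR /\
  ((forall n : nat, atL B (k - 11 * n%:Z)) \/
   exists n : nat, [/\ nform (trB (k - 11 * n%:Z) B), atL B (k - 11 * n%:Z)
                     & ~ atL B (k - 11 * n%:Z - 11)]).
Proof.
move=> Bs h.
have hR p : atL B p -> rtail B p = perR.
  by move=> hp; apply: atL_perR; exact: (step_ind hp (fun q => @atL_next R B q Bs)).
split; first exact: hR.
have [hall|/existsNP hex] := pselect (forall n : nat, atL B (k - 11 * n%:Z)).
  by left.
have hex' : exists n : nat, ~~ `[< atL B (k - 11 * n%:Z) >].
  by case: hex => n hn; exists n; apply/asboolPn.
case: (ex_minnP hex') => -[|n] /asboolPn hn hmin.
  by case: hn; rewrite mulr0 subr0.
have hn' : atL B (k - 11 * n%:Z).
  by apply: contrapT => /asboolPn/hmin; rewrite ltnn.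
have hn2 : ~ atL B (k - 11 * n%:Z - 11).
  by rewrite (_ : k - 11 * n%:Z - 11 = k - 11 * n.+1%:Z) //; lia.
right; exists n; split=> //.
have hr := hR _ hn'.
have hpre : pre (wr ++ w ++ w ++ w) (rtail B (k - 11 * n%:Z)).
  by rewrite hr (_ : wr ++ w ++ w ++ w = mkseq perR 39) //; exact: pre_mkseq.
have [//|hl] := atL_prev Bs hn' hpre.
by split; rewrite ?ltail_tr ?rtail_tr add0r.
Qed.

Lemma lambda_per B k : rtail B k = perR -> ltail B k = perL -> lam B k = j0_val.
Proof. by move=> h1 h2; rewrite (lambda_perR h1) h2. Qed.

Lemma core_classification B (x : R) : below_j1 B -> (forall k, lam B k <= x) ->
  lam B 0 = x -> i1_val < x -> x <> j0_val ->
  exists B', [/\ below_j1 B', (forall k, lam B' k <= x), lam B' 0 = x & nform B'].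
Proof.
move=> Bs hle h0 hx hj.
wlog hat : B Bs hle h0 / atL B 0.
  move=> hwlog.
  have [|hat|hat] := lambda_dichotomy R 0 (below_j1_letters123 Bs) (below_j1_avoids Bs).
  - by rewrite h0 leNgt hx.
  - exact: hwlog hat.
  apply: (hwlog (revB B)); first exact: below_j1_rev.
  - by move=> k; rewrite lambda_rev.
  - by rewrite lambda_rev oppr0.
  by have := atR_rev B 0; rewrite oppr0 => <-.
have [hr [hl|[n [hn _ _]]]] := atL_dichotomy Bs hat.
  by case: hj; rewrite -h0; exact: lambda_per hr (atL_perL hl).
exists (trB (0 - 11 * n%:Z) B); split=> //.
- exact: below_j1_tr.
- by move=> k; rewrite lambda_tr.
apply/le_anti; rewrite lambda_tr hle /=.
(* The start of the run has at least the value of any later copy, and at most x. *)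
case: n hn => [|n] hn; first by rewrite mulr0 !subr0 h0.
have := nform_lambda n (pos_trB _ Bs.1) hn.
rewrite !lambda_tr (_ : 11 * n.+1%:Z + (0 - 11 * n.+1%:Z) = 0) ?h0; last lia.
exact: ltW.
Qed.

Lemma j1_lt4 : j1_val <= 4%:R.
Proof. by have /andP[_ h] := J1_bounds R; exact: le_trans h (Jhi_lt4 R). Qed.

Lemma markov_classification (x : R) : markov_spectrum R x -> i1_val < x -> x < j1_val ->
  x <> j0_val -> exists B, [/\ below_j1 B, (forall k, lam B k <= x), lam B 0 = x & nform B].
Proof.
move=> hM hI hJ hj.
have [|B [B3 hle h0]] := markov_attained hM; first exact: lt_le_trans hJ j1_lt4.
apply: (core_classification _ hle h0 hI hj); split; first exact: letters123_pos.
by move=> k; exact: le_lt_trans (hle k) hJ.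
Qed.

End Classification.

(** * The Lagrange spectrum meets the interval only at [j0] *)

Lemma agree_win21 n B B' k l r : size l = 10%N -> size r = 11%N ->
  agree n B B' -> `|k| + 11 <= n%:Z -> win B k l r -> win B' k l r.
Proof.
move=> sl sr h hk hw; apply: (agree_win h _ _ _ _ hw); rewrite ?sl ?sr; lia.
Qed.

Lemma agree_atL n B B' k : agree n B B' -> `|k| + 11 <= n%:Z -> atL B k -> atL B' k.
Proof. exact: agree_win21. Qed.

Lemma agree_atR n B B' k : agree n B B' -> `|k| + 11 <= n%:Z -> atR B k -> atR B' k.
Proof. exact: agree_win21. Qed.

Lemma atL_tr d B k : atL (trB d B) k <-> atL B (k + d).
Proof. by rewrite /atL /win rtail_tr ltail_tr. Qed.

Lemma atR_tr d B k : atR (trB d B) k <-> atR B (k + d).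
Proof. by rewrite /atR /win rtail_tr ltail_tr. Qed.

Section Lagrange.
Variable R : realType.
Notation lam := (lambda R).
Notation below_j1 := (below_j1 R).
Notation i1_val := (i1_val R).
Notation j1_val := (j1_val R).
Notation j0_val := (j0_val R).

Lemma atR_prev B k : below_j1 B -> atR B k -> atR B (k - 11).
Proof.
move=> Bs /atR_rev/(atL_next (below_j1_rev Bs)) h; apply/atR_rev.
by have -> : - (k - 11) = - k + 11 by lia.
Qed.

Lemma lagrange_limit B (y : R) (p : nat -> int) : posB B ->
  (forall e, 0 < e -> exists m, forall j, (m <= j)%N -> lam B j%:Z < y + e) ->
  y < j1_val -> (forall j, j%:Z <= p j) ->
  exists B', [/\ below_j1 B', forall k, lam B' k <= y &
    forall m n, exists j, (m <= j)%N /\ agree n (trB (p j) B) B'].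
Proof.
move=> Bp hy yJ hp.
have [||B' [B3 hle hag]] := @limit_shift R B y p Bp.
- move=> e k e0; have [m hm] := hy _ e0.
  exists (m + `|k|)%N => j mj; have := hp j => hpj.
  have : 0 <= k + p j by lia.
  have : (m <= absz (k + p j)%R)%N by lia.
  by move=> h1 h2; rewrite -[k + p j]gez0_abs //; exact: hm.
- exact: lt_le_trans yJ (j1_lt4 R).
exists B'; split=> //; split; first exact: letters123_pos.
by move=> k; exact: le_lt_trans (hle k) yJ.
Qed.

(* Otherwise a limit of shifts would contain the end of a run of copies of [w]. *)
Lemma eventually_steps B (y : R) : posB B ->
  (forall e, 0 < e -> exists m, forall j, (m <= j)%N -> lam B j%:Z < y + e) ->
  y < j1_val ->
  exists N : nat, forall p : int, N%:Z <= p ->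
    (atL B p -> atL B (p + 11)) /\ (atR B p -> atR B (p - 11)).
Proof.
move=> Bp hy yJ; apply: contrapT => /forallNP hN.
have hj (j : nat) : exists p : int, j%:Z <= p /\
    ((atL B p /\ ~ atL B (p + 11)) \/ (atR B p /\ ~ atR B (p - 11))).
  have /existsNP[p] := hN j.
  move=> /not_implyP[h1 /not_andP[/not_implyP[h2 h3]|/not_implyP[h2 h3]]]; exists p; split=> //.
    by left.
  by right.
have [p hp] := choice hj.
have [B' [Bs _ hag]] := lagrange_limit Bp hy yJ (fun j => (hp j).1).
have [j [_ h]] := hag 0%N 40%N.
have [_ [[h1 h2]|[h1 h2]]] := hp j.
- have a1 : atL B' 0 by apply: agree_atL h _ _ => //; rewrite atL_tr add0r.
  have a2 : atL B' 11 := atL_next Bs a1.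
  by apply: h2; rewrite addrC -atL_tr; apply: agree_atL (agree_sym h) _ a2.
have a1 : atR B' 0 by apply: agree_atR h _ _ => //; rewrite atR_tr add0r.
have a2 : atR B' (- 11) := atR_prev Bs a1.
by apply: h2; rewrite addrC -atR_tr; apply: agree_atR (agree_sym h) _ a2.
Qed.

(** If the run in the limit had an end on the left, this end would recur in [B] arbitrarily far to
    the right. Runs that far out never stop, so the run from one recurrence sweeps up to the next.
    Its copies cannot overlap the copy found there, so one of them stands exactly one period before
    it, where there should be none. *)
Lemma lagrange_j0 (y : R) : lagrange_spectrum R y -> i1_val < y -> y < j1_val -> y = j0_val.
Proof.
move=> [B [Bp hB]] yI yJ.
have hlt e : 0 < e -> exists m, forall j, (m <= j)%N -> lam B j%:Z < y + e.
  exact: (@limn_esup_lt R (fun k : nat => lam B k%:Z) y e hB).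
have [N hN] := eventually_steps Bp hlt yJ.
have hgt (j : nat) : exists p : nat, (j <= p)%N /\ y - j.+1%:R^-1 < lam B p%:Z.
  have [//|p h1 h2] := @limn_esup_gt R (fun k : nat => lam B k%:Z) y j.+1%:R^-1 j hB.
  by exists p.
have [p hp] := choice hgt.
have [//|B' [Bs hle hag]] := @lagrange_limit B y (fun j => (p j)%:Z) Bp hlt yJ.
  by move=> j; rewrite lez_nat; exact: (hp j).1.
have h0 : lam B' 0 = y.
  apply/le_anti; rewrite hle /= leNgt; apply/negP => hl.
  have e0 : 0 < (y - lam B' 0) / 2 by lra.
  have [m hm] := inv_natS_lt e0; have [n hn] := lambda_agree 0 e0.
  have [j [/hm mj hj]] := hag m n.
  have := hn _ _ (pos_trB _ Bp) Bs.1 hj; rewrite lambda_tr add0r ltr_norml => /andP[h1 h2].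
  move: (hp j).2 mj h1 h2 hl; set z := _^-1; set a := lam B (p j); set b := lam B' 0.
  lra.
have far n (k : int) : `|k| + 11 <= n%:Z -> exists j1 j2, [/\ N%:Z + `|k| <= (p j1)%:Z,
    (p j1)%:Z + 11 <= (p j2)%:Z, agree n (trB (p j1)%:Z B) B' & agree n (trB (p j2)%:Z B) B'].
  move=> _; have [j1 [h1 h2]] := hag (N + `|k|)%N n.
  have [j2 [h3 h4]] := hag (p j1 + 11)%N n.
  exists j1, j2; split=> //; have := (hp j1).1; have := (hp j2).1; lia.
(* The remainder is taken in 1, ..., 11: d = 11 means that the run arrives exactly one period short
   of b, and any smaller d is a forbidden overlap. *)
have split11 (a b : int) : a + 11 <= b -> exists i d : nat,
    [/\ (0 < d)%N, (d <= 11)%N & b = a + 11 * i%:Z + d%:Z].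
  move=> ab; exists ((absz (b - a)%R - 1) %/ 11)%N, ((absz (b - a)%R - 1) %% 11).+1.
  have lt : ((absz (b - a)%R - 1) %% 11 < 11)%N by rewrite ltn_mod.
  have := divn_eq (absz (b - a)%R - 1) 11; split=> //; lia.
have [|hat|hat] := lambda_dichotomy R 0 (below_j1_letters123 Bs) (below_j1_avoids Bs).
- by rewrite h0 leNgt yI.
- have [hr [hl|[n [_ h1 h2]]]] := atL_dichotomy Bs hat.
    by rewrite -h0; exact: lambda_per hr (atL_perL hl).
  move: h1 h2; set k : int := 0 - _ => h1 h2.
  pose M := (`|k| + 40)%N.
  have [//|j1 [j2 [hN1 h12 ag1 ag2]]] := far M k; first lia.
  have a1 : atL B (k + (p j1)%:Z).
    by rewrite -atL_tr; apply: agree_atL (agree_sym ag1) _ h1; lia.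
  have a2 : atL B (k + (p j2)%:Z).
    by rewrite -atL_tr; apply: agree_atL (agree_sym ag2) _ h1; lia.
  have a3 : ~ atL B (k + (p j2)%:Z - 11).
    move=> h; apply: h2; apply: agree_atL ag2 _ _; first lia.
    by rewrite atL_tr addrAC.
  have [//|i [d [d0 d11 e]]] := split11 (k + (p j1)%:Z) (k + (p j2)%:Z); first lia.
  have a4 : atL B (k + (p j1)%:Z + 11 * i%:Z).
    have := @step_ind (fun q => N%:Z <= q /\ atL B q) (k + (p j1)%:Z) 11.
    move=> /(_ _ _ i)[] //; first by split=> //; lia.
    by move=> q [q1 q2]; split; [lia|exact: (hN q q1).1].
  have [d11'|d11'] := eqVneq d 11%N.
    by case: a3; rewrite e d11' addrK.
  by case: (atL_overlap d0 _ a4); [lia|rewrite -e].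
(* The transposed case: runs now extend to the left, so the later recurrence is followed back to the
   earlier one. *)
have hat' : atL (revB B') 0 by have := atR_rev B' 0; rewrite oppr0 => <-.
have [hr [hl|[n [_ h1 h2]]]] := atL_dichotomy (below_j1_rev Bs) hat'.
  by rewrite -h0 -[0]oppr0 -lambda_rev; exact: lambda_per hr (atL_perL hl).
move: h1 h2; set k' : int := 0 - _ => h1 h2.
pose k := - k'; have ek : k' = - k by rewrite opprK.
have {}h1 : atR B' k by apply/atR_rev; rewrite -ek.
have {}h2 : ~ atR B' (k + 11).
  by move=> /atR_rev h; apply: h2; rewrite ek -opprD.
pose M := (`|k| + 40)%N.
have [//|j1 [j2 [hN1 h12 ag1 ag2]]] := far M k; first lia.
have a1 : atR B (k + (p j1)%:Z).
  by rewrite -atR_tr; apply: agree_atR (agree_sym ag1) _ h1; lia.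
have a2 : atR B (k + (p j2)%:Z).
  by rewrite -atR_tr; apply: agree_atR (agree_sym ag2) _ h1; lia.
have a3 : ~ atR B (k + (p j1)%:Z + 11).
  move=> h; apply: h2; apply: agree_atR ag1 _ _; first lia.
  by rewrite atR_tr addrAC.
have [//|i [d [d0 d11 e]]] := split11 (k + (p j1)%:Z) (k + (p j2)%:Z); first lia.
have a4 : atR B (k + (p j1)%:Z + d%:Z).
  have : forall m : nat, (m <= i)%N -> atR B (k + (p j2)%:Z - 11 * m%:Z).
    elim=> [_|m ih mi]; first by rewrite mulr0 subr0.
    have q1 : N%:Z <= k + (p j2)%:Z - 11 * m%:Z by lia.
    have := (hN _ q1).2 (ih (ltnW mi)).
    by rewrite (_ : k + (p j2)%:Z - 11 * m%:Z - 11 = k + (p j2)%:Z - 11 * m.+1%:Z) //; lia.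
  move=> /(_ i (leqnn _)); rewrite (_ : k + (p j2)%:Z - 11 * i%:Z = k + (p j1)%:Z + d%:Z) //; lia.
have [d11'|d11'] := eqVneq d 11%N.
  by case: a3; move: a4; rewrite d11'.
by case: (atR_overlap d0 _ a1 a4); lia.
Qed.

End Lagrange.

(** * The endpoints *)

Lemma rtail_biseq l u v r : rtail (biseq l u v r) 0 = rcat v r.
Proof. by apply/funext => n; rewrite /rtail add0r. Qed.

Lemma ltail_biseq l u v r : ltail (biseq l u v r) 0 = rcat (rev u) l.
Proof. by apply/funext => n; rewrite /ltail sub0r -NegzE. Qed.

Lemma biseq_eq l u v r B : rtail B 0 = rcat v r -> ltail B 0 = rcat (rev u) l ->
  biseq l u v r = B.
Proof.
move=> h1 h2; apply/funext => -[n|n].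
  by move: (congr1 (fun F => F n) h1); rewrite /rtail add0r.
by move: (congr1 (fun F => F n) h2); rewrite /ltail sub0r -NegzE.
Qed.

Lemma altD i : alt (i + 2) = alt i.
Proof. by rewrite /alt oddD addbF. Qed.

Lemma rperiodic12 : rperiodic (word 12) = alt.
Proof. by apply: (@periodic_eq 2) => // i; [exact: (rperiodicD (word 12))|exact: altD]. Qed.

Lemma lperiodic21 : lperiodic (word 21) = alt.
Proof. exact: rperiodic12. Qed.

Definition closeS (l r : seq nat) : bool :=
  if highb Ilo l r then true else pfx [:: 3%N] r.

Lemma searchS : search closeS balanced 20 [::] [::].
Proof. by vm_compute. Qed.

Fixpoint allhigh (q : frac) (n : nat) (l r : seq nat) : bool :=
  if n is m.+1 then
    if r is c :: r' then
      if (if eqn c 3 then highb q l r else true) then allhigh q m (c :: l) r' else false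
    else true
  else true.

(** The tails contain no 3, so only the letters 3 of u and v can compete with the central one; [q]
    is a lower bound of the central value. *)
Definition endpoint_check (q : frac) (u v : seq nat) : bool :=
  [&& all (mem [:: 1; 2; 3]%N) (u ++ 3%N :: v), leq_frac Ilo q,
      allhigh q (size u) altw (u ++ 3%N :: v ++ altw)
    & allhigh q (size v) (3%N :: rev u ++ altw) (v ++ altw)].

Lemma endpoint_Ilo : endpoint_check Ilo (rev LI) RI.
Proof. by vm_compute. Qed.

Lemma endpoint_Jlo : endpoint_check Jlo (rev LJ) RJ.
Proof. by vm_compute. Qed.

Lemma Jlo_gt0 : (0 < nat_of_bin Jlo.2)%N.
Proof. by apply: nat_of_bin_gt0; vm_compute. Qed.

Section Endpoints.
Variable R : realType.
Notation lam := (lambda R).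
Notation fr := (frac_val R).

Lemma lambda_small B k : letters123 B -> B k <> 3%N -> lam B k <= fr Ilo.
Proof.
move=> B3 hk; have h0 : win B k [::] [::] by [].
have [l [r [hc hw]]] := searchP B3 h0 searchS.
move: hc; rewrite /closeS; case: ifP => [hh _|_ /pfxP[t e]].
  exact: highbP (letters123_pos B3) Ilo_gt0 hw hh.
case: hw => _; rewrite e => /pre_cat[] /preP/(_ 0%N isT).
by rewrite /rtail addr0 => /hk.
Qed.

Lemma allhighP q n B k l r : posB B -> (0 < nat_of_bin q.2)%N -> win B k l r -> (n <= size r)%N ->
  allhigh q n l r -> forall i : nat, (i < n)%N -> B (k + i%:Z) = 3%N ->
  lam B (k + i%:Z) <= fr q.
Proof.
move=> Bp q0; elim: n k l r => // n ih k l [|c r] //= hw nr.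
case: ifP => // h1 h2 [_|i ilt].
  rewrite addr0 => e; move: h1.
  have ec : c = 3%N by case: hw => _ /pre_cons[<- _]; rewrite /rtail addr0.
  by rewrite ec eqnE eqxx => h1; rewrite ec in hw; exact: highbP Bp q0 hw h1.
have -> : k + i.+1%:Z = k + 1 + i%:Z by lia.
by apply: ih h2 i ilt => //; exact/winS.
Qed.

Lemma leq_fracN x y : (0 < nat_of_bin x.2)%N -> (0 < nat_of_bin y.2)%N ->
  ~~ leq_frac x y -> fr y < fr x.
Proof.
move=> x0 y0 /BinNat.N.leb_spec0 h.
rewrite /frac_val ltr_pdivrMr ?ltr0n // mulrAC ltr_pdivlMr ?ltr0n // -!natrM ltr_nat.
by rewrite -!nat_of_mul_bin; lia.
Qed.

(* Both endpoints are values of sequences [... 2 1 2 1 u v 1 2 1 2 ...]. *)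
Lemma endpoint_value q u v : all (mem [:: 1; 2; 3]%N) (u ++ 3%N :: v) ->
  (0 < nat_of_bin q.2)%N -> leq_frac Ilo q ->
  allhigh q (size u) altw (u ++ 3%N :: v ++ altw) ->
  allhigh q (size v) (3%N :: rev u ++ altw) (v ++ altw) ->
  let x := 3%:R + cft v (cf R alt) + cft (rev u) (cf R alt) in
  fr q <= x ->
  markov_value R (biseq alt u (3%N :: v) alt) = x%:E.
Proof.
move=> /allP h3 q0 /(leq_fracP R Ilo_gt0 q0) qI hu hv x qx.
have {}hu B k B3 hw hs := @allhighP q _ B k _ _ B3 q0 hw hs hu.
have {}hv B k B3 hw hs := @allhighP q _ B k _ _ B3 q0 hw hs hv.
set B := biseq _ _ _ _.
have hl : ltail B 0 = rcat (rev u) alt by exact: ltail_biseq.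
have hr : rtail B 0 = rcat (3%N :: v) alt by exact: rtail_biseq.
have alt3 n : alt n \in [:: 1; 2; 3]%N by rewrite /alt; case: odd.
have Bpos n : B (Posz n) = rcat (3%N :: v) alt n by [].
have Bneg n : B (Negz n) = rcat (rev u) alt n by [].
clearbody B.
have B3 : letters123 B.
  case=> n.
    rewrite Bpos /rcat; case: (ltnP n _) => // ilt.
    by apply: h3; rewrite mem_cat mem_nth ?orbT.
  rewrite Bneg /rcat; case: (ltnP n _) => // ilt.
  by apply: h3; rewrite mem_cat -[_ \in u]mem_rev mem_nth.
have pa s : pre (s ++ altw) (rcat s alt).
  by apply/pre_cat; split; [exact: pre_rcat|rewrite shift_rcat; exact: pre_mkseq].
have hw : win B 0 (rev u ++ altw) (3%N :: v ++ altw).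
  by rewrite -cat_cons; split; [rewrite hl|rewrite hr]; exact: pa.
have x0 : lam B 0 = x.
  have hw' : win B 0 (rev u) (3%N :: v).
    by split; [rewrite hl|rewrite hr]; exact: pre_rcat.
  rewrite (win_lambda R (letters123_pos B3) hw') /x -[(size v).+1]/(size (3%N :: v)).
  by rewrite -shift_rtail -shift_ltail hl hr !shift_rcat.
rewrite -x0; apply: markov_value_eq => k.
have [->//|k0] := eqVneq k 0.
rewrite x0; apply: le_trans qx.
have [hk|hk] := pselect (B k = 3%N); last first.
  apply: le_trans (lambda_small B3 hk) _.
  exact: qI.
have hw2 : win B (0 - (size u)%:Z) altw (u ++ 3%N :: v ++ altw).
  by apply/win_move; rewrite subrK catrevE.
have hw3 : win B 1 (3%N :: rev u ++ altw) (v ++ altw) := (winS _ _ _ _ _).1 hw.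
have altn3 n : alt n <> 3%N by rewrite /alt; case: odd.
case: k hk k0 => n hk k0.
  case: n hk k0 => // n hk _.
  have nv : (n < size v)%N.
    rewrite ltnNge; apply/negP => h; move: hk.
    rewrite Bpos /rcat /= ltnNge ltnS h /=; exact: altn3.
  have := hv _ _ (letters123_pos B3) hw3 _ n nv.
  rewrite (_ : 1 + n%:Z = n.+1%:Z) //; apply=> //.
  by rewrite size_cat leq_addr.
have nu : (n < size u)%N.
  rewrite ltnNge; apply/negP => h; move: hk.
  by rewrite Bneg /rcat size_rev ltnNge h /=; exact: altn3.
have := hu _ _ (letters123_pos B3) hw2 _ (size u - n.+1)%N.
rewrite (_ : 0 - (size u)%:Z + (size u - n.+1)%N%:Z = Negz n); last by rewrite NegzE; lia.
by apply=> //; [rewrite size_cat leq_addr|lia].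
Qed.

Lemma i1_eq : i1 R = (i1_val R)%:E.
Proof.
rewrite /i1 lperiodic21 rperiodic12.
rewrite (_ : word 123232111111112321 ++ word 12221 ++ wl = rev LI) //.
rewrite (_ : wr ++ word 11123 ++ word 212111111111232321 = 3%N :: RI) //.
have /and4P[h1 h2 h3 h4] := endpoint_Ilo.
have h5 : fr Ilo <= 3%:R + cft RI (cf R alt) + cft (rev (rev LI)) (cf R alt).
  rewrite revK -/(i1_val R); exact: (andP (I1_bounds R)).1.
rewrite (endpoint_value h1 Ilo_gt0 h2 h3 h4 h5) revK.
reflexivity.
Qed.

Lemma j1_eq : j1 R = (j1_val R)%:E.
Proof.
rewrite /j1 lperiodic21 rperiodic12.
rewrite (_ : word 1232321212112221 ++ w ++ w ++ wl = rev LJ) //.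
rewrite (_ : wr ++ w ++ word 11121 = 3%N :: RJ) //.
have /and4P[h1 h2 h3 h4] := endpoint_Jlo.
have h5 : fr Jlo <= 3%:R + cft RJ (cf R alt) + cft (rev (rev LJ)) (cf R alt).
  rewrite revK -/(j1_val R); exact: (andP (J1_bounds R)).1.
rewrite (endpoint_value h1 Jlo_gt0 h2 h3 h4 h5) revK.
reflexivity.
Qed.

End Endpoints.

(** * Sequences in normal form *)

Definition Kw : seq nat := word 21212112221.
(** Long enough for all tests: an occurrence starting after the first copy of [w] moves back by
    multiples of 11 to an offset below 22, and the words have at most 45 of the 77 letters. *)
Definition Sw : seq nat := Kw ++ w ++ w ++ w ++ w ++ w ++ w.

(* Can [f] end strictly after the prefix [Kw] of the word [Kw w w w ...], where
   the letters before this word are unknown? *)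
Definition before (f : seq nat) : bool :=
  has (fun n => (11 < size f - n)%N && pfx (drop n f) Sw) (iota 0 (size f)).
Definition inside (f : seq nat) (o : nat) : bool :=
  (11 < o + size f)%N && pfx f (drop o Sw).
Definition straddles (f : seq nat) : bool :=
  before f || has (inside f) (iota 0 22).

Lemma straddle_check :
  [&& all (fun f => ~~ straddles f && (0 < size f <= 45)%N) forb0,
      ~~ straddles (rev last_word), ~~ before last_word &
      all (fun o => inside last_word o ==> (o == 17)%N) (iota 0 22)].
Proof. by vm_compute. Qed.

Lemma pre_pfx s t a : pre s a -> pre t a -> (size s <= size t)%N -> pfx s t.
Proof.
move=> sa ta le; rewrite -ta -(subnKC le) mkseqD sa; exact: pfx_prefix.
Qed.

Lemma ltail_cat B k r : pre r (rtail B k) ->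
  ltail B (k + (size r)%:Z) = rcat (rev r) (ltail B k).
Proof.
move=> h; have : win B k [::] (r ++ [::]) by rewrite cats0.
move=> /win_move[hl _]; rewrite catrevE cats0 in hl.
by rewrite (rcat_shift hl) shift_ltail size_rev addrK.
Qed.

Lemma rtail_cat B k l : pre l (ltail B k) ->
  rtail B (k - (size l)%:Z) = rcat (rev l) (rtail B k).
Proof.
move=> h; have : win B k l [::] by [].
move=> /win_catrev; rewrite catrevE cats0 => hr.
by rewrite (rcat_shift hr) shift_rtail size_rev subrK.
Qed.

Lemma perR_w : shift 6 perR = rperiodic w.
Proof. by rewrite -rcat_wr -[6%N]/(size wr) shift_rcat. Qed.

Lemma w_perR : shift 5 (rperiodic w) = perR.
Proof. by rewrite -perR_w shiftD -[(6 + 5)%N]/(11 * 1)%N shift_perR. Qed.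

Lemma rcat_per1 s : (0 < size s)%N -> rcat s (rperiodic s) = rperiodic s.
Proof. by move=> s0; have := @rcat_per s [::]; rewrite addn0 cats0; apply. Qed.

Lemma rcat_ww : rcat (w ++ w) (rperiodic w) = rperiodic w.
Proof. by rewrite rcat_cat !rcat_per1. Qed.

Lemma nform_start B : nform B -> rtail B (- 27) = rcat Kw (rperiodic w).
Proof.
move=> [hl hr].
have := rtail_cat hl; rewrite hr -rcat_wr -rcat_cat sub0r.
have -> : - (size Kl)%:Z = - 27 by [].
move=> ->; have -> : rev Kl ++ wr = Kw ++ (w ++ w) by [].
by rewrite rcat_cat rcat_ww.
Qed.

Lemma pre_Sw : pre Sw (rcat Kw (rperiodic w)).
Proof. by vm_compute. Qed.

Lemma shift_w m r : shift (11 * m + r) (rperiodic w) = shift r (rperiodic w).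
Proof.
apply/funext => i; rewrite /shift /rperiodic -addnA mulnC.
by rewrite (_ : size w = 11)%N // modnMDl.
Qed.

Lemma nform_occ B (f : seq nat) p : nform B -> (0 < size f <= 45)%N -> occ B p f ->
  - 16 < p + (size f)%:Z ->
  before f \/ exists o m : nat, [/\ (o < 22)%N, inside f o & p = o%:Z - 27 + 11 * m%:Z].
Proof.
move=> hB /andP[f0 f45] ho hp; have hS := nform_start hB.
have [lt|ge] := ltP p (- 27).
  left; apply/hasP; exists (absz (p + 27)).
    by rewrite mem_iota add0n leq0n /=; lia.
  apply/andP; split; first lia.
  move: ho; rewrite -{1}(cat_take_drop (absz (p + 27)) f) => /pre_cat[_].
  rewrite shift_rtail size_takel; last lia.
  have -> : p + (absz (p + 27))%:Z = - 27 by lia.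
  rewrite hS => h; apply: pre_pfx h pre_Sw _.
  by rewrite size_drop (_ : size Sw = 77)%N //; lia.
right.
have fits o : (o < 22)%N -> pre f (shift o (rcat Kw (rperiodic w))) -> pfx f (drop o Sw).
  move=> lt22 h; apply: pre_pfx h _ _; last first.
    by rewrite size_drop (_ : size Sw = 77)%N //; lia.
  have := pre_Sw; rewrite -{1}(cat_take_drop o Sw) => /pre_cat[_].
  by rewrite size_takel // (_ : size Sw = 77)%N //; lia.
have ho' : pre f (shift (absz (p + 27)) (rcat Kw (rperiodic w))).
  rewrite -hS shift_rtail.
  by have -> : - 27 + (absz (p + 27))%:Z = p by lia.
set o0 := (absz (p + 27)) in ho' *.
have eo : p = o0%:Z - 27 by rewrite /o0; lia.
have [lt22|lt22] := ltnP o0 22.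
  exists o0, 0%N; split=> //; last by rewrite mulr0 addr0.
  by rewrite /inside fits // andbT; lia.
have rlt : ((o0 - 11) %% 11 < 11)%N by rewrite ltn_mod.
have eqm := divn_eq (o0 - 11) 11.
exists (11 + (o0 - 11) %% 11)%N, ((o0 - 11) %/ 11)%N; split; [lia| |lia].
rewrite /inside fits ?andbT; [lia|lia|].
have sK a : shift 11 (rcat Kw a) = a by rewrite -[11%N]/(size Kw) shift_rcat.
have e11 : o0 = (11 + (11 * ((o0 - 11) %/ 11) + (o0 - 11) %% 11))%N by lia.
by move: ho'; rewrite {1}e11 -(shiftD _ 11) sK shift_w -(shiftD _ 11) sK.
Qed.

Lemma nform_forb0 B (f : seq nat) p : f \in forb0 -> nform B -> occ B p f -> p + (size f)%:Z <= - 16.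
Proof.
have /and4P[/allP h _ _ _] := straddle_check.
move=> /h/andP[/norP[h1 h2] h3] hB ho; rewrite leNgt; apply/negP => hp.
have [hb|[a [m [lt22 hi _]]]] := nform_occ hB h3 ho hp; first by rewrite hb in h1.
by case/negP: h2; apply/hasP; exists a => //; rewrite mem_iota.
Qed.

Lemma atL_occ B k : atL B k -> occ B (k - 10) last_word.
Proof. by move=> /win_catrev. Qed.

Lemma atR_occ B k : atR B k -> occ B (k - 10) (rev last_word).
Proof. by move=> /win_catrev. Qed.

Lemma nform_atL B k : nform B -> atL B k -> - 16 < k + 11 -> exists m : nat, k = 11 * m%:Z.
Proof.
have /and4P[_ _ /negP h3 /allP h4] := straddle_check.
move=> hB /atL_occ ho hk.
have [||//|[a [m [lt22 hi e]]]] := nform_occ hB _ ho.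
- by [].
- by rewrite (_ : size last_word = 21%N) //; lia.
have := h4 a; rewrite mem_iota hi /= => /(_ lt22)/eqP eo.
by exists m; rewrite eo in e; lia.
Qed.

Lemma nform_atR B k : nform B -> atR B k -> k + 11 <= - 16.
Proof.
have /and4P[_ /norP[h1 h2] _ _] := straddle_check.
move=> hB /atR_occ ho; rewrite leNgt; apply/negP => hp.
have [||hb|[a [m [lt22 hi _]]]] := nform_occ hB _ ho.
- by [].
- by rewrite (_ : size (rev last_word) = 21%N) //; lia.
- by rewrite hb in h1.
by case/negP: h2; apply/hasP; exists a => //; rewrite mem_iota.
Qed.

Lemma forb0_forbidden : all (mem forbidden) forb0.
Proof. by vm_compute. Qed.

Lemma last_forbidden : (last_word \in forbidden) && (rev last_word \in forbidden).
Proof. by vm_compute. Qed.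

Lemma forbidden_forb0 :
  all (fun f => [|| f == last_word, f == rev last_word | f \in forb0]) forbidden.
Proof. by vm_compute. Qed.

Lemma forbidden_rev (f : seq nat) : f \in forbidden -> rev f \in forbidden.
Proof. exact: mem_cat_map_rev. Qed.

(** The starred copy of [w] ends just before position 6, so the bound confines the condition to
    gamma 21212112221 w w. Beyond it the last word does occur, around the star itself. *)
Definition cform (B : int -> nat) : Prop :=
  [/\ letters123 B, nform B &
      forall f : seq nat, f \in forbidden -> forall p, p + (size f)%:Z <= 6 -> ~ occ B p f].

(* The two-sided sequence with middle word [v].  The reflection that exchanges
   the two ends of [v], which occupies the positions from [- 16 - size v] to -17,
   is [k |-> - k - size v - 33]. *)
Definition twoform (v : seq nat) (B : int -> nat) : Prop :=
  ltail B 0 = rcat (rev wl ++ rev w ++ rev v) (rperiodic w) /\ rtail B 0 = perR.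
Definition mirror (v : seq nat) (B : int -> nat) : int -> nat :=
  trB ((size v)%:Z + 33) (revB B).

Lemma twoform_mirror v B : twoform v B -> twoform (rev v) (mirror v B).
Proof.
move=> [hl hr].
rewrite /twoform /mirror ltail_tr rtail_tr ltail_rev rtail_rev add0r.
pose u := rev wl ++ rev w ++ rev v.
have su : size u = (16 + size v)%N by rewrite /u !size_cat !size_rev.
have pu : pre (u ++ w ++ wl) (ltail B 0).
  rewrite hl; apply/pre_cat; rewrite -/u; split; first exact: pre_rcat.
  by rewrite shift_rcat (_ : w ++ wl = mkseq (rperiodic w) 16) //; exact: pre_mkseq.
have e : 1 - ((size v)%:Z + 33) = 0 - (size (u ++ w ++ wl))%:Z.
  by rewrite size_cat su (_ : size (w ++ wl) = 16)%N //; lia.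
rewrite e; split.
  rewrite (rtail_cat pu) hr -rcat_wr -rcat_cat.
  have -> : rev (u ++ w ++ wl) ++ wr = (rev wl ++ rev w ++ v) ++ w ++ (wl ++ wr).
    by rewrite /u !rev_cat !revK -!catA.
  by rewrite -[wl ++ wr]/w rcat_cat rcat_ww revK.
rewrite -shift_ltail hl -/u size_cat -shiftD shift_rcat.
by rewrite (_ : size (w ++ wl) = 11 * 1 + 5)%N // shift_w w_perR.
Qed.

Lemma twoform_middle v B : twoform v B -> pre v (rtail B (- 16 - (size v)%:Z)).
Proof.
move=> [hl hr]; pose u := rev wl ++ rev w ++ rev v.
have pu : pre u (ltail B 0) by rewrite hl; exact: pre_rcat.
have su : size u = (16 + size v)%N by rewrite /u !size_cat !size_rev.
have := rtail_cat pu.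
have -> : 0 - (size u)%:Z = - 16 - (size v)%:Z by rewrite su; lia.
by move=> ->; rewrite /u !rev_cat !revK -catA rcat_cat; exact: pre_rcat.
Qed.

Lemma lambda_mirror (R : realType) v B k :
  lambda R (mirror v B) k = lambda R B (- k - (size v)%:Z - 33).
Proof.
rewrite lambda_tr lambda_rev.
by have -> : - (k + ((size v)%:Z + 33)) = - k - (size v)%:Z - 33 by lia.
Qed.

Lemma mirror_atR v B k : atR B k <-> atL (mirror v B) (- k - (size v)%:Z - 33).
Proof.
rewrite atL_tr atR_rev.
by have -> : - k - (size v)%:Z - 33 + ((size v)%:Z + 33) = - k by lia.
Qed.

Lemma mirror_occ v B p f : occ B p f ->
  occ (mirror v B) (- 32 - (size v)%:Z - p - (size f)%:Z) (rev f).
Proof.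
move=> h; rewrite /mirror /occ rtail_tr; apply/occ_revB.
have -> // : 1 - (- 32 - (size v)%:Z - p - (size f)%:Z + ((size v)%:Z + 33)) - (size f)%:Z = p.
lia.
Qed.

Lemma twoform_nform t B : twoform (t ++ Kw) B -> nform B.
Proof.
move=> [hl hr]; split=> //; rewrite hl rev_cat.
by rewrite (_ : rev wl ++ rev w ++ rev Kw ++ rev t = Kl ++ rev t).
Qed.

(** * The maximum is at the star *)

Section Maximum.
Variable R : realType.
Notation lam := (lambda R).
Notation fr := (frac_val R).

Definition RX : seq nat := mkseq (shift 1 perR) 45.

Lemma nform_check :
  ~~ leq_frac (lamq 3 (lo RX) (lo Kl)) Ihi && ~~ leq_frac Jlo (lamq 3 (hi RX) (hi Kl)).
Proof. by vm_compute. Qed.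

Lemma Ihi_gt0 : (0 < nat_of_bin Ihi.2)%N.
Proof. by apply: nat_of_bin_gt0; vm_compute. Qed.

Lemma nform_bounds B : posB B -> nform B -> i1_val R < lam B 0 < j1_val R.
Proof.
move=> Bp [hl hr].
have hX : pre RX (rtail B (0 + 1)) by rewrite -shift_rtail hr; exact: pre_mkseq.
have h3 : B 0 = 3%N by rewrite -[0]addr0 -/(rtail B 0 0) hr.
have [a1 a2 a3 a4] := lo_hiP R (pos_rtail _ Bp) hX.
have [b1 b2 b3 b4] := lo_hiP R (pos_ltail _ Bp) hl.
have [e1 p1] := lamqP R 3 a3 b3; have [e2 p2] := lamqP R 3 a4 b4.
have /andP[/(leq_fracN R p1 Ihi_gt0) c1 /(leq_fracN R Jlo_gt0 p2) c2] := nform_check.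
rewrite e1 in c1; rewrite e2 in c2.
have /andP[_ i2] := I1_bounds R; have /andP[j1 _] := J1_bounds R.
rewrite lambdaE h3; move: a1 a2 b1 b2 c1 c2 i2 j1; clear.
move: (fr (lo RX)) (fr (hi RX)) (fr (lo Kl)) (fr (hi Kl)) (fr Ihi) (fr Jlo) (i1_val R) (j1_val R).
move: (cf R _) (cf R _) => x y a b c d e f g h *.
by apply/andP; split; lra.
Qed.

Lemma nform_max B : letters123 B -> nform B -> avoids forb0 B ->
  (forall k, atL B k -> lam B k <= lam B 0) ->
  (forall k, atR B k -> lam B k <= lam B 0) -> forall k, lam B k <= lam B 0.
Proof.
move=> B3 hB Ba hL hR k.
have [h|/hL//|/hR//] := lambda_dichotomy R k B3 Ba.
have /andP[h1 _] := nform_bounds (letters123_pos B3) hB.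
exact: le_trans h (ltW h1).
Qed.

Lemma nform_lambda_le B (m : nat) : posB B -> nform B -> lam B (11 * m%:Z) <= lam B 0.
Proof.
case: m => [|m] Bp hB; first by rewrite mulr0.
exact/ltW/nform_lambda.
Qed.

Lemma forb0_sub (f : seq nat) : f \in forb0 -> f \in forbidden.
Proof. exact: (allP forb0_forbidden f). Qed.

Lemma last_sub : last_word \in forbidden /\ rev last_word \in forbidden.
Proof. exact: (andP last_forbidden). Qed.

Lemma cform_max B : cform B -> forall k, lam B k <= lam B 0.
Proof.
move=> [B3 hB hF]; have Bp := letters123_pos B3.
apply: nform_max => // [f hf k ho|k hk|k hk].
- have h := nform_forb0 hf hB ho.
  by apply: (hF _ (forb0_sub hf) k) ho; lia.
- have [h|h] := ltP (- 16) (k + 11).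
    by have [m ->] := nform_atL hB hk h; exact: nform_lambda_le.
  exfalso; apply: (hF _ last_sub.1 (k - 10) _ (atL_occ hk)).
  by rewrite (_ : size last_word = 21%N) //; lia.
have h := nform_atR hB hk.
exfalso; apply: (hF _ last_sub.2 (k - 10) _ (atR_occ hk)).
by rewrite (_ : size (rev last_word) = 21%N) //; lia.
Qed.

(** Both [B] and its mirror image are normal forms. An occurrence outside the two runs therefore
    ends inside [v] and, by reflection, begins inside [v], where every forbidden word is excluded.
    The two runs are led by their stars, which [hm] compares. *)
Lemma twoform_max t t' B : letters123 B -> twoform (t ++ Kw) B -> t ++ Kw = rev Kw ++ t' ->
  (forall f, f \in forbidden -> ~~ infix f (t ++ Kw)) ->
  lam (mirror (t ++ Kw) B) 0 <= lam B 0 -> forall k, lam B k <= lam B 0.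
Proof.
set v := t ++ Kw => B3 hB ev hv hm.
have Bp := letters123_pos B3.
have hN := twoform_nform hB.
have hN' : nform (mirror v B).
  by apply: (@twoform_nform (rev t')); have := twoform_mirror hB; rewrite {1}ev rev_cat revK.
have Bp' : posB (mirror v B) by exact/pos_trB/pos_revB.
pose sv := (size v)%:Z.
have hocc (f : seq nat) p : f \in forbidden -> occ B p f -> p + (size f)%:Z <= - 16 -> - 16 - sv <= p -> False.
  move=> hf ho h1 h2; case/negP: (hv f hf).
  have hpre : pre v (rtail B (- 16 - sv)).
    exact: twoform_middle hB.
  have [i ei] : exists i : nat, p = - 16 - sv + i%:Z by exists (absz (p + 16 + sv)); lia.
  have iv : (i + size f <= size v)%N by move: h1 ei; rewrite /sv; lia.
  have hpre' : pre (drop i v) (rtail B p).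
    move: hpre; rewrite -{1}(cat_take_drop i v) => /pre_cat[_].
    rewrite shift_rtail size_takel; last exact: leq_trans (leq_addr _ _) iv.
    by rewrite -/sv -ei.
  have := pre_pfx ho hpre' _; rewrite size_drop leq_subRL; last exact: leq_trans (leq_addr _ _) iv.
  move=> /(_ iv).
  move=> /pfxP[t1 e1]; apply/infixP; exists (take i v), t1.
  by rewrite -e1 cat_take_drop.
have hocc' (f : seq nat) p : f \in forb0 -> ~ occ B p f.
  move=> hf ho; apply: (hocc f p (forb0_sub hf) ho).
    exact: nform_forb0 hf hN ho.
  have := nform_forb0 (mem_forb0_rev hf) hN' (mirror_occ v ho).
  by rewrite size_rev /sv; set n1 := size v; set n2 := size f; clearbody n1 n2; clear -n1; lia.
apply: nform_max => // [f hf k|k hk|k hk].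
- exact: hocc'.
- have [h|h] := ltP (- 16) (k + 11).
    by have [m ->] := nform_atL hN hk h; exact: nform_lambda_le.
  case: (hocc _ _ last_sub.1 (atL_occ hk)).
    by rewrite (_ : size last_word = 21%N) //; lia.
  have : atR (mirror v B) (- k - sv - 33).
    rewrite /mirror atR_tr /sv.
    have -> : - k - (size v)%:Z - 33 + ((size v)%:Z + 33) = - k by lia.
    exact/atL_rev.
  by move=> /(nform_atR hN'); lia.
move: hk => /(mirror_atR v) hk; rewrite -/sv in hk.
have -> : lam B k = lam (mirror v B) (- k - sv - 33).
  by rewrite lambda_mirror -/sv; congr lam; lia.
have [h|h] := ltP (- 16) (- k - sv - 33 + 11).
  have [m ->] := nform_atL hN' hk h.
  exact: le_trans (nform_lambda_le _ Bp' hN') hm.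
have hk' : atR B k by apply/(mirror_atR v).
case: (hocc _ _ last_sub.2 (atR_occ hk')).
  have := nform_atR hN hk'.
  by rewrite (_ : size (rev last_word) = 21%N) //; lia.
by lia.
Qed.

End Maximum.

(** * Extending words without forbidden factors *)

(** The states of the Aho-Corasick automaton of [forbidden]. *)
Definition prefixes : seq (seq nat) :=
  flatten [seq [seq take i f | i <- iota 0 (size f)] | f <- forbidden].

(** Sixteen letters from 1, 2 free the continuation: by [forbidden_3] and [uavoid_rcat], any letters
    1, 2 may then follow. *)
Definition tails : seq (seq nat) :=
  [:: nseq 16 1%N; nseq 16 2%N; flatten (nseq 8 [:: 1; 2]%N);
      2%N :: nseq 16 1%N; 2%N :: flatten (nseq 8 [:: 1; 2]%N)].

(* [has] with a lazy disjunction: [||] evaluates both sides under call-by-value. *)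
Fixpoint has_lazy (P : pred (seq nat)) (s : seq (seq nat)) : bool :=
  if s is x :: s' then if P x then true else has_lazy P s' else false.

Lemma has_lazyE P s : has_lazy P s = has P s.
Proof. by elim: s => //= x s ->; case: (P x). Qed.

(** Some words force their next letters, so perhaps no tail fits at once. All continuations by at
    most [d] letters are examined, among them the actual one; a branch closes when a tail fits or a
    forbidden word appears. *)
Fixpoint extends (d : nat) (p : seq nat) : bool :=
  if has_lazy (fun e => ~~ hasw forbidden (p ++ e)) tails then true else
  if hasw forbidden p then true else
  if d is d'.+1 then
    [&& extends d' (rcons p 1), extends d' (rcons p 2) & extends d' (rcons p 3)]
  else false.

Lemma extends_case d p : extends d p ->
  [\/ hasw forbidden p, exists2 e, e \in tails & ~~ hasw forbidden (p ++ e) |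
    exists2 d', d = d'.+1 & forall c, c \in [:: 1; 2; 3]%N -> extends d' (rcons p c)].
Proof.
have -> : extends d p = if has_lazy (fun e => ~~ hasw forbidden (p ++ e)) tails then true else
  if hasw forbidden p then true else
  if d is d'.+1 then
    [&& extends d' (rcons p 1), extends d' (rcons p 2) & extends d' (rcons p 3)]
  else false by case: d.
rewrite has_lazyE; case: ifP => [/hasP[e eT he] _|_]; first by constructor 2; exists e.
case: ifP => [h _|_]; first by constructor 1.
case: d => // d /and3P[h1 h2 h3]; constructor 3; exists d => // c.
by rewrite !inE => /or3P[] /eqP ->.
Qed.

Lemma extends_prefixes : all (extends 3) prefixes.
Proof. by vm_compute. Qed.

Lemma nil_prefixes : [::] \in prefixes.
Proof. by vm_compute. Qed.

(* Every forbidden word has at most 16 letters after its last letter 3. *)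
Lemma forbidden_3 : all (fun f =>
  has (fun j => (nth 0%N f j == 3)%N && (size f <= j.+1 + 16)%N) (iota 0 (size f))) forbidden.
Proof. by vm_compute. Qed.

Lemma tails_12 : all (fun e => (16 <= size e)%N && all (mem [:: 1; 2]%N) e) tails.
Proof. by vm_compute. Qed.

Definition uavoid (u : nat -> nat) : Prop :=
  forall f : seq nat, f \in forbidden -> forall k, ~ pre f (shift k u).

Lemma pre_infix f s k u : pre f (shift k u) -> pre s u -> (k + size f <= size s)%N ->
  infix f s.
Proof.
move=> hf hs le.
have hd : pre (drop k s) (shift k u).
  move: hs; rewrite -{1}(cat_take_drop k s) => /pre_cat[_].
  by rewrite size_takel // (leq_trans (leq_addr _ _) le).
have := pre_pfx hf hd; rewrite size_drop leq_subRL ?(leq_trans (leq_addr _ _) le) //.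
move=> /(_ le)/pfxP[t e]; apply/infixP; exists (take k s), t.
by rewrite -e cat_take_drop.
Qed.

Lemma uavoid_pre u s : uavoid u -> pre s u -> ~~ hasw forbidden s.
Proof.
move=> hu hs; apply/negP => /haswP[f fF /infixP[a [b e]]].
apply: (hu f fF (size a)); move: hs; rewrite e => /pre_cat[_ /pre_cat[]] //.
Qed.

Lemma prefixesP f i : f \in forbidden -> (i < size f)%N -> take i f \in prefixes.
Proof.
move=> fF ilt; apply/flatten_mapP; exists f => //.
by apply: map_f; rewrite mem_iota.
Qed.

(* Only the longest suffix of [s] that is a proper prefix of a forbidden word
   matters for the words that may follow [s]. *)
Lemma suffix_state s : ~~ hasw forbidden s ->
  exists a p, [/\ s = a ++ p, p \in prefixes &
    forall e, hasw forbidden (s ++ e) -> hasw forbidden (p ++ e)].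
Proof.
move=> hs.
have hex : exists i, drop i s \in prefixes by exists (size s); rewrite drop_size nil_prefixes.
case: (ex_minnP hex) => i hi imin.
exists (take i s), (drop i s); split=> //; first by rewrite cat_take_drop.
move=> e /haswP[f fF /infixP[a [b eab]]].
have [sa|sa] := leqP (size s) (size a).
  apply: (hasw_infix fF); apply/infixP.
  exists (drop i s ++ drop (size s) a), b.
  have e1 : drop (size s) (s ++ e) = e := drop_size_cat e erefl.
  rewrite -catA; congr (_ ++ _); rewrite -e1 eab drop_cat.
  case: ltnP => h; first by [].
  have -> : size s = size a by apply/eqP; rewrite eqn_leq sa h.
  by rewrite drop_size subnn drop0.
have ea : a = take (size a) s.
  have := congr1 (take (size a)) eab; rewrite (take_size_cat (f ++ b) (erefl (size a))).
  by rewrite takel_cat ?(ltnW sa).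
have ef : drop (size a) s ++ e = f ++ b.
  have := congr1 (drop (size a)) eab; rewrite (drop_size_cat (f ++ b) (erefl (size a))).
  by rewrite drop_cat sa.
have [sf|sf] := leqP (size f) (size s - size a).
  case/negP: hs; apply: (hasw_infix fF); apply/infixP.
  exists a, (drop (size f) (drop (size a) s)).
  rewrite {1}(_ : s = a ++ drop (size a) s); last by rewrite {1}ea cat_take_drop.
  congr (_ ++ _); have := congr1 (take (size f)) ef.
  rewrite (take_size_cat b (erefl (size f))) takel_cat ?size_drop // => e1.
  by rewrite -{1}e1 cat_take_drop.
have hpr : drop (size a) s \in prefixes.
  have -> : drop (size a) s = take (size s - size a) f.
    have := congr1 (take (size s - size a)) ef.
    by rewrite (take_size_cat e (size_drop _ _)) takel_cat ?(ltnW sf).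
  exact: prefixesP.
have le := imin _ hpr.
apply: (hasw_infix fF); apply/infixP; exists (drop i (take (size a) s)), b.
rewrite -ef catA; congr (_ ++ _).
rewrite -{1}(cat_take_drop (size a) s) drop_cat size_takel ?(ltnW sa) //.
case: ltnP => // h; have -> : i = size a by apply/eqP; rewrite eqn_leq le h.
by rewrite subnn drop0 -ea drop_size.
Qed.

Lemma extend_word d p s a (u : nat -> nat) : (forall n, u n \in [:: 1; 2; 3]%N) -> uavoid u ->
  pre s u -> s = a ++ p ->
  (forall e, hasw forbidden (s ++ e) -> hasw forbidden (p ++ e)) ->
  extends d p -> exists t e : seq nat, [/\ pre (s ++ t) u, e \in tails & ~~ hasw forbidden (s ++ t ++ e)].
Proof.
move=> u3 hu; elim/ltn_ind: d p s => d ih p s hs es hp.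
case/extends_case => [hf|[e eT he]|[d' ed hd']].
- case/negP: (uavoid_pre hu hs); rewrite es.
  have [f fF /infixP[x [y e]]] := haswP hf.
  by apply: (hasw_infix fF); apply/infixP; exists (a ++ x), y; rewrite e !catA.
- exists [::], e; split; rewrite ?cats0 //.
  by apply: contra he; exact: hp.
have hd := hd' _ (u3 (size s)).
have hs' : pre (rcons s (u (size s))) u by apply/pre_rcons.
have [|||t [e [k1 k2 k3]]] := ih d' _ _ (rcons s (u (size s))) hs' _ _ hd.
- by rewrite ed.
- by rewrite es rcons_cat.
- by move=> e; rewrite !cat_rcons; exact: hp.
by exists (u (size s) :: t), e; split=> //; rewrite ?cat_cons -cat_rcons.
Qed.

(** The last 3 of a forbidden word would lie in [s]; at most 16 letters follow it, so the whole word
    would lie in [s ++ e]. *)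
Lemma uavoid_rcat (s e : seq nat) (tl : nat -> nat) : (16 <= size e)%N ->
  all (mem [:: 1; 2]%N) e -> (forall i, tl i \in [:: 1; 2]%N) ->
  ~~ hasw forbidden (s ++ e) -> uavoid (rcat (s ++ e) tl).
Proof.
move=> e16 /allP e12 htl hs f fF k hk.
have not3 i : (size s <= i)%N -> rcat (s ++ e) tl i \in [:: 1; 2]%N.
  move=> le; rewrite /rcat; case: (ltnP i (size (s ++ e))) => [ilt|_]; last exact: htl.
  rewrite nth_cat ltnNge le /=; apply: e12; apply: mem_nth.
  by rewrite ltn_subLR // -size_cat.
have /hasP[j] := allP forbidden_3 _ fF.
rewrite mem_iota add0n => /andP[_ jlt] /andP[/eqP e3 f16].
have kj : (k + j < size s)%N.
  rewrite ltnNge; apply/negP => /not3.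
  by move/preP: hk => /(_ j jlt); rewrite e3 /shift => ->.
case/negP: hs; apply: (hasw_infix fF); apply: (pre_infix hk (pre_rcat _ _)).
rewrite size_cat.
apply: leq_trans (_ : k + (j.+1 + 16) <= _)%N; first by rewrite leq_add2l.
have kj1 : (k + j.+1 <= size s)%N by rewrite addnS.
by rewrite addnA; exact: leq_add kj1 e16.
Qed.

Lemma uavoid_perturb (u : nat -> nat) n : (forall n, u n \in [:: 1; 2; 3]%N) -> uavoid u ->
  exists u', [/\ forall n, u' n \in [:: 1; 2; 3]%N, uavoid u', pre (mkseq u n) u' & u' <> u].
Proof.
move=> u3 hu; have hs := pre_mkseq u n.
have [a [p [es hp hpe]]] := suffix_state (uavoid_pre hu hs).
have [t [e [k1 k2 k3]]] := extend_word u3 hu hs es hpe (allP extends_prefixes _ hp).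
have /andP[e16 e12] : (16 <= size e)%N && all (mem [:: 1; 2]%N) e := allP tails_12 _ k2.
rewrite catA in k3; set s := mkseq u n ++ t in k1 k3.
(* Differs from [u] at every index, so the new word is not [u]. *)
pose tl i := if u (size (s ++ e) + i)%N == 1%N then 2%N else 1%N.
have htl i : tl i \in [:: 1; 2]%N by rewrite /tl; case: ifP.
exists (rcat (s ++ e) tl); split.
- move=> i; rewrite /rcat; case: (ltnP i (size (s ++ e))) => [ilt|_]; last first.
    by have := htl (i - size (s ++ e))%N; rewrite !inE => /orP[] ->; rewrite ?orbT.
  rewrite nth_cat; case: (ltnP i (size s)) => h.
    by move/preP: k1 => /(_ i h) <-; exact: u3.
  have : nth 0%N e (i - size s) \in [:: 1; 2]%N.
    by apply: (allP e12); apply: mem_nth; rewrite ltn_subLR // -size_cat.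
  by rewrite !inE => /orP[] ->; rewrite ?orbT.
- exact: uavoid_rcat.
- by have := pre_rcat (s ++ e) tl; rewrite /s -catA => /pre_cat[].
move=> /(congr1 (fun F => F (size (s ++ e) + 0)%N)).
rewrite -/(shift (size (s ++ e)) (rcat (s ++ e) tl) 0) shift_rcat /tl.
by case: eqP => [->//|h /esym/h].
Qed.

(** * The Cantor set *)

Section Cantor.
Variable R : realType.
Notation lam := (lambda R).

Lemma nform_win B : nform B -> win B 0 Kl wr.
Proof.
by move=> [hl hr]; split=> //; rewrite hr -rcat_wr; exact: pre_rcat.
Qed.

Lemma nform_ltail6 B : nform B -> ltail B 6 = rcat (rev wr) (ltail B 0).
Proof. by move=> /nform_win[_ /ltail_cat]. Qed.

Lemma occ_ltail B (c : int) (k : nat) f :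
  occ B (c - k%:Z - (size f)%:Z) f <-> pre (rev f) (shift k (ltail B c)).
Proof.
rewrite shift_ltail; split=> [h|h].
  have := @occ_win B (c - k%:Z - (size f)%:Z) (rev f) [::].
  rewrite catrevE cats0 revK size_rev subrK => /(_ h)[] //.
have := @win_catrev B (c - k%:Z) (rev f) [::].
by rewrite catrevE cats0 revK size_rev; apply.
Qed.

Lemma cform_uavoid B : nform B -> letters123 B -> (cform B <-> uavoid (ltail B 6)).
Proof.
move=> hN h3; split=> [[_ _ hF] f fF k|hu].
  have h6 : 6 - k%:Z - (size (rev f))%:Z + (size (rev f))%:Z <= 6 by rewrite subrK; lia.
  have h := hF _ (forbidden_rev fF) (6 - k%:Z - (size (rev f))%:Z) h6.
  by move=> hp; apply: h; apply/occ_ltail; rewrite revK.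
split=> // f fF p hp ho.
have h := hu _ (forbidden_rev fF) (absz (6 - p - (size f)%:Z)%R); apply: h.
apply/occ_ltail; move: ho.
by have -> // : 6 - (absz (6 - p - (size f)%:Z)%R)%:Z - (size f)%:Z = p by lia.
Qed.

Lemma perR_123 n : perR n \in [:: 1; 2; 3]%N.
Proof.
rewrite /perR /rperiodic; have : (n %% size wR < size wR)%N by rewrite ltn_mod.
by move=> /(mem_nth 0%N); apply: (allP (isT : all (mem [:: 1; 2; 3]%N) wR)).
Qed.

Lemma perR_letters123 B : rtail B 0 = perR -> (forall n, ltail B 0 n \in [:: 1; 2; 3]%N) -> letters123 B.
Proof.
move=> hr hl [] n.
  by have := perR_123 n; rewrite -hr /rtail add0r.
by have := hl n; rewrite /ltail sub0r -NegzE.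
Qed.

Lemma lcontains_pre u (f : seq nat) : lcontains u f <-> exists k, pre (rev f) (shift k u).
Proof. by rewrite /lcontains; split=> -[k hk]; exists k; move: hk; rewrite /pre size_rev. Qed.

Lemma cantor_partP (x : R) : cantor_part R x <-> exists B, cform B /\ lam B 0 = x.
Proof.
split=> [[gamma [h3 hF ->]]|[B [[B3 hN hF] <-]]].
  set B := biseq _ _ _ _; exists B; split=> //.
  have hl : ltail B 0 = rcat Kl gamma by exact: ltail_biseq.
  have hr : rtail B 0 = perR by rewrite -rcat_wr; exact: rtail_biseq.
  clearbody B.
  have hN : nform B by split=> //; rewrite hl; exact: pre_rcat.
  have e6 : ltail B 6 = lcat gamma (word 21212112221 ++ w ++ w).
    by rewrite (nform_ltail6 hN) hl -rcat_cat.
  have hB3 : letters123 B.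
    apply: perR_letters123 => // n; have := h3 (6 + n)%N; rewrite -e6 (nform_ltail6 hN).
    by rewrite -/(shift (size (rev wr)) (rcat (rev wr) (ltail B 0)) n) shift_rcat.
  apply/(cform_uavoid hN hB3) => f fF k hk; rewrite e6 in hk.
  apply: (hF _ (forbidden_rev fF)); apply/lcontains_pre; exists k.
  by rewrite revK.
exists (shift (size Kl) (ltail B 0)).
have hl := rcat_shift hN.1.
have e6 : lcat (shift (size Kl) (ltail B 0)) (word 21212112221 ++ w ++ w) = ltail B 6.
  by rewrite (nform_ltail6 hN) {2}hl -rcat_cat.
rewrite e6; split=> [n|f fF /lcontains_pre[k hk]|]; first exact: B3.
  have /(cform_uavoid hN B3) := And3 B3 hN hF.
  by move=> /(_ _ (forbidden_rev fF) k).
congr lam; apply/esym/biseq_eq; first by rewrite rcat_wr hN.2.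
by rewrite {1}hl.
Qed.

Lemma nform_inj B B' : posB B -> posB B' -> rtail B 0 = perR -> rtail B' 0 = perR ->
  lam B 0 = lam B' 0 -> ltail B 0 = ltail B' 0.
Proof.
move=> Bp Bp' h h'; rewrite (lambda_perR _ h) (lambda_perR _ h') => /addrI.
exact: cf_inj (pos_ltail _ Bp) (pos_ltail _ Bp').
Qed.

Lemma tails_eq B B' : ltail B 0 = ltail B' 0 -> rtail B 0 = rtail B' 0 -> B = B'.
Proof.
move=> hl hr; apply/funext => -[] n.
  by have := congr1 (fun F => F n) hr; rewrite /rtail !add0r.
by have := congr1 (fun F => F n) hl; rewrite /ltail !sub0r -NegzE.
Qed.

Lemma cantor_part_perturb (x e : R) : cantor_part R x -> 0 < e ->
  exists y, [/\ cantor_part R y, y <> x & `|x - y| < e].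
Proof.
move=> /cantor_partP[B [hC <-]] e0; have [B3 hN _] := hC.
have [n hn] := @lambda_agree R e 0 e0.
have hu : uavoid (ltail B 6) by apply/(cform_uavoid hN B3).
(* The first 33 letters spell [rev wr] and [Kl]; keeping them preserves the normal form, and the
   others keep the value within e. *)
have [u' [u3 hu' hpre hne]] := @uavoid_perturb (ltail B 6) (n + 50) (fun i => B3 _) hu.
pose B' := biseq (shift 6 u') [::] wr (rperiodic w).
have hl : ltail B' 0 = shift 6 u' by rewrite /B' ltail_biseq; apply/funext => i; rewrite /rcat subn0.
have hr : rtail B' 0 = perR by rewrite /B' rtail_biseq rcat_wr.
clearbody B'.
have ag i : (i < n + 50)%N -> u' i = ltail B 6 i.
  move=> ilt; move/preP: hpre => ->; rewrite ?size_mkseq //.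
  by rewrite nth_mkseq.
have agl i : (i < n + 44)%N -> ltail B' 0 i = ltail B 0 i.
  move=> ilt; rewrite hl /shift ag; last lia.
  by rewrite /ltail; congr B; lia.
have hN' : nform B'.
  split=> //; apply/preP => i ilt; rewrite agl; first by move/preP: hN.1 => ->.
  by move: ilt; rewrite (_ : size Kl = 27%N) //; lia.
have e6 : ltail B' 6 = u'.
  rewrite (nform_ltail6 hN') hl -[6%N]/(size (rev wr)) -rcat_shift //.
  apply/preP => i ilt; rewrite ag; last by move: ilt; rewrite (_ : size (rev wr) = 6%N) //; lia.
  by move: i ilt; apply/preP; rewrite (nform_ltail6 hN); exact: pre_rcat.
have B3' : letters123 B'.
  by apply: perR_letters123 => // i; rewrite hl; exact: u3.
have hC' : cform B' by apply/(cform_uavoid hN' B3'); rewrite e6.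
exists (lam B' 0); split.
- by apply/cantor_partP; exists B'.
- move=> he; apply: hne; rewrite -e6 (nform_ltail6 hN') (nform_ltail6 hN).
  by rewrite (nform_inj (letters123_pos B3') (letters123_pos B3) hN'.2 hN.2 he).
apply: hn; [exact: letters123_pos|exact: letters123_pos|].
move=> [] i h1 h2.
  by have := congr1 (fun F => F i) hN.2; rewrite -hN'.2 /rtail !add0r.
have := agl i ltac:(lia); by rewrite /ltail !sub0r -NegzE.
Qed.

Lemma nform_limit (Bs : nat -> int -> nat) (x : R) :
  (forall j, letters123 (Bs j)) -> (forall j, nform (Bs j)) ->
  (forall e, 0 < e -> exists m, forall j, (m <= j)%N -> `|lam (Bs j) 0 - x| < e) ->
  exists B, [/\ letters123 B, nform B, lam B 0 = x &
    forall m n, exists j, (m <= j)%N /\ agree n (Bs j) B].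
Proof.
move=> B3 hN hx.
have [k|B [hB3 hag]] := @word_compactness Bs; first by exists 0%N => j _; exact: B3.
exists B; split=> //.
- split.
    have [j [_ h]] := hag 0%N 40%N.
    by have [] := agree_win h _ _ _ _ (nform_win (hN j)).
  apply/funext => i; have [j [_ h]] := hag 0%N i.
  by rewrite -(hN j).2 /rtail add0r h //; lia.
apply/eqP/negPn/negP => /eqP hne.
have e0 : 0 < `|lam B 0 - x| / 2 by rewrite divr_gt0 // normr_gt0 subr_eq0; apply/eqP.
have [m hm] := hx _ e0; have [n hn] := lambda_agree 0 e0.
have [j [mj h]] := hag m n.
have h1 := hm _ mj; have h2 := hn _ _ (letters123_pos (B3 j)) (letters123_pos hB3) h.
have := ler_distD (lam (Bs j) 0) (lam B 0) x.
rewrite (distrC (lam B 0) (lam (Bs j) 0)); lra.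
Qed.

Lemma cantor_part_closed : closed (cantor_part R).
Proof.
move=> x hx.
have hj (j : nat) : exists B, cform B /\ `|lam B 0 - x| < j.+1%:R^-1.
  have j0 : 0 < j.+1%:R^-1 :> R by rewrite invr_gt0.
  have [y [/cantor_partP[B [hB <-]] hy]] := hx _ (nbhsx_ballx x _ j0).
  by exists B; split=> //; rewrite distrC.
have [Bs hBs] := choice hj.
have [||e e0|B [B3 hN hx0 hag]] := @nform_limit Bs x.
- by move=> j; have [[]] := hBs j.
- by move=> j; have [[]] := hBs j.
- have [m hm] := inv_natS_lt e0; exists m => j /hm; exact: lt_trans (hBs j).2.
apply/cantor_partP; exists B; split=> //; split=> // f fF p hp ho.
have [j [_ h]] := hag 0%N (absz p + size f)%N.
have [[_ _ hF] _] := hBs j.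
apply: (hF f fF p hp).
have hw : win B p [::] f by split.
have hw' : win (Bs j) p [::] f by apply: agree_win (agree_sym h) _ _ _ _ hw; rewrite /=; lia.
exact: hw'.2.
Qed.

(** All elements are the constant c plus an infinite continued fraction, which is irrational; so no
    c + q with q rational is an element. *)
Lemma cantor_part_gap (x y : R) : x < y ->
  exists z, ~ cantor_part R z /\ x < z < y.
Proof.
move=> xy; pose c : R := 3%:R + cf R (shift 1 perR).
have [|q] := @rat_in_itvoo R (x - c) (y - c); first by rewrite ltrD2r.
rewrite in_itv /= => /andP[q1 q2]; exists (c + ratr q); split; last by apply/andP; split; lra.
move=> /cantor_partP[B [[B3 hN _]]]; rewrite (lambda_perR _ hN.2) => /addrI e.
have lp := pos_ltail 0 (letters123_pos B3).
have /andP[q0 _] := cf_itv R lp.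
rewrite e ltr0q in q0.
apply: (@cf_irrational R (ltail B 0) `|numq q|%N `|denq q|%N lp).
  by rewrite absz_gt0 denq_neq0.
rewrite e /ratr -{1}(gez0_abs (ltW (denq_gt0 q))) -{1}(@gez0_abs (numq q)) //.
by rewrite numq_ge0 ltW.
Qed.

End Cantor.

(** * Recognising a Cantor set of reals *)

Section RealCantor.
Variable R : realType.
Notation lam := (lambda R).

Lemma compact_set_type (A : set R) : compact A -> compact [set: set_type A].
Proof.
move=> cA F FF _.
have hA : (set_val @ F) A.
  apply: (@filterS _ F _ setT) => [z _|]; first exact: set_mem (valP z).
  exact: filterT.
have [p [Ap clp]] := cA (set_val @ F) (fmap_proper_filter _ FF) hA.
exists (exist _ p (mem_set Ap)); split=> // B C FB [V [[W oW <-] Wp VC]].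
have h1 : (set_val @ F) (set_val @` B).
  by apply: (@filterS _ F _ B) => // z Bz; exists z.
have h2 : nbhs p W by apply: open_nbhs_nbhs.
have [_ [[z Bz <-] Wz]] := clp _ _ h1 h2.
by exists z; split=> //; exact: VC.
Qed.

(** A cut at a point outside [A] splits [A] into two clopen pieces. This gives zero-dimensionality,
    and the Hausdorff property follows from it. *)
Lemma cantor_setP (A : set R) : A !=set0 -> compact A ->
  (forall x e, A x -> 0 < e -> exists y, [/\ A y, y <> x & `|x - y| < e]) ->
  (forall x y : R, x < y -> exists z, ~ A z /\ x < z < y) ->
  cantor_set A.
Proof.
move=> A0 cA hp hg; split=> //.
have zd : zero_dimensional (set_type A).
  have sep (x y : set_type A) : set_val x < set_val y ->
      exists U : set (set_type A), [/\ clopen U, U x & ~ U y].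
    move=> /hg[z [nz /andP[xz zy]]].
    exists (set_val @^-1` [set t | t < z]); split=> //; last first.
      by rewrite /= => h; move: (lt_trans h zy); rewrite ltxx.
    split; first by exists [set t | t < z] => //; exact: open_lt.
    have -> : set_val @^-1` [set t | t < z] = set_val @^-1` [set t | t <= z] :> set (set_type A).
      apply/seteqP; split=> t /=; first exact: ltW.
      rewrite le_eqVlt => /predU1P[e|//].
      by case: nz; rewrite -e; exact: set_mem (valP t).
    by apply: closed_comp (@closed_le _ z) => t _; exact: initial_continuous.
  move=> x y xy.
  have : set_val x != set_val y by apply: contra xy => /eqP/val_inj ->.
  rewrite neq_lt => /orP[/sep//|/sep[U [cU Uy nUx]]].
  exists (~` U); split=> //.
  by case: cU => oU cU; split; [exact: closed_openC|exact: open_closedC].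
split=> //.
- apply/perfectTP => x [W oW hW].
  have Wx : W (set_val x) by have : [set x] x by []; rewrite -hW.
  have /nbhs_ballP[e /= e0 he] : nbhs (set_val x) W by apply: open_nbhs_nbhs.
  have [y [Ay yx xy]] := hp _ _ (set_mem (valP x)) e0.
  have : (set_val @^-1` W) (exist _ y (mem_set Ay) : set_type A) by exact: he.
  by rewrite hW /= => /(congr1 set_val).
- exact: compact_set_type.
move=> x y; apply: contraPP => /eqP/zd[U [[oU cU] Ux nUy]] cl.
have [|//|z [Uz nUz]] := cl U (~` U).
- exact: open_nbhs_nbhs.
- by apply: open_nbhs_nbhs; split=> //; exact: closed_openC.
exact: nUz.
Qed.

Lemma cantor_part_nonempty : cantor_part R !=set0.
Proof.
(* The witness has gamma = ...111. *)
pose tl (i : nat) := 1%N; pose s := rev wr ++ Kl; pose e := nseq 16 1%N.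
have hs : ~~ hasw forbidden (s ++ e) by vm_compute.
have {hs}hu : uavoid (rcat (s ++ e) tl) by exact: uavoid_rcat hs.
pose B := biseq tl (rev (Kl ++ e)) wr (rperiodic w).
have hl : ltail B 0 = rcat (Kl ++ e) tl by rewrite /B ltail_biseq revK.
have hr : rtail B 0 = perR by rewrite /B rtail_biseq rcat_wr.
clearbody B.
have hN : nform B by split=> //; rewrite hl rcat_cat; exact: pre_rcat.
have h3 : letters123 B.
  apply: perR_letters123 => // n; rewrite hl /rcat; case: (ltnP n (size (Kl ++ e))) => // ilt.
  exact: (allP (isT : all (mem [:: 1; 2; 3]%N) (Kl ++ e)) _ (mem_nth 0%N ilt)).
exists (lam B 0); apply/cantor_partP; exists B; split=> //.
apply/(cform_uavoid hN h3); rewrite (nform_ltail6 hN) hl -rcat_cat catA.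
exact: hu.
Qed.

Lemma cantor_part_compact : compact (cantor_part R).
Proof.
apply: (subclosed_compact (@cantor_part_closed R) (@segment_compact R 0 5)).
move=> x /cantor_partP[B [[B3 hN _] <-]].
rewrite /= in_itv /=; have := lambda_ge R 0 (letters123_pos B3); have := lambda_lt R 0 (letters123_pos B3).
have := ler0n R (B 0); have : (B 0)%:R <= 3 :> R by rewrite ler_nat; have := B3 0; case: (B 0) => [|[|[|[|]]]].
by move=> *; apply/andP; split; lra.
Qed.

Lemma cantor_part_cantor : cantor_set (cantor_part R).
Proof.
apply: cantor_setP.
- exact: cantor_part_nonempty.
- exact: cantor_part_compact.
- by move=> x e hx e0; exact: cantor_part_perturb.
exact: cantor_part_gap.
Qed.

End RealCantor.

(** * The two-sided sequences *)

Definition exceptional_words : seq (seq nat) :=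
  [:: word 122211212121212112221; word 1222112121212112221; word 12221121212112221].

Lemma overlap_check :
  all (fun m => (drop m (rev Kw ++ drop (11 - m) Kw) == Kw) ==>
                (rev Kw ++ drop (11 - m) Kw \in exceptional_words)) (iota 0 11).
Proof. by vm_compute. Qed.

(** With at least 22 letters the two ends of [v] are disjoint and theta is what lies between them;
    otherwise they overlap, which leaves only the words of X. *)
Lemma middle_cases (v t t' : seq nat) : v = t ++ Kw -> v = rev Kw ++ t' ->
  (exists th, v = rev Kw ++ th ++ Kw) \/ v \in exceptional_words.
Proof.
move=> e1 e2.
have s1 : size v = (size t + 11)%N by rewrite e1 size_cat.
have s2 : size v = (11 + size t')%N by rewrite e2 size_cat.
have [le|lt] := leqP 11 (size t).
  left; exists (drop 11 t); rewrite catA {1}e1; congr (_ ++ _).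
  have h1 : take 11 v = take 11 t by rewrite e1 takel_cat.
  have h2 : take 11 v = rev Kw by rewrite e2 (take_size_cat t' (erefl : size (rev Kw) = 11%N)).
  by rewrite -{1}(cat_take_drop 11 t) -h1 h2.
right.
have et' : t' = drop (11 - size t) Kw.
  have := congr1 (drop 11) e1; rewrite {1}e2 (drop_size_cat t' (erefl : size (rev Kw) = 11%N)).
  by move=> ->; rewrite drop_cat ltnNge (ltnW lt).
have hi : size t \in iota 0 11 by rewrite mem_iota.
have : (drop (size t) (rev Kw ++ drop (11 - size t) Kw) == Kw) ==>
  (rev Kw ++ drop (11 - size t) Kw \in exceptional_words) := allP overlap_check _ hi.
rewrite -et' -e2 => /implyP; apply.
by rewrite e1 drop_size_cat.
Qed.

(** Keeps the mirrored start of a run from reaching beyond 21212112221, so that the middle word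
    contains both ends. *)
Lemma revKw_check : ~~ before (rev Kw) && ~~ has (inside (rev Kw)) (iota 0 22).
Proof. by vm_compute. Qed.

Section TwoSided.
Variable R : realType.
Notation lam := (lambda R).
Notation below_j1 := (below_j1 R).

Lemma nform_atL0 B : nform B -> atL B 0.
Proof.
move=> [hl hr]; split; last by rewrite hr (_ : Lr = wR) //; exact: pre_rperiodic.
by move: hl; rewrite (_ : Kl = Ll ++ drop 10 Kl) // => /pre_cat[].
Qed.

Lemma nform_atL_ge0 B k : below_j1 B -> nform B -> atL B k -> 0 <= k.
Proof.
move=> Bs hN hk; rewrite leNgt; apply/negP => k0.
have hs := @step_ind (atL B) k 11 hk (fun q => @atL_next R B q Bs).
pose r := (absz k %% 11)%N; pose m := (absz k %/ 11)%N.
have rlt : (r < 11)%N by rewrite ltn_mod.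
have em : absz k = (m * 11 + r)%N := divn_eq _ _.
have [r0|r0] := posnP r.
  have [m' em'] : exists m', m = m'.+1 by case: (m) em r0 => [|m' _ _]; [lia|exists m'].
  have := hs m'; have -> : k + 11 * m'%:Z = - 11 by lia.
  (* At -11 the word 22221 w 11122 asks for a 2 where the start 12221 w of the run has a 1. *)
  move=> [/preP/(_ 9%N isT) h _]; move/preP: hN.1 => /(_ 20%N isT).
  by rewrite [LHS](_ : _ = ltail B (- 11) 9) ?h // /ltail; congr B.
apply: (@atL_overlap B (- r%:Z) r) => //; last by rewrite addNr; exact: nform_atL0.
by have := hs m; have -> : k + 11 * m%:Z = - r%:Z by lia.
Qed.

Lemma nform_twoform B k : below_j1 B -> nform B -> atR B k ->
  exists v, [/\ twoform v B, exists t, v = t ++ Kw & exists t', v = rev Kw ++ t'].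
Proof.
move=> Bs hN hk; have /atR_rev hk' := hk.
have [_ [hall|[n [hn hn2 _]]]] := atL_dichotomy (below_j1_rev Bs) hk'.
  (* A run of the transpose that is infinite to the right would enter the right half, against
     [nform_atR]. *)
  have /atR_rev : atL (revB B) (- (k + 11 * (absz k)%:Z)) by rewrite opprD; exact: hall.
  by move=> /(nform_atR hN); lia.
set c := - k - 11 * n%:Z in hn hn2; pose s := - c.
have ec : c = - s by rewrite opprK.
clearbody c; rewrite ec in hn hn2 *; clear ec; clearbody s.
have hs : atR B s by apply/atR_rev.
have s27 := nform_atR hN hs.
have [hl hr] := hn; rewrite ltail_tr add0r ltail_rev in hl; rewrite rtail_tr add0r rtail_rev in hr.
rewrite opprK in hl hr.
have hKw : pre (rev Kw) (rtail B (s + 17)).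
  move: hl; rewrite (_ : Kl = (rev wl ++ rev w) ++ rev Kw) // => /pre_cat[_].
  rewrite shift_rtail (_ : size (rev wl ++ rev w) = 16%N) //.
  by have -> : 1 + s + 16%N%:Z = s + 17 by lia.
have s44 : s + 28 <= - 16.
  rewrite leNgt; apply/negP => h; have /andP[/negP k1 /negP k2] := revKw_check.
  have [||//|[a [m [alt2 ha _]]]] := nform_occ hN _ hKw.
  - by [].
  - by rewrite (_ : size (rev Kw) = 11%N) //; lia.
  by apply: k2; apply/hasP; exists a => //; rewrite mem_iota.
have [m em] : exists m : nat, - 44 - s = m%:Z by exists (absz (- 44 - s)%R); lia.
(* The middle word fills the positions from s + 17, just after the last transposed copy of [w], to
   -17. *)
pose v := mkseq (rtail B (s + 17)) (m + 11).
have sv : size v = (m + 11)%N by rewrite size_mkseq.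
have hv : pre v (rtail B (s + 17)) by exact: pre_mkseq.
exists v; split.
- split; last exact: hN.2.
  have h16 : pre (rev wl ++ rev w) (ltail B 0).
    by move: hN.1; rewrite (_ : Kl = (rev wl ++ rev w) ++ rev Kw) // => /pre_cat[].
  rewrite catA rcat_cat {1}(rcat_shift h16); congr rcat.
  rewrite shift_ltail (_ : 0 - (size (rev wl ++ rev w))%:Z = s + 17 + (size v)%:Z); last first.
    by rewrite sv (_ : size (rev wl ++ rev w) = 16%N) //; lia.
  rewrite (ltail_cat hv); congr rcat.
  have := rtail_cat (B := trB (- s) (revB B)) (k := 0) (l := rev wl ++ rev w).
  rewrite !rtail_tr !ltail_tr !add0r !rtail_rev !ltail_rev !opprK.
  have -> : 1 - (0 - (size (rev wl ++ rev w))%:Z - s) = s + 17.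
    by rewrite (_ : size (rev wl ++ rev w) = 16%N) //; lia.
  move=> -> //; last first.
    by move: hl; rewrite (_ : Kl = (rev wl ++ rev w) ++ rev Kw) // => /pre_cat[].
  by rewrite hr -rcat_wr -rcat_cat (_ : rev (rev wl ++ rev w) ++ wr = w ++ w) // rcat_ww.
- exists (mkseq (rtail B (s + 17)) m); rewrite /v mkseqD shift_rtail; congr (_ ++ _).
  have -> : s + 17 + m%:Z = - 27 by lia.
  by rewrite (nform_start hN) (_ : mkseq _ 11 = Kw).
exists (mkseq (shift 11 (rtail B (s + 17))) m); rewrite /v addnC mkseqD; congr (_ ++ _).
exact: hKw.
Qed.

(** The condition on theta compares finite fractions, the values compare infinite ones. The
    ambiguity [..., a, 1] = [..., a + 1] cannot interfere for equal lengths; this is the case c <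
    d. *)
Lemma cft_le_transfer s t (x : R) : all (fun c => (0 < c)%N) s -> all (fun c => (0 < c)%N) t ->
  size s = size t -> 0 < x < 1 -> cft s 0 <= cft t (0 : R) -> cft s x <= cft t x.
Proof.
move=> + + + /andP[x0 x1].
have i01 u (y : R) : all (fun c => (0 < c)%N) u -> 0 <= y <= 1 -> 0 <= cft u y <= 1 by exact: cft_itv.
have [n] := ubnP (size s); elim: n s t => // n ih [|c s] [|d t] //= sn.
move=> /andP[c0 sp] /andP[d0 tp] [st].
have c1 : 1 <= c%:R :> R by rewrite ler1n.
have d1 : 1 <= d%:R :> R by rewrite ler1n.
have /andP[a1 a2] := i01 s 0 sp ltac:(lra); have /andP[b1 b2] := i01 t 0 tp ltac:(lra).
have /andP[a3 a4] := i01 s x sp ltac:(lra); have /andP[b3 b4] := i01 t x tp ltac:(lra).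
rewrite !lef_pV2 ?posrE; [|lra..] => h.
case: (ltngtP c d) => cd.
- have cd1 : c%:R + 1 <= d%:R :> R by rewrite natr1 ler_nat.
  have t0 : cft t 0 = 0 :> R by lra.
  have s1 : cft s 0 = 1 :> R by lra.
  case: t t0 tp st {ih b1 b2 b3 b4 h} => [|b t] /= t0.
    by move=> _ /eqP/nilP es; move: s1; rewrite es /=; lra.
  move=> /andP[b0 tp] _; have /andP[u1 _] := i01 t 0 tp ltac:(lra).
  have b1 : 1 <= b%:R :> R by rewrite ler1n.
  have : 0 < (b%:R + cft t 0)^-1 :> R by rewrite invr_gt0; lra.
  by rewrite t0 ltxx.
- have cd1 : d%:R + 1 <= c%:R :> R by rewrite natr1 ler_nat.
  lra.
rewrite cd in h *; rewrite lerD2l; apply: ih; rewrite -?st //.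
by move: h; rewrite lerD2l.
Qed.

Lemma cf_fin_le s t E : all (fun c => (0 < c)%N) s -> all (fun c => (0 < c)%N) t ->
  size s = size t -> pos E ->
  (cf_fin R s <= cf_fin R t) <-> (cf R (rcat s E) <= cf R (rcat t E)).
Proof.
move=> sp tp st Ep; have E01 := cf_itv R Ep.
have tr u v : all (fun c => (0 < c)%N) u -> all (fun c => (0 < c)%N) v -> size u = size v ->
    cf_fin R u <= cf_fin R v -> cf R (rcat u E) <= cf R (rcat v E).
  by move=> up vp uv h; rewrite !cf_rcat //; exact: cft_le_transfer.
split; first exact: tr.
move=> h; rewrite leNgt; apply/negP => lt.
have h' := tr t s tp sp (esym st) (ltW lt).
have e : rcat s E = rcat t E.
  by apply: (@cf_inj R); [exact: pos_rcat|exact: pos_rcat|apply/le_anti; rewrite h h'].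
have est : s = t by rewrite -(pre_rcat s E) e st; exact: pre_rcat.
by rewrite est ltxx in lt.
Qed.

Lemma pos_E : pos (rcat Kw (rperiodic w)).
Proof.
apply: pos_rcat => // i; rewrite /rperiodic.
have : (i %% size w < size w)%N by rewrite ltn_mod.
by move=> /(mem_nth 0%N); apply: (allP (isT : all (fun c => (0 < c)%N) w)).
Qed.

(** From the two stars one reads [Kl] and then [rev th] or [th], followed by the same tail. The 27
    letters of [Kl] reverse the order, whence the direction of the inequality. *)
Lemma twoform_order (th : seq nat) B : all (mem [:: 1; 2; 3]%N) th ->
  twoform (rev Kw ++ th ++ Kw) B ->
  (lam (mirror (rev Kw ++ th ++ Kw) B) 0 <= lam B 0) <-> (cf_fin R (rev th) <= cf_fin R th).
Proof.
move=> /allP th3 hB; set v := rev Kw ++ _ in hB *.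
have [hl' hr'] := twoform_mirror hB; have [hl hr] := hB.
rewrite (lambda_perR R hr) (lambda_perR R hr') lerD2l.
have thp : all (fun c => (0 < c)%N) th.
  by apply/allP => c /th3; rewrite !inE => /or3P[] /eqP ->.
have rthp : all (fun c => (0 < c)%N) (rev th) by rewrite all_rev.
rewrite (cf_fin_le rthp thp _ pos_E) ?size_rev //.
have -> : ltail B 0 = rcat Kl (rcat (rev th) (rcat Kw (rperiodic w))).
  by rewrite hl /v !rev_cat revK -!rcat_cat; congr rcat; rewrite -!catA.
have -> : ltail (mirror v B) 0 = rcat Kl (rcat th (rcat Kw (rperiodic w))).
  by rewrite hl' /v revK -!rcat_cat; congr rcat; rewrite -!catA.
have p1 := pos_rcat rthp pos_E; have p2 := pos_rcat thp pos_E.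
rewrite (cf_rcat R _ p1) // (cf_rcat R _ p2) //.
have /andP[a1 _] := cf_itv R p1; have /andP[a2 _] := cf_itv R p2.
have Kp : all (fun c => (0 < c)%N) Kl by [].
split=> h; last by have := cft_mono_le Kp (ltW a1) h.
rewrite leNgt; apply/negP => h'; have := cft_mono Kp (ltW a2) h'.
by rewrite /= ltNge h.
Qed.

Lemma twoform_exists v : exists B, twoform v B /\ lam B 0 = two_sided_value R v.
Proof.
exists (biseq (lperiodic (rev w)) (rev w ++ rev w ++ v ++ w ++ wl) wr (rperiodic w)).
split=> //; split; last by rewrite rtail_biseq rcat_wr.
rewrite ltail_biseq /lperiodic revK.
have -> : rev (rev w ++ rev w ++ v ++ w ++ wl) = (rev wl ++ rev w ++ rev v) ++ w ++ w.
  by rewrite !rev_cat !revK -!catA.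
by rewrite rcat_cat rcat_ww.
Qed.

Lemma twoform_value v B : twoform v B -> lam B 0 = two_sided_value R v.
Proof.
move=> [hl hr]; have [B' [[hl' hr'] <-]] := twoform_exists v.
by congr lam; apply: tails_eq; rewrite ?hl ?hr.
Qed.

Lemma twoform_letters v B : all (mem [:: 1; 2; 3]%N) v -> twoform v B -> letters123 B.
Proof.
move=> v3 [hl hr]; apply: perR_letters123 => // n; rewrite hl /rcat.
case: (ltnP n (size _)) => [ilt|_].
  have : all (mem [:: 1; 2; 3]%N) (rev wl ++ rev w ++ rev v).
    by rewrite !all_cat !all_rev v3.
  by move=> /allP; apply; exact: mem_nth.
rewrite /rperiodic; set i := (n - _)%N; have : (i %% size w < size w)%N by rewrite ltn_mod.
by move=> /(mem_nth 0%N); apply: (allP (isT : all (mem [:: 1; 2; 3]%N) w)).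
Qed.

Definition admissible (v : seq nat) : Prop :=
  [/\ all (mem [:: 1; 2; 3]%N) v, forall f : seq nat, f \in forbidden -> ~~ infix f v,
      exists t, v = t ++ Kw & exists t', v = rev Kw ++ t'].

(** D and X together: the starred end of the middle word is required to be at least as good as the
    mirrored one, a condition that makes sense without theta. *)
Definition two_sided_set : set R :=
  [set x | exists v B, [/\ admissible v, twoform v B, lam B 0 = x &
    lam (mirror v B) 0 <= lam B 0]].

Lemma exceptional_check :
  all (fun v => [&& all (mem [:: 1; 2; 3]%N) v, ~~ has (fun f => infix f v) forbidden,
    v == take (size v - 11) v ++ Kw, v == rev Kw ++ drop 11 v & rev v == v]) exceptional_words.
Proof. by vm_compute. Qed.

Lemma two_sided_setE : two_sided_set = two_sided_part R `|` exceptional_part R.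
Proof.
have ex v : v \in exceptional_words -> two_sided_set (two_sided_value R v).
  move=> /(allP exceptional_check)/and5P[h1 h2 /eqP h3 /eqP h4 /eqP h5].
  have [B [hB <-]] := twoform_exists v; exists v, B; split=> //.
    split=> //; [|by exists (take (size v - 11) v)|by exists (drop 11 v)].
    by move=> f fF; apply: contra h2 => hf; apply/hasP; exists f.
  by have := twoform_mirror hB; rewrite h5 => /twoform_value ->; rewrite (twoform_value hB).
apply/seteqP; split=> x.
  move=> [v [B [[v3 hF [t et] [t' et']] hB <- hle]]]; rewrite (twoform_value hB).
  have [[th eth]|] := middle_cases et et'.
    left; exists th; rewrite [word 12221121212](_ : _ = rev Kw) // -[word 21212112221]/Kw -eth.
    have th3 : all (mem [:: 1; 2; 3]%N) th.
      by move: v3; rewrite eth !all_cat => /and3P[].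
    split=> //; rewrite eth in hB hle.
    exact: (twoform_order th3 hB).1.
  rewrite !inE => /or3P[] /eqP ->; right; [by left; left|by left; right|by right].
move=> [[th]|].
  rewrite [word 12221121212](_ : _ = rev Kw) // -[word 21212112221]/Kw.
  move=> [th3 hle hF ->]; have [B [hB <-]] := twoform_exists (rev Kw ++ th ++ Kw).
  exists (rev Kw ++ th ++ Kw), B; split=> //.
    split=> //; first by rewrite !all_cat th3.
      by exists (rev Kw ++ th); rewrite catA.
    by exists (th ++ Kw).
  by apply/(twoform_order th3 hB).
by move=> [[->|->]|->]; apply: ex; rewrite !inE eqxx ?orbT.
Qed.

Lemma two_sided_max v B : admissible v -> twoform v B -> lam (mirror v B) 0 <= lam B 0 ->
  [/\ letters123 B, nform B & forall k, lam B k <= lam B 0].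
Proof.
move=> [v3 hF [t et] [t' et']] hB hle.
have B3 := twoform_letters v3 hB.
rewrite et in hB hF hle et'.
split=> //; first exact: twoform_nform hB.
exact: twoform_max B3 hB et' hF hle.
Qed.

End TwoSided.

(** * The two spectra between [i1] and [j1] *)

Section Final.
Variable R : realType.
Notation lam := (lambda R).
Notation below_j1 := (below_j1 R).
Notation i1_val := (i1_val R).
Notation j1_val := (j1_val R).
Notation j0_val := (j0_val R).

Lemma limn_esup_const (u : nat -> R) (x : R) : (forall n, u n <= x) ->
  (forall n, exists2 m, (n <= m)%N & u m = x) -> limn_esup (fun n => (u n)%:E) = x%:E.
Proof.
move=> hle hex; rewrite limn_esup_lim.
have -> : esups (fun n => (u n)%:E) = (fun _ => x%:E).
  apply/funext => n; apply/le_anti/andP; split.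
    by apply: ge_ereal_sup => _ [m _ <-]; rewrite lee_fin.
  by have [m nm um] := hex n; apply: ereal_sup_ubound; exists m => //; rewrite um.
exact: lim_cst.
Qed.

Lemma periodic_lagrange B : posB B -> rtail B 0 = perR -> ltail B 0 = perL ->
  (forall k, lam B k <= j0_val) -> lagrange_spectrum R j0_val.
Proof.
move=> Bp hr hl hle; exists B; split=> //.
have hR m : rtail B (11 * m%:Z) = perR by rewrite -(shift_perR m) -hr shift_rtail add0r PoszM.
have hL m : ltail B (11 * m%:Z) = perL.
  elim: m => [|m ih]; first by rewrite mulr0.
  have pw : pre wR (rtail B (11 * m%:Z)) by rewrite hR; exact: pre_rperiodic.
  have := ltail_cat pw; rewrite ih (_ : rev wR = wL) // rcat_per1 // => h; rewrite /perL -h.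
  by congr ltail; rewrite (_ : size wR = 11)%N //; lia.
apply: limn_esup_const => [n|n]; first exact: hle.
exists (11 * n)%N; first by rewrite leq_pmull.
by rewrite PoszM; exact: lambda_per.
Qed.

(** A sequence attaining [j0] cannot contain the start of a run, whose value would be larger; so it
    is periodic up to reversal, and its value recurs for ever. *)
Lemma markov_j0_lagrange : markov_spectrum R j0_val -> i1_val < j0_val -> j0_val < j1_val ->
  lagrange_spectrum R j0_val.
Proof.
move=> hM hI hJ.
have [|B [B3 hle h0]] := markov_attained hM; first exact: lt_le_trans hJ (j1_lt4 R).
have Bs : below_j1 B by split; [exact: letters123_pos|move=> k; exact: le_lt_trans (hle k) hJ].
have key B' : below_j1 B' -> (forall k, lam B' k <= j0_val) -> atL B' 0 -> lagrange_spectrum R j0_val.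
  move=> Bs' hle' hat; have [hr [hl|[n [hn _ _]]]] := atL_dichotomy Bs' hat.
    exact: periodic_lagrange Bs'.1 hr (atL_perL hl) hle'.
  have := nform_gt_j0 R (pos_trB _ Bs'.1) hn.
  by rewrite lambda_tr ltNge hle'.
have [|hat|hat] := lambda_dichotomy R 0 B3 (below_j1_avoids Bs).
- by rewrite h0 leNgt hI.
- exact: key hat.
apply: (key (revB B)); first exact: below_j1_rev.
- by move=> k; rewrite lambda_rev.
by have := atR_rev B 0; rewrite oppr0 => <-.
Qed.

Lemma nform_spectrum B (x : R) : letters123 B -> nform B -> lam B 0 = x -> (forall k, lam B k <= x) ->
  [/\ markov_spectrum R x, ~ lagrange_spectrum R x, i1_val < x & x < j1_val].
Proof.
move=> B3 hN <- hle; have Bp := letters123_pos B3.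
have /andP[h1 h2] := nform_bounds R Bp hN.
split=> //; first by exists B; split=> //; exact: markov_value_eq.
move=> /lagrange_j0/(_ h1 h2) e.
by have := nform_gt_j0 R Bp hN; rewrite e ltxx.
Qed.

Lemma cantor_part_spectrum (x : R) : cantor_part R x ->
  [/\ markov_spectrum R x, ~ lagrange_spectrum R x, i1_val < x & x < j1_val].
Proof.
move=> /cantor_partP[B [hC h0]]; have [B3 hN _] := hC.
by apply: (nform_spectrum B3 hN h0) => k; rewrite -h0; exact: cform_max.
Qed.

Lemma two_sided_spectrum (x : R) : @two_sided_set R x ->
  [/\ markov_spectrum R x, ~ lagrange_spectrum R x, i1_val < x & x < j1_val].
Proof.
move=> [v [B [va hB h0 hle]]]; have [B3 hN hm] := two_sided_max va hB hle.
by apply: (nform_spectrum B3 hN h0) => k; rewrite -h0.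
Qed.

(** Outside [cform] some forbidden word ends by position 6. Those of [forb0] never occur and 22221 w
    11122 occurs only from the star on, so it is the transpose of the latter, which makes the
    sequence two-sided. *)
Lemma nform_cases B (x : R) : below_j1 B -> (forall k, lam B k <= x) -> lam B 0 = x -> nform B ->
  cantor_part R x \/ @two_sided_set R x.
Proof.
move=> Bs hle h0 hN; have B3 := below_j1_letters123 Bs; have Ba := below_j1_avoids Bs.
have [hC|hC] := pselect (cform B); first by left; apply/cantor_partP; exists B.
right.
have hocc B' p : below_j1 B' -> nform B' -> p + 21 <= 6 -> ~ occ B' p last_word.
  move=> Bs' hN' hp ho.
  have hat : atL B' (p + 10) by exact: (@occ_win B' p Ll Lr ho).
  by have := nform_atL_ge0 Bs' hN' hat; lia.
have hforb (f : seq nat) : f \in forbidden -> [\/ f = last_word, f = rev last_word | f \in forb0].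
  by move=> /(allP forbidden_forb0)/or3P[/eqP|/eqP|]; [exact: Or31|exact: Or32|exact: Or33].
have [p [hp ho]] : exists p, p + 21 <= 6 /\ occ B p (rev last_word).
  apply: contrapT => hno; apply: hC; split=> // f /hforb[->|->|fF] p hp ho.
  - exact: hocc ho.
  - by apply: hno; exists p.
  - exact: Ba ho.
have hat : atR B (p + 10) by exact: (@occ_win B p (behead Lr) (3%N :: Ll) ho).
have [v [hB [t et] [t' et']]] := nform_twoform Bs hN hat.
exists v, B; split=> //; last by rewrite lambda_mirror h0.
have hN' : nform (mirror v B).
  have := twoform_mirror hB; rewrite {1}et' rev_cat revK; exact: twoform_nform.
have Bs' : below_j1 (mirror v B) by exact/below_j1_tr/below_j1_rev.
have hmid := twoform_middle hB.
split; [| |by exists t|by exists t'].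
  by rewrite -hmid; apply/allP => c /mapP[i _ ->]; exact: B3.
move=> f fF; apply/negP => /infixP[a [b eab]].
have hof : occ B (- 16 - (size v)%:Z + (size a)%:Z) f.
  move: hmid; rewrite {1}eab => /pre_cat[_ /pre_cat[+ _]].
  by rewrite shift_rtail.
have sv : size v = (size a + (size f + size b))%N by rewrite eab !size_cat.
have [e|e|e] := hforb f fF.
- rewrite e in hof sv; apply: hocc Bs hN _ hof.
  by rewrite (_ : size last_word = 21%N) // in sv; lia.
- rewrite e in hof sv; have := mirror_occ v hof; rewrite revK; apply: hocc => //.
  by rewrite (_ : size (rev last_word) = 21%N) // in sv *; lia.
exact: Ba hof.
Qed.

(** The normal form is determined by its value, so sequences with values near x agree with [B] on a
    window containing both stars. The runs beyond the stars are then forced, and the sequences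
    coincide. *)
Lemma two_sided_isolated (x : R) : @two_sided_set R x -> isolated (markov_spectrum R) x.
Proof.
move=> hx; have [hM hnL hI hJ] := two_sided_spectrum hx.
split; first exact: mem_set.
apply: contrapT => hno.
have [v [B [va hB h0 hle]]] := hx; have [B3 hN hm] := two_sided_max va hB hle.
have hj : j0_val < x by rewrite -h0; exact: nform_gt_j0 (letters123_pos B3) hN.
(* Within d of x, a Markov value lies in the interval and is not [j0], so the classification applies
   to it. *)
pose d := Num.min (x - i1_val) (Num.min (j1_val - x) (x - j0_val)).
have d0 : 0 < d by rewrite /d !lt_min; apply/and3P; split; lra.
have hseq (j : nat) : exists y, [/\ markov_spectrum R y, y <> x,
    `|y - x| < d & `|y - x| < j.+1%:R^-1].
  apply: contrapT => hn; apply: hno.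
  have e0 : 0 < Num.min d j.+1%:R^-1 by rewrite lt_min d0 /= invr_gt0 ltr0n.
  exists (ball x (Num.min d j.+1%:R^-1)); first exact: nbhsx_ballx.
  apply/seteqP; split=> [y [yb yM]|y ->]; last by split=> //; exact: ballxx.
  apply: contrapT => yx; apply: hn; exists y.
  move: yb; rewrite /ball /= distrC lt_min => /andP[h1 h2]; by split.
have hB' (j : nat) : exists B', [/\ below_j1 B', nform B', lam B' 0 <> x &
    `|lam B' 0 - x| < j.+1%:R^-1].
  have [y [yM yx yd yj]] := hseq j.
  move: yd; rewrite /d !lt_min !ltr_norml => /and3P[/andP[a1 a2] /andP[a3 a4] /andP[a5 a6]].
  have [|||B' [Bs' _ e hN']] := @markov_classification R y yM; try lra.
  by exists B'; split=> //; rewrite e.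
have [Bs hBs] := choice hB'.
have [j|j|e e0|B' [B3' hN' hx' hag]] := @nform_limit R Bs x.
- by have [/below_j1_letters123] := hBs j.
- by have [] := hBs j.
- have [m hm'] := inv_natS_lt e0; exists m => j /hm'; apply: lt_trans; by have [] := hBs j.
have eB : B' = B.
  apply: tails_eq; last by rewrite hN'.2 hN.2.
  apply: (@nform_inj R) hN'.2 hN.2 _; [exact: letters123_pos|exact: letters123_pos|by rewrite hx' h0].
rewrite {}eB in hag; clear B' B3' hN' hx'.
have [j [_ ag]] := hag 0%N (size v + 100)%N.
have [Bs1 hN1 hne _] := hBs j.
apply: hne; rewrite -h0.
pose s := - (size v)%:Z - 33.
have hmN : nform (mirror v B).
  have [_ _ _ [t' et']] := va; have := twoform_mirror hB.
  by rewrite {1}et' rev_cat revK; exact: twoform_nform.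
have hs : atR B s.
  apply/(mirror_atR v); rewrite /s.
  have -> : - (- (size v)%:Z - 33) - (size v)%:Z - 33 = 0 by lia.
  exact: nform_atL0.
have hs1 : atR (Bs j) s by apply: (agree_atR (agree_sym ag)) hs; rewrite /s; lia.
(* To the left of the mirrored star [s] nothing is free: the transposed run is infinite. *)
have hl B1 : below_j1 B1 -> atR B1 s -> ltail B1 (s + 1) = perR.
  move=> Bs2 /atR_rev hat; have [+ _] := atL_dichotomy (below_j1_rev Bs2) hat.
  by rewrite rtail_rev opprK addrC.
have BsB : below_j1 B by split; [exact: letters123_pos|move=> k; rewrite (le_lt_trans (hm k)) // h0].
congr lam; apply: tails_eq; last by rewrite hN1.2 hN.2.
apply/funext => i.
have [lt|ge] := leqP i (size v + 50).
  by rewrite /ltail ag //; lia.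
have e1 := congr1 (fun F => F (i - (size v + 32))%N) (hl _ Bs1 hs1).
have e2 := congr1 (fun F => F (i - (size v + 32))%N) (hl _ BsB hs).
have eq1 C : ltail C (s + 1) (i - (size v + 32))%N = ltail C 0 i.
  by rewrite /ltail /s; congr C; lia.
by rewrite -!eq1 e1 e2.
Qed.

Lemma spectrum_classification :
  (markov_spectrum R `\` lagrange_spectrum R)
    `&` [set x : R | (i1 R < x%:E < j1 R)%E] = cantor_part R `|` @two_sided_set R.
Proof.
apply/seteqP; split=> x.
  move=> [[hM hL]]; rewrite /= i1_eq j1_eq !lte_fin => /andP[hI hJ].
  have hj : x <> j0_val by move=> e; apply: hL; rewrite e in hM hI hJ *; exact: markov_j0_lagrange.
  have [B [Bs hle h0 hN]] := markov_classification hM hI hJ hj.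
  exact: nform_cases Bs hle h0 hN.
rewrite /= i1_eq j1_eq !lte_fin.
by move=> [/cantor_part_spectrum|/two_sided_spectrum] [h1 h2 h3 h4]; split; rewrite ?h3.
Qed.

End Final.

Theorem mainTheorem4 (R : realType) :
  [/\ (markov_spectrum R `\` lagrange_spectrum R)
        `&` [set x : R | (i1 R < x%:E < j1 R)%E]
      = cantor_part R `|` two_sided_part R `|` exceptional_part R,
      cantor_set (cantor_part R),
      two_sided_part R `<=` isolated (markov_spectrum R)
    & exceptional_part R `<=` isolated (markov_spectrum R)].
Proof.
split.
- by rewrite spectrum_classification two_sided_setE setUA.
- exact: cantor_part_cantor.
- by move=> x hx; apply: two_sided_isolated; rewrite two_sided_setE; left.
by move=> x hx; apply: two_sided_isolated; rewrite two_sided_setE; right.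
Qed.
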